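(* There is an isomorphism of $({\boldsymbol{\mathcal S}}(\infty,r),{\boldsymbol{\mathcal H}})$-bimodules $${\bf\Omega}_\infty^{\otimes r}\cong\bigoplus_{\mu\in\Lambda^+(r)}W(\infty,\mu)\otimes S^\mu.$$ Hence ${\bf\Omega}_\infty^{\otimes r}$ is completely reducible as a left ${\boldsymbol{\mathcal S}}(\infty,r)$-module.
   Context: $v$ indeterminate. ${\bf\Omega}_\infty$ is the $\mathbb Q(v)$-space with basis $\{\omega_i\}_{i\in\mathbb Z}$. ${\boldsymbol{\mathcal H}}$ is the Hecke algebra of the symmetric group $\mathfrak S_r$ over $\mathbb Q(v)$ with basis $\{\mathcal T_w\}$: $\mathcal T_s\mathcal T_w=\mathcal T_{sw}$ if $\ell(sw)>\ell(w)$ and $=(v-v^{-1})\mathcal T_w+\mathcal T_{sw}$ otherwise ($s$ simple transposition); $T_w=v^{\ell(w)}\mathcal T_w$. ${\boldsymbol{\mathcal H}}$ acts on the right of ${\bf\Omega}_\infty^{\otimes r}$ by $(\omega_{i_1}\cdots\omega_{i_r})\mathcal T_{(j,j+1)}=\omega_{i_1}\cdots\omega_{i_{j+1}}\omega_{i_j}\cdots\omega_{i_r}$ if $i_j<i_{j+1}$; $=v\,\omega_{i_1}\cdots\omega_{i_r}$ if $i_j=i_{j+1}$; $=(v-v^{-1})\omega_{i_1}\cdots\omega_{i_r}+\omega_{i_1}\cdots\omega_{i_{j+1}}\omega_{i_j}\cdots\omega_{i_r}$ if $i_j>i_{j+1}$. ${\boldsymbol{\mathcal S}}(\infty,r)=\operatorname{End}_{\boldsymbol{\mathcal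 H}}({\bf\Omega}_\infty^{\otimes r})$ (infinite $q$-Schur algebra). Compositions: $\Lambda(\infty,r)$ is the set of finitely supported $\lambda\in\mathbb N^{\mathbb Z}$ with $\sum\lambda_i=r$; $\Lambda^+(r)\subseteq\Lambda(\infty,r)$ the partitions of $r$ ($\lambda_i=0$ for $i\le0$, $\lambda_1\ge\lambda_2\ge\cdots$). For $\lambda\in\Lambda(\infty,r)$, let $\Omega_\lambda$ be the span of the $\omega_{i_1}\otimes\cdots\otimes\omega_{i_r}$ with $\#\{j:i_j=k\}=\lambda_k$ for all $k$, and $\omega_\lambda$ the such tensor with $i_1\le\cdots\le i_r$; $\mathfrak S_\lambda$ is the Young subgroup stabilizing the consecutive blocks of $\{1,\dots,r\}$ of sizes $\lambda_i$ (in increasing order of $i$), $x_\lambda=\sum_{w\in\mathfrak S_\lambda}T_w$; then $\Omega_\lambda\cong x_\lambda{\boldsymbol{\mathcal H}}$ via $\omega_\lambda h\mapsto x_\lambda h$. $\varpi\in\Lambda(\infty,r)$ has $\varpi_i=1$ for $1\le i\le r$ and $0$ otherwise; $\Omega_\varpi$ is free of rank one over ${\boldsymbol{\mathcal H}}$ on $\omega_\varpi=\omega_1\otimes\cdots\otimes\omega_r$. For $\lambda\in\Lambda(\infty,r)$ let $\lambda^t\in\Lambda(\infty,r)$ with $\lambda^t_i=\#\{j:\lambda_j\ge i\}$ for $i\ge1$ and $0$ for $i\le0$; $w_\lambda$ is the unique distinguished $(\mathfrak S_\lambda,\mathfrak S_{\lambda^t})$-double coset representative with $w_\lambda^{-1}\mathfrak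 S_\lambda w_\lambda\cap\mathfrak S_{\lambda^t}=\{1\}$; $y_{\lambda^t}=\sum_{w\in\mathfrak S_{\lambda^t}}(-v^2)^{-\ell(w)}T_w$. The Specht module is $S^\mu=x_\mu T_{w_\mu}y_{\mu^t}{\boldsymbol{\mathcal H}}$. Let $z_\mu\in{\boldsymbol{\mathcal S}}(\infty,r)$ vanish on $\Omega_\nu$ for $\nu\ne\varpi$ and satisfy $z_\mu(\omega_\varpi h)=\omega_\mu T_{w_\mu}y_{\mu^t}h$ ($h\in{\boldsymbol{\mathcal H}}$). The Weyl module is $W(\infty,\mu)={\boldsymbol{\mathcal S}}(\infty,r)z_\mu$. In the bimodule $W(\infty,\mu)\otimes S^\mu$, ${\boldsymbol{\mathcal S}}(\infty,r)$ acts on the first factor and ${\boldsymbol{\mathcal H}}$ on the second. *)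

(* Defs.v *)
From HB Require Import structures.
From mathcomp Require Import all_boot all_order all_algebra all_fingroup.
From mathcomp Require Import fraction.
From mathcomp Require Import finmap.
From mathcomp.multinomials Require Import monalg.

Set Implicit Arguments.
Unset Strict Implicit.
Unset Printing Implicit Defensive.

Import Order.TTheory GRing.Theory.
Local Open Scope ring_scope.

Definition Qv : fieldType := {fraction {poly rat}}.
Definition vv : Qv := tofrac ('X : {poly rat}).

Section Defs.
Variable r : nat.

Definition word := {ffun 'I_r -> int}.

(* Omega_infty^{(x) r}: the Q(v)-space with basis the words. *)
Definition Omega := {malg Qv[word]}.

(* the basis vector omega_{i_1} (x) ... (x) omega_{i_r} *)
Definition bvec (i : word) : Omega := << i >>.

(* permutations of positions; math composition (a o b) x = a (b x) *)
Definition sym := {perm 'I_r}.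
Definition pcomp (a b : sym) : sym := (b * a)%g.

Definition wperm (i : word) (w : sym) : word := [ffun p => i (w p)].

(* entry at 0-based position n (0 if out of range) *)
Definition ent (i : word) (n : nat) : int :=
  if @insub nat (fun k => k < r)%N _ n is Some a then i a else 0.

(* simple transposition (j, j+1) (0-based positions j, j+1), j < r-1 *)
Definition stp (j : 'I_r.-1) : sym :=
  match @insub nat (fun k => k < r)%N _ j, @insub nat (fun k => k < r)%N _ j.+1 with
  | Some a, Some b => tperm a b
  | _, _ => 1%g
  end.

Definition len (w : sym) : nat :=
  #|[set p : 'I_r * 'I_r | (p.1 < p.2)%N && (w p.2 < w p.1)%N]|.

(* a canonical reduced word: w = s_{j1} o ... o s_{jk} *)
Fixpoint redword_rec (fuel : nat) (w : sym) : seq 'I_r.-1 :=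
  match fuel with
  | 0%N => [::]
  | fuel'.+1 =>
    if [pick j : 'I_r.-1 | (len (pcomp w (stp j)) < len w)%N] is Some j
    then rcons (redword_rec fuel' (pcomp w (stp j))) j
    else [::]
  end.
Definition redword (w : sym) : seq 'I_r.-1 := redword_rec (len w) w.

(* The Hecke algebra H, with basis (cT_w)_w  (cT_w = \mathcal T_w).    *)
Definition Hk := {malg Qv[sym]}.
Definition hbas (w : sym) : Hk := << w >>.

Definition lmulT_bas (j : 'I_r.-1) (w : sym) : Hk :=
  let sw := pcomp (stp j) w in
  if (len w < len sw)%N then hbas sw
  else (vv - vv^-1) *: hbas w + hbas sw.
Definition lmulT (j : 'I_r.-1) (h : Hk) : Hk :=
  \sum_(w : sym) h@_w *: lmulT_bas j w.

Definition hmul (h h' : Hk) : Hk :=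
  \sum_(w : sym) h@_w *: foldr lmulT h' (redword w).

Definition Tw (w : sym) : Hk := vv ^+ len w *: hbas w.

Definition actT_bas (j : 'I_r.-1) (i : word) : Omega :=
  let a := ent i j in let b := ent i j.+1 in
  if a < b then bvec (wperm i (stp j))
  else if a == b then vv *: bvec i
  else (vv - vv^-1) *: bvec i + bvec (wperm i (stp j)).
Definition actT (u : Omega) (j : 'I_r.-1) : Omega :=
  \sum_(i <- msupp u) u@_i *: actT_bas j i.
Definition actH (u : Omega) (h : Hk) : Omega :=
  \sum_(w : sym) h@_w *: foldl actT u (redword w).

(* The infinite q-Schur algebra S(infty,r) = End_H(Omega^{(x) r}),     *)
(* as a predicate on maps Omega -> Omega.                              *)
Definition lin_map (V W : lmodType Qv) (f : V -> W) : Prop :=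
  forall (a : Qv) (x y : V), f (a *: x + y) = a *: f x + f y.
Definition inSchur (f : Omega -> Omega) : Prop :=
  lin_map f /\ forall (u : Omega) (h : Hk), f (actH u h) = actH (f u) h.

Definition is_partition (mu : seq nat) : bool :=
  [&& sorted geq mu, all (fun m => 0 < m)%N mu & sumn mu == r].
Definition conjp (mu : seq nat) : seq nat :=
  [seq count (fun m => i < m)%N mu | i <- iota 0 (head 0%N mu)].

(* omega_lambda: the weakly increasing word with lambda_k letters k    *)
(* (lambda a partition, lambda_k = nth 0 lambda (k-1) for k >= 1)      *)
Definition lword (lam : seq nat) : word :=
  [ffun p : 'I_r =>
     (nth 0%N (flatten [seq nseq (nth 0%N lam k) k.+1 | k <- iota 0 (size lam)])
         p)%:Z].

(* Young subgroup S_lambda: permutations stabilizing the consecutive   *)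
(* blocks of positions of sizes lambda_1, lambda_2, ...                *)
Definition young (lam : seq nat) : {set sym} :=
  [set w : sym | wperm (lword lam) w == lword lam].

Definition xel (lam : seq nat) : Hk := \sum_(w in young lam) Tw w.
Definition yel (lam : seq nat) : Hk :=
  \sum_(w in young lam) ((- vv ^+ 2)^-1) ^+ len w *: Tw w.

Definition dcoset (lam : seq nat) (w : sym) : {set sym} :=
  [set pcomp (pcomp a w) b | a in young lam, b in young (conjp lam)].
Definition is_wlam (lam : seq nat) (w : sym) : bool :=
  [forall u in dcoset lam w, (len w <= len u)%N] &&
  ([set pcomp (pcomp (w^-1)%g a) w | a in young lam] :&: young (conjp lam)
     == [set 1%g]).
Definition wlam (lam : seq nat) : sym := odflt 1%g [pick w | is_wlam lam w].

Definition spech (mu : seq nat) : Hk :=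
  hmul (hmul (xel mu) (Tw (wlam mu))) (yel (conjp mu)).
Definition inSpecht (mu : seq nat) (s : Hk) : Prop :=
  exists h : Hk, s = hmul (spech mu) h.

(* varpi = (1,...,1,0,...) ; a word has content varpi iff its letters  *)
(* are exactly 1,...,r, each once (i.e. the basis vector is in Omega_varpi) *)
Definition varpi_content (i : word) : bool :=
  [forall k : 'I_r, #|[set p | i p == (k.+1)%:Z]| == 1%N] &&
  [forall p, (0 < i p) && (i p <= r%:Z)].
Definition om_varpi : Omega := bvec [ffun p : 'I_r => (p.+1)%:Z].

Definition zspec (mu : seq nat) (z : Omega -> Omega) : Prop :=
  inSchur z /\
  (forall i : word, ~~ varpi_content i -> z (bvec i) = 0) /\
  (forall h : Hk, z (actH om_varpi h) =
                  actH (bvec (lword mu)) (hmul (hmul (Tw (wlam mu)) (yel (conjp mu))) h)).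

Definition inWeyl (z : Omega -> Omega) (phi : Omega -> Omega) : Prop :=
  exists2 f, inSchur f & forall u, phi u = f (z u).

Definition mapLC (a : Qv) (f g : Omega -> Omega) : Omega -> Omega :=
  fun u => a *: f u + g u.

Definition bilin_on (V : lmodType Qv) (z : Omega -> Omega) (mu : seq nat)
    (g : (Omega -> Omega) -> Hk -> V) : Prop :=
  (forall a phi1 phi2 s, inWeyl z phi1 -> inWeyl z phi2 -> inSpecht mu s ->
     g (mapLC a phi1 phi2) s = a *: g phi1 s + g phi2 s) /\
  (forall a phi s1 s2, inWeyl z phi -> inSpecht mu s1 -> inSpecht mu s2 ->
     g phi (a *: s1 + s2) = a *: g phi s1 + g phi s2).

(* (beta_mu)_mu exhibits Omega as  (+)_{mu in Lambda^+(r)} W(infty,mu) (x) S^mu,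
   compatibly with the (S(infty,r), H)-bimodule structures:
   - beta_mu is bilinear and bimodule-equivariant,
   - universal property of the direct sum of tensor products. *)
Definition bimod_tensor_decomp (z : seq nat -> Omega -> Omega)
    (beta : seq nat -> (Omega -> Omega) -> Hk -> Omega) : Prop :=
  (forall mu, is_partition mu -> bilin_on (z mu) mu (beta mu)) /\
  (forall mu f phi s, is_partition mu -> inSchur f -> inWeyl (z mu) phi ->
     inSpecht mu s -> beta mu (fun u => f (phi u)) s = f (beta mu phi s)) /\
  (forall mu phi s h, is_partition mu -> inWeyl (z mu) phi -> inSpecht mu s ->
     beta mu phi (hmul s h) = actH (beta mu phi s) h) /\
  (forall (V : lmodType Qv) (gam : seq nat -> (Omega -> Omega) -> Hk -> V),
     (forall mu, is_partition mu -> bilin_on (z mu) mu (gam mu)) ->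
     (exists g : Omega -> V, lin_map g /\
        forall mu phi s, is_partition mu -> inWeyl (z mu) phi -> inSpecht mu s ->
          g (beta mu phi s) = gam mu phi s) /\
     (forall g1 g2 : Omega -> V, lin_map g1 -> lin_map g2 ->
        (forall mu phi s, is_partition mu -> inWeyl (z mu) phi -> inSpecht mu s ->
           g1 (beta mu phi s) = gam mu phi s /\ g2 (beta mu phi s) = gam mu phi s) ->
        forall u, g1 u = g2 u)).

Definition Ssubmod (P : Omega -> Prop) : Prop :=
  P 0 /\ (forall a u w, P u -> P w -> P (a *: u + w)) /\
  (forall f u, inSchur f -> P u -> P (f u)).
Definition S_completely_reducible : Prop :=
  forall P, Ssubmod P -> exists Q, Ssubmod Q /\
    (forall u, P u -> Q u -> u = 0) /\
    (forall u, exists a b, P a /\ Q b /\ u = a + b).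

End Defs.

(* Main.v *)
(** The bilinear form for which words are orthonormal makes every [T_j] self-adjoint, and it is anisotropic because Q(v) is formally real. With values in the Hecke algebra it becomes [ip p u = sum_w (p T_w, u) T_w], and every rank one map [u |-> q . ip p u] lies in the q-Schur algebra.

For a partition mu put [p_mu = omega_mu T_(w_mu) y_(mu^t)] and [eps_mu = ip p_mu p_mu]. The symmetrizer [y_(mu^t)] kills all words of content mu except the rearrangements of one column reading word kappa_mu, so the vectors of content mu are mapped by [y_(mu^t)] to multiples of [p_mu]. Hence [eps_mu H eps_mu] is a line, [eps_mu] is a nonzero multiple of an idempotent, and comparing sums of letters gives [eps_mu H eps_lambda = 0] for distinct mu and lambda.

The ideals generated by the [eps_mu] fill up H: an element orthogonal to them kills every [p_mu H]. By induction on the sum of the letters, it maps a word of positive letters to a vector killed by all raising operators. The last word (comparing last letters first) of such a highest weight vector is a Yamanouchi word, and [p_mu H] contains a vector with each prescribed Yamanouchi word as leading word, so highest weight vectors of content mu lie in [p_mu H]. Writing 1 as a sum of terms [a eps_mu b] then yields both the decomposition, with [beta (phi, s_mu h) = phi (omega_varpi) h], and the complete reducibility. *)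
From Pilot Require Import Defs.
From HB Require Import structures.
From mathcomp Require Import all_boot all_order all_algebra all_fingroup.
From mathcomp Require Import generic_quotient fraction finmap.
From mathcomp.multinomials Require Import monalg.
From mathcomp Require Import ring zify.
From Stdlib Require Import Classical FunctionalExtensionality.
Import Pilot.Defs.

Set Implicit Arguments.
Unset Strict Implicit.
Unset Printing Implicit Defensive.

Import Order.TTheory GRing.Theory Num.Theory.
Local Open Scope ring_scope.

(** * The field Q(v) is formally real *)

(** Positivity replaces the structure theory of the Hecke algebra. Over a formally real field a
    nonzero [u] has [u . ip u u] nonzero, because its product with [u] is a sum of squares, one of
    them that of [(u, u)]; this excludes a nilpotent [eps_mu]. The same principle gives
    [v + v^-1 <> 0], so that an antisymmetrizer kills a letter repeated in a block, and makes the
    quantum integers nonzero, so that raising operators are injective in negative weight. Nor are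
    dimensions counted: that the [eps_mu] generate H is tested by duality, on an element orthogonal
    to the ideal. The raising operators are the only trace of the quantum group. Those used stay
    within positive letters, hence the inductions over words are confined to positive letters
    although letters range over the integers. All this is done for an abstract [hecke_data], into
    which Q(v) is inserted at the end. *)

Lemma frac_repr (R : idomainType) (x : {fraction R}) :
  exists n d : R, d != 0 /\ x * tofrac d = tofrac n.
Proof.
elim/quotW: x => y; exists (frac y).1, (frac y).2; split; first exact: denom_ratioP.
unlock FracField.tofrac; rewrite -[LHS]FracField.pi_mul; apply/eqmodP.
rewrite /= /FracField.mulf FracField.equivfE !numden_Ratio ?(oner_eq0, mulr1, mulf_neq0, denom_ratioP) //.
by rewrite mulrC.
Qed.

Lemma frac_common (R : idomainType) (s : seq {fraction R}) :
  exists2 d : R, d != 0 & forall x, x \in s -> exists n, x * tofrac d = tofrac n.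
Proof.
elim: s => [|x s [d d0 h]]; first by exists 1; rewrite ?oner_neq0.
have [n [e [e0 xe]]] := @frac_repr _ x.
exists (d * e); first by rewrite mulf_neq0.
move=> y; rewrite inE => /orP[/eqP ->|/h[m ym]].
  by exists (n * d); rewrite !tofracM -xe mulrA mulrAC.
by exists (m * e); rewrite !tofracM -ym mulrA.
Qed.

(** Evaluation at a rational gives a vanishing sum of squares in an ordered field, so every rational
    is a root of [p]; [size p] of them already force [p = 0]. *)
Lemma poly_real (s : seq {poly rat}) :
  \sum_(p <- s) p ^+ 2 = 0 -> forall p, p \in s -> p = 0.
Proof.
move=> e p ps.
have ev (a : rat) : p.[a] = 0.
  have := congr1 (horner^~ a) e; rewrite horner_sum horner0 => /eqP.
  rewrite psumr_eq0 => [/allP /(_ p ps)|q _]; last by rewrite horner_exp sqr_ge0.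
  by rewrite /= horner_exp sqrf_eq0 => /eqP.
apply: (@roots_geq_poly_eq0 _ p [seq (k%:R : rat) | k <- iota 0 (size p)]).
- by apply/allP => _ /mapP[k _ ->]; rewrite /root ev.
- rewrite map_inj_uniq ?iota_uniq // => a b; exact: (@mulrIn rat 1 (oner_neq0 _)).
- by rewrite size_map size_iota.
Qed.

Lemma Qv_real (s : seq {fraction {poly rat}}) :
  \sum_(x <- s) x ^+ 2 = 0 -> forall x, x \in s -> x = 0.
Proof.
move=> e x xs; have [d d0 h] := @frac_common _ s.
(* The implication makes the claim true for every [y], so a numerator can be chosen as a function on
   the whole field. *)
have h' y : exists n, (y \in s) ==> (y * tofrac d == tofrac n).
  case: (boolP (y \in s)) => [/h[n en]|_]; first by exists n; rewrite en eqxx.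
  by exists 0.
pose num y := xchoose (h' y).
have numE y : y \in s -> y * tofrac d = tofrac (num y).
  by move=> ys; have /implyP/(_ ys)/eqP := xchooseP (h' y).
have : num x = 0.
  apply: (@poly_real (map num s)); last exact: map_f.
  apply/eqP; rewrite big_map -tofrac_eq0 rmorph_sum /=.
  rewrite big_seq (eq_bigr (fun y => tofrac d ^+ 2 * y ^+ 2)) => [|y ys].
    by rewrite -big_seq -mulr_sumr e mulr0.
  by rewrite tofracXn -numE // exprMn mulrC.
move=> n0; have := numE x xs; rewrite n0 tofrac0 => /eqP.
by rewrite mulf_eq0 tofrac_eq0 (negPf d0) orbF => /eqP.
Qed.

Lemma vv_neq0 : vv != 0.
Proof. by rewrite /vv tofrac_eq0 polyX_eq0. Qed.

#[global] Opaque Qv vv fgscale fgadd fgopp fgzero.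

(** * Linear maps on free modules *)

(** Over an arbitrary field, as the abstract theory requires; over [Qv] it unfolds to [lin_map]. *)
Definition islin (F : fieldType) (V W : lmodType F) (f : V -> W) : Prop :=
  forall (a : F) (x y : V), f (a *: x + y) = a *: f x + f y.

Section LinMap.
Variables (F : fieldType) (V W : lmodType F).
Variable f : V -> W.
Hypothesis fL : islin f.

Lemma lin_map0 : f 0 = 0.
Proof.
have := fL (-1) 0 0; rewrite scaler0 add0r scaleN1r.
by rewrite addNr.
Qed.

Lemma lin_mapD x y : f (x + y) = f x + f y.
Proof. by have := fL 1 x y; rewrite !scale1r. Qed.

Lemma lin_mapZ a x : f (a *: x) = a *: f x.
Proof. by have := fL a x 0; rewrite !addr0 lin_map0 addr0. Qed.

Lemma lin_mapN x : f (- x) = - f x.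
Proof. by rewrite -scaleN1r lin_mapZ scaleN1r. Qed.

Lemma lin_mapB x y : f (x - y) = f x - f y.
Proof. by rewrite lin_mapD lin_mapN. Qed.

Lemma lin_map_sum (I : Type) (s : seq I) (P : pred I) (G : I -> V) :
  f (\sum_(i <- s | P i) G i) = \sum_(i <- s | P i) f (G i).
Proof. by apply: (big_morph f lin_mapD lin_map0). Qed.

End LinMap.

Lemma lin_map_comp (F : fieldType) (U V W : lmodType F) (f : V -> W) (g : U -> V) :
  islin f -> islin g -> islin (fun u => f (g u)).
Proof. by move=> fL gL a x y; rewrite gL fL. Qed.

Lemma lin_map_scale (F : fieldType) (V W : lmodType F) (f : V -> W) c :
  islin f -> islin (fun u => c *: f u).
Proof. by move=> fL a x y; rewrite fL scalerDr !scalerA mulrC. Qed.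

Lemma lin_map_bigsum (F : fieldType) (V W : lmodType F) (I : Type) (s : seq I) (P : pred I)
    (G : I -> V -> W) :
  (forall i, islin (G i)) -> islin (fun u => \sum_(i <- s | P i) G i u).
Proof.
move=> FL a x y; rewrite scaler_sumr -big_split /=.
by apply: eq_bigr => i _; rewrite FL.
Qed.

Section Malg.
Variable K : choiceType.
Local Notation M := {malg Qv[K]}.

Lemma coefZ (c : Qv) (u : M) k : (c *: u)@_k = c * u@_k.
Proof. exact: mcoeffZ. Qed.

Definition lext (W : lmodType Qv) (g : K -> W) (u : M) : W :=
  \sum_(i <- msupp u) u@_i *: g i.

Lemma lextEw (W : lmodType Qv) (g : K -> W) (u : M) (d : {fset K}) :
  (msupp u `<=` d)%fset -> lext g u = \sum_(i <- d) u@_i *: g i.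
Proof.
move=> le; rewrite /lext; apply: big_fset_incl => //= i _ iNu.
by rewrite mcoeff_outdom // scale0r.
Qed.

Lemma lext_lin (W : lmodType Qv) (g : K -> W) : islin (lext g).
Proof.
move=> a x y.
pose d := (msupp (a *: x + y) `|` (msupp x `|` msupp y))%fset.
rewrite !(@lextEw _ _ _ d) /d ?fsubsetUl //.
- rewrite scaler_sumr -big_split /=; apply: eq_bigr => i _.
  by rewrite mcoeffD coefZ scalerDl scalerA.
- by apply: fsubset_trans (fsubsetUr _ _); rewrite fsubsetUr.
- by apply: fsubset_trans (fsubsetUr _ _); rewrite fsubsetUl.
Qed.

Lemma lextU (W : lmodType Qv) (g : K -> W) i : lext g << i >> = g i.
Proof. by rewrite /lext msuppU oner_eq0 big_seq_fset1 mcoeffUU scale1r. Qed.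

Lemma lext_id (u : M) : lext (fun i => << i >>) u = u.
Proof.
rewrite {2}[u]monalgE; apply: eq_bigr => i _; apply/malgP => k.
by rewrite coefZ !mcoeffU mulr_natr.
Qed.

Lemma malg_decomp (u : M) : u = \sum_(i <- msupp u) u@_i *: (<< i >> : M).
Proof. by rewrite -{1}[u]lext_id. Qed.

Lemma eq_lin_map (W : lmodType Qv) (f g : M -> W) :
  islin f -> islin g -> (forall i, f << i >> = g << i >>) ->
  forall u, f u = g u.
Proof.
move=> fL gL e u; rewrite [u]malg_decomp !lin_map_sum //.
by apply: eq_bigr => i _; rewrite !lin_mapZ // e.
Qed.

Lemma mcoeff_lin k : @islin Qv M (Qv^o) (fun u : M => u@_k).
Proof. by move=> a x y; rewrite mcoeffD coefZ. Qed.

Lemma mcoeff_bas (i k : K) : (<< i >> : M)@_k = (i == k)%:R.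
Proof. by rewrite mcoeffU. Qed.

End Malg.

Lemma finsum_lin (T : finType) (W : lmodType Qv) (g : T -> W) :
  islin (fun h : {malg Qv[T]} => \sum_(w : T) h@_w *: g w).
Proof.
move=> a x y; rewrite scaler_sumr -big_split /=; apply: eq_bigr => i _.
by rewrite mcoeffD coefZ scalerDl scalerA.
Qed.

Lemma finsumU (T : finType) (W : lmodType Qv) (g : T -> W) k :
  \sum_(w : T) (<< k >> : {malg Qv[T]})@_w *: g w = g k.
Proof.
rewrite (bigD1 k isT) /= [X in X *: _ + _]mcoeff_bas eqxx scale1r.
rewrite big1 ?addr0 // => i ik.
by rewrite mcoeff_bas eq_sym (negPf ik) scale0r.
Qed.

(** * Simple transpositions and the generators acting on words *)

Section Position.
Variable r : nat.
Implicit Types (j : 'I_r.-1) (i : word r) (w : sym r).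

Lemma lo_subproof j : (j < r)%N. Proof. by have := ltn_ord j; lia. Qed.
Lemma hi_subproof j : (j.+1 < r)%N. Proof. by have := ltn_ord j; lia. Qed.
Definition lo j : 'I_r := Ordinal (lo_subproof j).
Definition hi j : 'I_r := Ordinal (hi_subproof j).

Lemma lo_lt_hi j : (lo j < hi j)%N. Proof. exact: ltnSn. Qed.
Lemma lo_neq_hi j : (lo j == hi j) = false.
Proof. by rewrite -val_eqE /= ltn_eqF. Qed.
Lemma hi_neq_lo j : (hi j == lo j) = false.
Proof. by rewrite eq_sym lo_neq_hi. Qed.

Lemma stpE j : stp j = tperm (lo j) (hi j).
Proof.
rewrite /stp; case: insubP => [a _ ea|]; last by rewrite lo_subproof.
case: insubP => [b _ eb|]; last by rewrite hi_subproof.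
by congr tperm; apply: val_inj.
Qed.

Lemma ent_lo i j : ent i j = i (lo j).
Proof.
rewrite /ent; case: insubP => [a _ ea|]; last by rewrite lo_subproof.
by congr (i _); apply: val_inj.
Qed.

Lemma ent_hi i j : ent i j.+1 = i (hi j).
Proof.
rewrite /ent; case: insubP => [a _ ea|]; last by rewrite hi_subproof.
by congr (i _); apply: val_inj.
Qed.

Lemma stp_lo j : stp j (lo j) = hi j. Proof. by rewrite stpE tpermL. Qed.
Lemma stp_hi j : stp j (hi j) = lo j. Proof. by rewrite stpE tpermR. Qed.
Lemma stp_out j p : p != lo j -> p != hi j -> stp j p = p.
Proof. by move=> pl ph; rewrite stpE tpermD // eq_sym. Qed.
Lemma stpK j p : stp j (stp j p) = p.
Proof. by rewrite stpE tpermK. Qed.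

Lemma stpE_if j p : stp j p = if p == lo j then hi j else if p == hi j then lo j else p.
Proof.
case: eqP => [->|/eqP pl]; first exact: stp_lo.
case: eqP => [->|/eqP ph]; first exact: stp_hi.
exact: stp_out.
Qed.

Lemma pcompE (a b : sym r) p : pcomp a b p = a (b p).
Proof. by rewrite /pcomp permM. Qed.

Lemma pcompA (a b c : sym r) : pcomp a (pcomp b c) = pcomp (pcomp a b) c.
Proof. by rewrite /pcomp mulgA. Qed.

Lemma pcomp1p (a : sym r) : pcomp 1%g a = a. Proof. by rewrite /pcomp mulg1. Qed.
Lemma pcompp1 (a : sym r) : pcomp a 1%g = a. Proof. by rewrite /pcomp mul1g. Qed.

Lemma pcompKs j w : pcomp (pcomp w (stp j)) (stp j) = w.
Proof. by apply/permP => p; rewrite !pcompE stpK. Qed.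
Lemma pcompsK j w : pcomp (stp j) (pcomp (stp j) w) = w.
Proof. by apply/permP => p; rewrite !pcompE stpK. Qed.

Lemma wpermE i w p : wperm i w p = i (w p). Proof. by rewrite ffunE. Qed.
Lemma wpermM i a b : wperm (wperm i a) b = wperm i (pcomp a b).
Proof. by apply/ffunP => p; rewrite !wpermE pcompE. Qed.
Lemma wperm1 i : wperm i 1%g = i.
Proof. by apply/ffunP => p; rewrite wpermE perm1. Qed.
Lemma wpermKs i j : wperm (wperm i (stp j)) (stp j) = i.
Proof. by apply/ffunP => p; rewrite !wpermE stpK. Qed.
Lemma wperm_eqs i j : i (lo j) = i (hi j) -> wperm i (stp j) = i.
Proof.
move=> e; apply/ffunP => p; rewrite wpermE stpE_if.
by do 2?case: eqP => [->|_] //.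
Qed.

Lemma actT_basE j i : actT_bas j i =
  if i (lo j) < i (hi j) then bvec (wperm i (stp j))
  else if i (lo j) == i (hi j) then vv *: bvec i
  else (vv - vv^-1) *: bvec i + bvec (wperm i (stp j)).
Proof. by rewrite /actT_bas ent_lo ent_hi. Qed.

Lemma actT_lin j : islin (fun u : Omega r => actT u j).
Proof. exact: (@lext_lin _ _ (actT_bas j)). Qed.

Lemma actT_bvec i j : actT (bvec i) j = actT_bas j i.
Proof. exact: (@lextU _ _ (actT_bas j)). Qed.

Lemma eq_lin_Omega (W : lmodType Qv) (f g : Omega r -> W) :
  islin f -> islin g -> (forall i : word r, f (bvec i) = g (bvec i)) ->
  forall u, f u = g u.
Proof. exact: eq_lin_map. Qed.

Definition Tf (F : fieldType) (v : F) j (f : word r -> F) i : F :=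
  if i (lo j) < i (hi j) then f (wperm i (stp j))
  else if i (lo j) == i (hi j) then v * f i
  else (v - v^-1) * f i + f (wperm i (stp j)).

Lemma bvec_coef i k : (bvec i)@_k = (i == k)%:R.
Proof. exact: mcoeff_bas. Qed.

Lemma wperm_eq_swap i k j : (wperm i (stp j) == k) = (i == wperm k (stp j)).
Proof. by apply/eqP/eqP => [<-|->]; rewrite wpermKs. Qed.

(* The matrix of [actT] in the basis of words is symmetric, so it also describes the action on coefficients. *)
Lemma actT_coef u j i : (actT u j)@_i = Tf vv j (fun k => u@_k) i.
Proof.
apply: (@eq_lin_Omega (Qv^o) (fun u : Omega r => (actT u j)@_i)
   (fun u : Omega r => Tf vv j (fun k => u@_k) i)) => [||k].
- exact: (lin_map_comp (mcoeff_lin i) (actT_lin j)).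
- move=> a x y; rewrite /Tf; case: ifP => _; first exact: mcoeff_lin.
  case: ifP => _; rewrite !mcoeffD !coefZ /GRing.scale /=; by ring.
- rewrite actT_bvec actT_basE /Tf !bvec_coef.
  (* The entry at [(k, i)] involves only whether [k] is [i] or [i] swapped at [j]; [e1] to [e6] turn
     these equalities into relations between the two letters, which rule out the mixed cases. *)
  have e1 : k == i -> k (lo j) = i (lo j) by move/eqP->.
  have e2 : k == i -> k (hi j) = i (hi j) by move/eqP->.
  have e3 : k == wperm i (stp j) -> k (lo j) = i (hi j).
    by move/eqP->; rewrite wpermE stp_lo.
  have e4 : k == wperm i (stp j) -> k (hi j) = i (lo j).
    by move/eqP->; rewrite wpermE stp_hi.
  have e5 : k == i -> k (lo j) = k (hi j) -> k == wperm i (stp j).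
    by move/eqP-> => e; rewrite wperm_eqs.
  have e6 : k == wperm i (stp j) -> k (lo j) = k (hi j) -> k == i.
    by move/eqP-> => e; move: e; rewrite !wpermE stp_lo stp_hi => e; rewrite wperm_eqs.
  case: (ltgtP (k (lo j)) (k (hi j))) => h;
  case: (ltgtP (i (lo j)) (i (hi j))) => h';
  rewrite ?mcoeffD ?coefZ ?bvec_coef ?wperm_eq_swap //;
  move: e1 e2 e3 e4 e5 e6; case: (k == i); case: (k == wperm i (stp j)) => //=;
  move=> e1 e2 e3 e4 e5 e6; rewrite ?mulr0 ?addr0 ?add0r //;
  try (have {}e1 := e1 isT); try (have {}e2 := e2 isT);
  try (have {}e3 := e3 isT); try (have {}e4 := e4 isT); try (exfalso; lia);
  try (by have := e5 isT ltac:(lia)); try (by have := e6 isT ltac:(lia)).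
Qed.

End Position.
#[global] Opaque actT.

(** * Lengths and reduced words *)

Ltac case_if := match goal with |- context [if ?b then _ else _] =>
  lazymatch b with context [if _ then _ else _] => fail | _ => case: (boolP b) => ? end end.

Section Length.
Variable r : nat.
Implicit Types (j : 'I_r.-1) (w : sym r) (js : seq 'I_r.-1).

Definition swapn (j p : nat) : nat :=
  if p == j then j.+1 else if p == j.+1 then j else p.

Lemma val_stp j (p : 'I_r) : stp j p = swapn j p :> nat.
Proof. by rewrite stpE_if /swapn -!val_eqE /=; do 2?case: ifP. Qed.

Definition inv w : {set 'I_r * 'I_r} :=
  [set p : 'I_r * 'I_r | (p.1 < p.2)%N && (w p.2 < w p.1)%N].

Lemma lenE w : len w = #|inv w|. Proof. by []. Qed.

(** Applying [stp j] to both entries maps the inversions of [w] bijectively to those of [w s_j]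
    other than [(lo j, hi j)], which is the new one. *)
Lemma len_asc w j : (w (lo j) < w (hi j))%N -> len (pcomp w (stp j)) = (len w).+1.
Proof.
move=> asc; rewrite !lenE (cardsD1 (lo j, hi j)).
rewrite inE /= !pcompE stp_lo stp_hi asc ltnSn /= add1n; congr _.+1.
pose f (p : 'I_r * 'I_r) := (stp j p.1, stp j p.2).
have fK : involutive f by move=> [p q]; rewrite /f /= !stpK.
rewrite -(card_imset _ (inv_inj fK)); apply: eq_card => -[p q].
rewrite -[(p, q)]fK mem_imset ?fK; last exact: inv_inj.
rewrite !inE /f /= !pcompE !stpK xpair_eqE.
have e : (stp j p < stp j q)%N && ~~ ((stp j p == lo j) && (stp j q == hi j)) =
         (p < q)%N && ~~ ((p == lo j) && (q == hi j)).
  by rewrite -!val_eqE /= !val_stp /swapn; do 4?case: eqP => //=; lia.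
have e' : (p == lo j) && (q == hi j) -> (w q < w p)%N = false.
  by case/andP => /eqP -> /eqP ->; lia.
case: (boolP ((p == lo j) && (q == hi j))) e e' => [c|c] e e' /=.
  by rewrite e' // !andbF.
by rewrite andbA [_ && (stp j p < _)%N]andbC e andbT.
Qed.

Lemma len_desc w j : (w (hi j) < w (lo j))%N -> (len (pcomp w (stp j))).+1 = len w.
Proof.
move=> desc; rewrite -{2}[w](pcompKs j) [RHS]len_asc //.
by rewrite !pcompE stp_lo stp_hi.
Qed.

Lemma perm_lohi w j : (w (lo j) < w (hi j))%N || (w (hi j) < w (lo j))%N.
Proof.
rewrite -neq_ltn; apply/eqP => /val_inj /perm_inj /eqP.
by rewrite lo_neq_hi.
Qed.

Lemma len_ascE w j : (len w < len (pcomp w (stp j)))%N = (w (lo j) < w (hi j))%N.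
Proof.
by case/orP: (perm_lohi w j) => h; have := h; [move=> /(@len_asc w j)|move=> /(@len_desc w j)]; lia.
Qed.

Lemma len_descE w j : (len (pcomp w (stp j)) < len w)%N = (w (hi j) < w (lo j))%N.
Proof.
by case/orP: (perm_lohi w j) => h; have := h; [move=> /(@len_asc w j)|move=> /(@len_desc w j)]; lia.
Qed.

Lemma len_inv w : len (w^-1)%g = len w.
Proof.
rewrite !lenE; pose f (p : 'I_r * 'I_r) := (w p.2, w p.1).
have fI : injective f by move=> [p q] [p' q'] [/perm_inj -> /perm_inj ->].
rewrite -[RHS](card_imset _ fI); apply: eq_card => -[p q].
have -> : (p, q) = f ((w^-1)%g q, (w^-1)%g p) by rewrite /f /= !permKV.
by rewrite mem_imset // !inE /= !permKV andbC.
Qed.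

Lemma stp_inv j : ((stp j)^-1)%g = stp j.
Proof. by apply: (@mulgI _ (stp j)); rewrite mulgV; apply/permP => p; rewrite permM stpK perm1. Qed.

Lemma pcomp_inv (a b : sym r) : ((pcomp a b)^-1)%g = pcomp (b^-1)%g (a^-1)%g.
Proof. by rewrite /pcomp invMg. Qed.

Lemma len_left w j : len (pcomp (stp j) w) = len (pcomp (w^-1)%g (stp j)).
Proof. by rewrite -len_inv pcomp_inv stp_inv. Qed.

Lemma len_stp_alt w j : len (pcomp w (stp j)) = (len w).+1 \/ len w = (len (pcomp w (stp j))).+1.
Proof.
by case/orP: (perm_lohi w j) => h; [left; rewrite len_asc|right; rewrite len_desc].
Qed.

Lemma len1 : len (1%g : sym r) = 0%N.
Proof.
apply/eqP; rewrite lenE cards_eq0; apply/eqP/setP => -[p q].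
by rewrite !inE /= !perm1; lia.
Qed.

Lemma asc_homo w : (forall j, (w (lo j) < w (hi j))%N) ->
  forall p q : 'I_r, (p < q)%N -> (w p < w q)%N.
Proof.
move=> asc p q; move e: (q - p)%N => n; elim: n p q e => [|n IH] p q e pq; first by lia.
have jP : (p < r.-1)%N by have := ltn_ord q; lia.
have -> : p = lo (Ordinal jP) by apply: val_inj.
have := asc (Ordinal jP).
case: (ltngtP (hi (Ordinal jP) : nat) q) => [h|h|/val_inj <-] //; last by move: h => /=; lia.
by move/ltn_trans; apply; apply: IH => //=; lia.
Qed.

Lemma homo_ge (f : 'I_r -> 'I_r) : (forall p q : 'I_r, (p < q)%N -> (f p < f q)%N) ->
  forall p : 'I_r, (p <= f p)%N.
Proof.
move=> fH p; case: p => n; elim: n => [|n IH] nr //=.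
have nr' : (n < r)%N by lia.
by apply: leq_ltn_trans (IH nr') _; apply: fH.
Qed.

(** An increasing self-map satisfies [p <= w p]; the inverse is increasing too and gives the
    opposite inequality. *)
Lemma no_desc w : (forall j, (w (lo j) < w (hi j))%N) -> w = 1%g.
Proof.
move=> /asc_homo wH.
have wH' (p q : 'I_r) : (p < q)%N -> ((w^-1)%g p < (w^-1)%g q)%N.
  move=> pq; rewrite ltnNge leq_eqVlt; apply/negP => /orP[/eqP/val_inj/perm_inj e|/wH].
    by move: pq; rewrite e ltnn.
  by rewrite !permKV; lia.
apply/permP => p; rewrite perm1; apply: val_inj; apply/eqP; rewrite eqn_leq (homo_ge wH) andbT.
by have := homo_ge wH' (w p); rewrite permK.
Qed.

Definition wprod js : sym r := foldr (fun j w => pcomp (stp j) w) 1%g js.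

Lemma wprod_cat js ks : wprod (js ++ ks) = pcomp (wprod js) (wprod ks).
Proof. by elim: js => [|j js IH] /=; rewrite ?pcomp1p // IH pcompA. Qed.

Lemma wprod_rcons js j : wprod (rcons js j) = pcomp (wprod js) (stp j).
Proof. by rewrite -cats1 wprod_cat /= pcompp1. Qed.

Lemma wprod_rev js : wprod (rev js) = ((wprod js)^-1)%g.
Proof.
elim: js => [|j js IH]; first by rewrite /= invg1.
by rewrite rev_cons wprod_rcons IH /= pcomp_inv stp_inv.
Qed.

Lemma len_wprod js : (len (wprod js) <= size js)%N.
Proof.
elim/last_ind: js => [|js j IH]; first by rewrite len1.
by rewrite wprod_rcons size_rcons; have := len_stp_alt (wprod js) j; lia.
Qed.

Lemma redword_recP n w : (len w <= n)%N ->
  wprod (redword_rec n w) = w /\ size (redword_rec n w) = len w.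
Proof.
elim: n w => [|n IH] w le.
  suff -> : w = 1%g by rewrite len1.
  by apply: no_desc => j; rewrite -len_ascE; have := len_stp_alt w j; lia.
rewrite /=; case: pickP => [j|none].
  move=> lt; have alt := len_stp_alt w j.
  have [|e1 e2] := IH (pcomp w (stp j)); first by lia.
  by rewrite wprod_rcons size_rcons e1 e2 pcompKs; split=> //; lia.
suff -> : w = 1%g by rewrite len1.
by apply: no_desc => j; have := none j; rewrite len_descE; have := perm_lohi w j; case: (ltnP (w (lo j))) => //= _ ->.
Qed.

Lemma wprod_redword w : wprod (redword w) = w.
Proof. by have [] := redword_recP (leqnn (len w)). Qed.

Lemma size_redword w : size (redword w) = len w.
Proof. by have [] := redword_recP (leqnn (len w)). Qed.

Definition reduced js := len (wprod js) == size js.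

Lemma reduced_redword w : reduced (redword w).
Proof. by rewrite /reduced wprod_redword size_redword. Qed.

Lemma reduced_rconsE js j :
  reduced (rcons js j) = reduced js && (wprod js (lo j) < wprod js (hi j))%N.
Proof.
rewrite /reduced wprod_rcons size_rcons -len_ascE.
by have := len_wprod js; have := len_stp_alt (wprod js) j; lia.
Qed.

Lemma reduced_rcons_intro js j w : reduced js -> wprod js = pcomp w (stp j) ->
  (w (hi j) < w (lo j))%N -> reduced (rcons js j) /\ wprod (rcons js j) = w.
Proof.
move=> red e lt; rewrite reduced_rconsE red e wprod_rcons e pcompKs.
by rewrite !pcompE stp_lo stp_hi lt.
Qed.

Lemma reduced_rcons_desc js j : reduced (rcons js j) ->
  (wprod (rcons js j) (hi j) < wprod (rcons js j) (lo j))%N.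
Proof.
by rewrite reduced_rconsE wprod_rcons !pcompE stp_lo stp_hi => /andP[].
Qed.

Lemma stp_comm (i j : 'I_r.-1) : (i.+1 < j)%N -> pcomp (stp i) (stp j) = pcomp (stp j) (stp i).
Proof.
move=> ij; apply/permP => p; apply: val_inj; rewrite /= !pcompE !val_stp /swapn.
by repeat case_if; lia.
Qed.

Lemma stp_braid (i j : 'I_r.-1) : j = i.+1 :> nat ->
  pcomp (stp i) (pcomp (stp j) (stp i)) = pcomp (stp j) (pcomp (stp i) (stp j)).
Proof.
move=> ij; apply/permP => p; apply: val_inj; rewrite /= !pcompE !val_stp /swapn ij.
by repeat case_if; lia.
Qed.

(** * Matsumoto's theorem for operators satisfying the braid relations *)

Section Matsumoto.
Variables (T : Type) (op : T -> 'I_r.-1 -> T).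
Hypothesis op_comm : forall u (i j : 'I_r.-1), (i.+1 < j)%N -> op (op u i) j = op (op u j) i.
Hypothesis op_braid : forall u (i j : 'I_r.-1), j = i.+1 :> nat ->
  op (op (op u i) j) i = op (op (op u j) i) j.

(** Induction on the length: with equal last letters both words are shortened, with different ones
    they are compared through words that end in the two sides of a braid relation. *)
Lemma matsumoto js ks u : reduced js -> reduced ks -> wprod js = wprod ks ->
  foldl op u js = foldl op u ks.
Proof.
move: {-1}(size js) (leqnn (size js)) => n; elim: n js ks => [|n IH] js ks.
  case: js => // _ _ /eqP redk /= e; move: redk; rewrite -e len1.
  by case: ks {e}.
(* Both [i] and [j] are right descents of [w], so [w] ends in the longest element generated by [s_i]
   and [s_j]. With [c] a reduced word of the remaining factor, each given word agrees by induction
   with an extension of [c] having the same last letter. *)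
have main (i j : 'I_r.-1) a b : (i < j)%N -> (size a <= n)%N -> (size b <= n)%N ->
  reduced (rcons a i) -> reduced (rcons b j) -> wprod (rcons a i) = wprod (rcons b j) ->
  foldl op u (rcons a i) = foldl op u (rcons b j).
  move=> ij sa sb ra rb e; set w := wprod (rcons a i) in e.
  have di := reduced_rcons_desc ra; rewrite -/w in di.
  have dj := reduced_rcons_desc rb; rewrite -e in dj.
  have [ra' _] := andP (etrans (esym (reduced_rconsE a i)) ra).
  have [rb' _] := andP (etrans (esym (reduced_rconsE b j)) rb).
  have wa : wprod a = pcomp w (stp i) by rewrite /w wprod_rcons pcompKs.
  have wb : wprod b = pcomp w (stp j) by rewrite e wprod_rcons pcompKs.
  case: (ltngtP i.+1 j) => [ij2|ij2|ij2]; last 1 first.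
  - have lohi : lo j = hi i by apply: val_inj.
    have n1 : stp i (hi j) = hi j by apply: stp_out; rewrite -val_eqE /= -ij2; lia.
    have n2 : stp j (lo i) = lo i by apply: stp_out; rewrite -val_eqE /= -ij2; lia.
    pose c := redword (pcomp (pcomp (pcomp w (stp i)) (stp j)) (stp i)).
    have rc : reduced c := reduced_redword _.
    have wc : wprod c = pcomp (pcomp (pcomp w (stp i)) (stp j)) (stp i) := wprod_redword _.
    have wc' : wprod c = pcomp (pcomp (pcomp w (stp j)) (stp i)) (stp j).
      by rewrite wc -!pcompA; congr pcomp; rewrite stp_braid.
    have ji : stp j (hi i) = hi j by rewrite -lohi stp_lo.
    rewrite lohi in dj.
    have [r1 w1] := reduced_rcons_intro rc wc ltac:(
       rewrite !pcompE n2 ji stp_lo n1; exact: dj).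
    have [r2 w2] := reduced_rcons_intro r1 w1 ltac:(
       rewrite !pcompE n1 lohi stp_hi; exact: ltn_trans dj di).
    have [s1 v1] := reduced_rcons_intro rc wc' ltac:(
       rewrite !pcompE n1 stp_hi lohi stp_hi n2; exact: di).
    have [s2 v2] := reduced_rcons_intro s1 v1 ltac:(
       rewrite !pcompE ji n2; exact: ltn_trans dj di).
    rewrite !foldl_rcons (IH a _ sa ra' r2) ?w2 // (IH b _ sb rb' s2) ?v2 //.
    by rewrite !foldl_rcons op_braid.
  - have n1 : stp i (hi j) = hi j by apply: stp_out; rewrite -val_eqE /=; lia.
    have n1' : stp i (lo j) = lo j by apply: stp_out; rewrite -val_eqE /=; lia.
    have n2 : stp j (lo i) = lo i by apply: stp_out; rewrite -val_eqE /=; lia.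
    have n2' : stp j (hi i) = hi i by apply: stp_out; rewrite -val_eqE /=; lia.
    pose c := redword (pcomp (pcomp w (stp i)) (stp j)).
    have rc : reduced c := reduced_redword _.
    have wc : wprod c = pcomp (pcomp w (stp i)) (stp j) := wprod_redword _.
    have wc' : wprod c = pcomp (pcomp w (stp j)) (stp i).
      by rewrite wc -!pcompA; congr pcomp; rewrite stp_comm.
    have [r1 w1] := reduced_rcons_intro rc wc ltac:(
       rewrite !pcompE n1 n1'; exact: dj).
    have [s1 v1] := reduced_rcons_intro rc wc' ltac:(
       rewrite !pcompE n2 n2'; exact: di).
    rewrite !foldl_rcons (IH a _ sa ra' r1) ?w1 // (IH b _ sb rb' s1) ?v1 //.
    by rewrite !foldl_rcons [RHS]op_comm.
  - by lia.
case/lastP: js => [|a i]; first by move=> _ _ /eqP redk /= e; move: redk; rewrite -e len1; case: ks {e}.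
case/lastP: ks => [|b j] le rj rk e.
  by move/eqP: rj; rewrite e /= len1 size_rcons.
have sa : (size a <= n)%N by move: le; rewrite size_rcons.
have sb : (size b <= n)%N.
  by move/eqP: rj; move/eqP: rk; rewrite e !size_rcons => ->; move: le; rewrite size_rcons; lia.
case: (ltngtP i j) => [ij|ij|/val_inj ij]; first exact: main.
  by apply/esym; apply: main.
subst j; rewrite !foldl_rcons; congr op; apply: IH => //.
- by move: rj; rewrite reduced_rconsE => /andP[].
- by move: rk; rewrite reduced_rconsE => /andP[].
by move: e; rewrite !wprod_rcons => /(congr1 (fun x => pcomp x (stp i))); rewrite !pcompKs.
Qed.

End Matsumoto.
End Length.

(** * The Hecke algebra action on words *)

Section Tf.
Variables (r : nat) (F : fieldType) (v : F).
Hypothesis vn0 : v != 0.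
Implicit Types (f : word r -> F) (x : word r).
Local Notation Tf := (Tf v).

Lemma Tf_quad (j : 'I_r.-1) f x :
  Tf j (Tf j f) x = (v - v^-1) * Tf j f x + f x.
Proof.
rewrite /Tf !wpermE stp_lo stp_hi wpermKs.
case: (ltgtP (x (lo j)) (x (hi j))) => h; rewrite ?ltxx ?eqxx //.
by field.
Qed.

Lemma Tf_comm (i j : 'I_r.-1) f x : (i.+1 < j)%N -> Tf i (Tf j f) x = Tf j (Tf i f) x.
Proof.
move=> ij; rewrite /Tf !wpermE.
have n1 : stp i (hi j) = hi j by apply: stp_out; rewrite -val_eqE /=; lia.
have n1' : stp i (lo j) = lo j by apply: stp_out; rewrite -val_eqE /=; lia.
have n2 : stp j (lo i) = lo i by apply: stp_out; rewrite -val_eqE /=; lia.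
have n2' : stp j (hi i) = hi i by apply: stp_out; rewrite -val_eqE /=; lia.
rewrite n1 n1' n2 n2' !wpermM stp_comm //.
case: (ltgtP (x (lo i)) (x (hi i))) => h; case: (ltgtP (x (lo j)) (x (hi j))) => h' //; ring.
Qed.

(** A comparison of the three letters involved. When two of them coincide, so do some of the
    rearranged words, as [eab], [ebc], [eac] and their consequences record; each case is then an
    identity in [v]. *)
Lemma Tf_braid (i j : 'I_r.-1) f x : j = i.+1 :> nat ->
  Tf i (Tf j (Tf i f)) x = Tf j (Tf i (Tf j f)) x.
Proof.
move=> ij.
have lohi : lo j = hi i by apply: val_inj.
have n1 : stp i (hi j) = hi j by apply: stp_out; rewrite -val_eqE /= ij; lia.
have n2 : stp j (lo i) = lo i by apply: stp_out; rewrite -val_eqE /= ij; lia.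
have ji : stp j (hi i) = hi j by rewrite -lohi stp_lo.
have ji' : stp j (hi j) = hi i by rewrite -lohi stp_hi.
have eab : x (lo i) = x (hi i) -> wperm x (stp i) = x by apply: wperm_eqs.
have ebc : x (hi i) = x (hi j) -> wperm x (stp j) = x by rewrite -lohi; apply: wperm_eqs.
have eac : x (lo i) = x (hi j) ->
   wperm (wperm (wperm x (stp i)) (stp j)) (stp i) = x.
  move=> e; apply/ffunP => p; rewrite !wpermE.
  case: (p =P lo i) => [->|/eqP pl]; first by rewrite stp_lo ji n1.
  case: (p =P hi i) => [->|/eqP ph]; first by rewrite stp_hi n2 stp_lo.
  case: (p =P hi j) => [->|/eqP pj]; first by rewrite n1 ji' stp_hi.
  by rewrite (stp_out pl ph) (@stp_out _ j) ?lohi // stp_out.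
have br : wperm (wperm (wperm x (stp j)) (stp i)) (stp j) =
          wperm (wperm (wperm x (stp i)) (stp j)) (stp i).
  by rewrite !wpermM (stp_braid ij).
have eac1 : x (lo i) = x (hi j) -> wperm (wperm x (stp i)) (stp j) = wperm x (stp i).
  by move/eac => {2}<-; rewrite wpermKs.
have eac2 : x (lo i) = x (hi j) -> wperm (wperm x (stp j)) (stp i) = wperm x (stp j).
  by move/eac; rewrite -br => {2}<-; rewrite wpermKs.
rewrite /Tf !wpermE !lohi ?(stp_lo, stp_hi, n1, n2, ji, ji') ?lohi br.
case: (ltgtP (x (lo i)) (x (hi i))) => h1;
case: (ltgtP (x (hi i)) (x (hi j))) => h2;
case: (ltgtP (x (lo i)) (x (hi j))) => h3; try (exfalso; lia);
rewrite ?wpermKs ?(eab h1) ?(ebc h2) ?(eac1 h3) ?(eac2 h3) ?(eac h3) ?wpermKs; try by field.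
Qed.

End Tf.

(** * The tensor space as a right module over the Hecke algebra *)

Section HeckeModule.
Variable r : nat.
Implicit Types (i : word r) (w : sym r) (u : Omega r) (h : Hk r).

Lemma actT_coefE u (j : 'I_r.-1) :
  (fun k => (actT u j)@_k) = Tf vv j (fun k => u@_k).
Proof. by apply: functional_extensionality => k; apply: actT_coef. Qed.

Lemma actT_quad u (j : 'I_r.-1) :
  actT (actT u j) j = (vv - vv^-1) *: actT u j + u.
Proof.
apply/malgP => k. rewrite [RHS]mcoeffD. rewrite [X in _ = X + _]coefZ. rewrite [LHS]actT_coef. rewrite actT_coefE.
rewrite (Tf_quad vv_neq0). by rewrite actT_coef.
Qed.

Lemma actT_coef2 u (i j : 'I_r.-1) k :
  (actT (actT u i) j)@_k = Tf vv j (Tf vv i (fun k => u@_k)) k.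
Proof.
exact: etrans (actT_coef _ _ _) (congr1 (fun f => Tf vv j f k) (actT_coefE u i)).
Qed.

Lemma actT_comm u (i j : 'I_r.-1) : (i.+1 < j)%N -> actT (actT u i) j = actT (actT u j) i.
Proof.
move=> ij; apply/malgP => k; apply: etrans (actT_coef2 _ _ _ _) _.
apply: etrans _ (esym (actT_coef2 _ _ _ _)); exact: (esym (Tf_comm vv_neq0 _ _ ij)).
Qed.

Lemma actT_coef3 u (i j l : 'I_r.-1) k :
  (actT (actT (actT u i) j) l)@_k = Tf vv l (Tf vv j (Tf vv i (fun k => u@_k))) k.
Proof.
apply: etrans (actT_coef _ _ _) (congr1 (fun f => Tf vv l f k) _).
by apply: functional_extensionality => m; apply: actT_coef2.
Qed.

Lemma actT_braid u (i j : 'I_r.-1) : j = i.+1 :> nat ->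
  actT (actT (actT u i) j) i = actT (actT (actT u j) i) j.
Proof.
move=> ij; apply/malgP => k; apply: etrans (actT_coef3 _ _ _ _ _) _.
apply: etrans _ (esym (actT_coef3 _ _ _ _ _)); exact: (Tf_braid vv_neq0).
Qed.

Lemma actT_matsumoto js ks u : reduced js -> reduced ks -> wprod js = wprod ks ->
  foldl (@actT r) u js = foldl (@actT r) u ks.
Proof. exact: matsumoto actT_comm actT_braid js ks u. Qed.

Lemma actH_linr u : islin (actH u).
Proof. exact: finsum_lin. Qed.

Lemma foldl_actT_lin js : islin (fun u : Omega r => foldl (@actT r) u js).
Proof.
elim: js => [|j js IH]; first by move=> a x y.
exact: (lin_map_comp IH (actT_lin j)).
Qed.

Lemma actH_linl h : islin (fun u : Omega r => actH u h).
Proof. by apply: lin_map_bigsum => w; apply/lin_map_scale/foldl_actT_lin. Qed.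

Lemma actH_hbas u w : actH u (hbas w) = foldl (@actT r) u (redword w).
Proof. exact: finsumU. Qed.

#[global] Opaque actH.

Lemma actH_word u js : reduced js -> actH u (hbas (wprod js)) = foldl (@actT r) u js.
Proof.
move=> red; rewrite actH_hbas; apply: actT_matsumoto => //.
  exact: reduced_redword.
exact: wprod_redword.
Qed.

Lemma actH_cons u w (j : 'I_r.-1) : (len w < len (pcomp (stp j) w))%N ->
  actH u (hbas (pcomp (stp j) w)) = actH (actT u j) (hbas w).
Proof.
move=> asc; rewrite -{1}(wprod_redword w) -[pcomp _ _]/(wprod (j :: redword w)).
rewrite actH_word /=; first by rewrite actH_hbas.
rewrite /reduced /= wprod_redword size_redword.
by have := len_stp_alt (w^-1)%g j; rewrite -len_left len_inv; lia.
Qed.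

Lemma Hk_eq_lin (W : lmodType Qv) (f g : Hk r -> W) :
  islin f -> islin g -> (forall w, f (hbas w) = g (hbas w)) ->
  forall h, f h = g h.
Proof. exact: eq_lin_map. Qed.

Lemma lmulT_lin (j : 'I_r.-1) : islin (lmulT j).
Proof. exact: (@finsum_lin _ _ (lmulT_bas j)). Qed.

Lemma lmulT_hbas (j : 'I_r.-1) w : lmulT j (hbas w) = lmulT_bas j w.
Proof. exact: finsumU. Qed.

#[global] Opaque lmulT.

(** If [j] lengthens [w], prefixing it to a reduced word is again reduced. Otherwise [w] itself
    begins with [j], and the quadratic relation for [actT] matches the second case of
    [lmulT_bas]. *)
Lemma actH_lmulT u (j : 'I_r.-1) h : actH u (lmulT j h) = actH (actT u j) h.
Proof.
apply: (@Hk_eq_lin _ (fun h => actH u (lmulT j h)) (actH (actT u j))).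
- exact: (lin_map_comp (actH_linr u) (lmulT_lin j)).
- exact: actH_linr.
move=> w; rewrite lmulT_hbas /lmulT_bas; case: ifP => [asc|nasc].
  exact: actH_cons.
have asc : (len (pcomp (stp j) w) < len (pcomp (stp j) (pcomp (stp j) w)))%N.
  move: nasc; rewrite pcompsK.
  by have := len_stp_alt (w^-1)%g j; rewrite -len_left len_inv; lia.
have := actH_cons u asc; rewrite pcompsK => e.
rewrite (lin_mapD (actH_linr u)) (lin_mapZ (actH_linr u)) e.
have := actH_cons (actT u j) asc; rewrite pcompsK => ->.
by rewrite actT_quad (lin_mapD (actH_linl _)) (lin_mapZ (actH_linl _)).
Qed.

Lemma hmul_linl h : islin (fun h' => hmul h' h).
Proof. exact: finsum_lin. Qed.

Lemma hmul_hbas w h : hmul (hbas w) h = foldr (@lmulT r) h (redword w).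
Proof. exact: finsumU. Qed.

#[global] Opaque hmul.

(** [hmul] multiplies along canonical reduced words, so associativity is not visible from its
    definition; it is recovered from this identity in [hMA]. *)
Lemma actHM u h h' : actH u (hmul h h') = actH (actH u h) h'.
Proof.
apply: (@Hk_eq_lin _ (fun h => actH u (hmul h h')) (fun h => actH (actH u h) h')).
- exact: (lin_map_comp (actH_linr u) (hmul_linl h')).
- exact: (lin_map_comp (actH_linl h') (actH_linr u)).
move=> w; rewrite hmul_hbas actH_hbas.
elim: (redword w) u => [|j js IH] u; first by [].
by rewrite [foldr _ _ _]/= [foldl _ _ _]/= actH_lmulT IH.
Qed.

End HeckeModule.

(** * Invariant forms *)

(* [hV] stands for the tensor space and [hH] for the Hecke algebra: [vc] and [hc] are the coefficient
   functions in the bases [vb] and [hb], [vs] is the support of a vector, [aT] and [aH] are the right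
   actions of a generator and of the algebra, and [hM] is the product. *)
Record hecke_data (r : nat) := HeckeData {
  hF : fieldType;
  hv : hF;
  hV : lmodType hF;
  hH : lmodType hF;
  vb : word r -> hV;
  vc : hV -> word r -> hF;
  vs : hV -> seq (word r);
  hb : sym r -> hH;
  hc : hH -> sym r -> hF;
  aT : hV -> 'I_r.-1 -> hV;
  aH : hV -> hH -> hV;
  hM : hH -> hH -> hH;
  hv_neq0 : hv != 0;
  hreal : forall s : seq hF, \sum_(x <- s) x ^+ 2 = 0 -> forall x, x \in s -> x = 0;
  vc_lin : forall k, @islin hF hV hF^o (fun u => vc u k);
  vc_bas : forall i k, vc (vb i) k = (i == k)%:R;
  vc_ext : forall u u', (forall k, vc u k = vc u' k) -> u = u';
  vs_uniq : forall u, uniq (vs u);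
  vs_mem : forall u i, (i \in vs u) = (vc u i != 0);
  hc_lin : forall w, @islin hF hH hF^o (fun h => hc h w);
  hc_bas : forall w w', hc (hb w) w' = (w == w')%:R;
  hc_ext : forall h h', (forall w, hc h w = hc h' w) -> h = h';
  aT_coef : forall u j i, vc (aT u j) i = Tf hv j (vc u) i;
  aT_bas : forall i j, aT (vb i) j =
    if i (lo j) < i (hi j) then vb (wperm i (stp j))
    else if i (lo j) == i (hi j) then hv *: vb i
    else (hv - hv^-1) *: vb i + vb (wperm i (stp j));
  aT_quad : forall u j, aT (aT u j) j = (hv - hv^-1) *: aT u j + u;
  aH_linr : forall u, islin (aH u);
  aH_word : forall u js, reduced js -> aH u (hb (wprod js)) = foldl aT u js;
  aHM : forall u h h', aH u (hM h h') = aH (aH u h) h'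
}.

Section Theory.
Variables (r : nat) (D : hecke_data r).
Local Notation F := (hF D).
Local Notation v := (hv D).
Local Notation V := (hV D).
Local Notation H := (hH D).
Local Notation vb := (vb D).
Local Notation hb := (hb D).
Implicit Types (i k : word r) (w : sym r) (u p q : V) (h a b : H) (j : 'I_r.-1).

Lemma vcD u u' k : vc (u + u') k = vc u k + vc u' k.
Proof. exact: (lin_mapD (@vc_lin _ D k)). Qed.
Lemma vcZ (c : F) u k : vc (c *: u) k = c * vc u k.
Proof. exact: (lin_mapZ (@vc_lin _ D k)). Qed.
Lemma vc0 k : vc (0 : V) k = 0.
Proof. exact: (lin_map0 (@vc_lin _ D k)). Qed.
Lemma vcB u u' k : vc (u - u') k = vc u k - vc u' k.
Proof. exact: (lin_mapB (@vc_lin _ D k)). Qed.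
Lemma vc_sum (I : Type) (s : seq I) (P : pred I) (G : I -> V) k :
  vc (\sum_(i <- s | P i) G i) k = \sum_(i <- s | P i) vc (G i) k.
Proof. exact: (lin_map_sum (@vc_lin _ D k)). Qed.
Lemma hcD h h' w : hc (h + h') w = hc h w + hc h' w.
Proof. exact: (lin_mapD (@hc_lin _ D w)). Qed.
Lemma hcZ (c : F) h w : hc (c *: h) w = c * hc h w.
Proof. exact: (lin_mapZ (@hc_lin _ D w)). Qed.
Lemma hc0 w : hc (0 : H) w = 0.
Proof. exact: (lin_map0 (@hc_lin _ D w)). Qed.
Lemma hc_sum (I : Type) (s : seq I) (P : pred I) (G : I -> H) w :
  hc (\sum_(i <- s | P i) G i) w = \sum_(i <- s | P i) hc (G i) w.
Proof. exact: (lin_map_sum (@hc_lin _ D w)). Qed.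

Lemma vc_out u k : k \notin vs u -> vc u k = 0.
Proof. by rewrite vs_mem negbK => /eqP. Qed.

Lemma sum_vs (W : zmodType) u (s : seq (word r)) (G : word r -> W) :
  uniq s -> {subset vs u <= s} -> (forall k, k \notin vs u -> G k = 0) ->
  \sum_(k <- vs u) G k = \sum_(k <- s) G k.
Proof.
move=> us sub out; rewrite [RHS](bigID (fun k => k \in vs u)) /=.
rewrite [X in _ + X]big1 ?addr0 => [|k /out //].
rewrite -[RHS]big_filter; apply: perm_big; apply: uniq_perm => [||k].
- exact: vs_uniq.
- exact: filter_uniq.
by rewrite mem_filter; case: (boolP (k \in vs u)) => //= /sub.
Qed.

Lemma vdec u : u = \sum_(k <- vs u) vc u k *: vb k.
Proof.
apply: (@vc_ext _ D) => k; rewrite vc_sum.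
rewrite (eq_bigr (fun i => if i == k then vc u k else 0)); last first.
  by move=> i _; rewrite vcZ vc_bas; case: eqP => [->|_]; rewrite ?mulr1 ?mulr0.
rewrite -big_mkcond /=; case: (boolP (k \in vs u)) => ku.
  by rewrite -big_filter filter_pred1_uniq ?vs_uniq // big_seq1.
rewrite vc_out // big_seq_cond big1 // => i /andP[iu /eqP e].
Qed.

Lemma veq_lin (W : lmodType F) (f g : V -> W) : islin f -> islin g ->
  (forall i, f (vb i) = g (vb i)) -> forall u, f u = g u.
Proof.
move=> fL gL e u; rewrite [u]vdec !lin_map_sum //.
by apply: eq_bigr => i _; rewrite !lin_mapZ // e.
Qed.

Definition vext (W : lmodType F) (g : word r -> W) (u : V) : W :=
  \sum_(k <- vs u) vc u k *: g k.

Lemma vext_lin (W : lmodType F) (g : word r -> W) : islin (vext g).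
Proof.
move=> c x y; pose s := undup (vs (c *: x + y) ++ vs x ++ vs y).
have us : uniq s by apply: undup_uniq.
have o (z : V) k : k \notin vs z -> vc z k *: g k = 0.
  by move/vc_out ->; rewrite scale0r.
rewrite /vext !(@sum_vs _ _ s) //; try exact: o;
  try by move=> k kk; rewrite mem_undup !mem_cat kk ?orbT.
rewrite scaler_sumr -big_split /=; apply: eq_bigr => k _.
by rewrite vcD vcZ scalerDl scalerA.
Qed.

Lemma vb_vc1 i k : i != k -> vc (vb i) k = 0.
Proof. by move=> n; rewrite vc_bas (negPf n). Qed.

Lemma vextU (W : lmodType F) (g : word r -> W) i : vext g (vb i) = g i.
Proof.
rewrite /vext (@sum_vs _ _ [:: i]) //.
- by rewrite big_seq1 vc_bas eqxx scale1r.
- by move=> k; rewrite vs_mem vc_bas inE [k == i]eq_sym; case: (i == k) => //; rewrite eqxx.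
- by move=> k /vc_out ->; rewrite scale0r.
Qed.

Lemma hdec h : h = \sum_w hc h w *: hb w.
Proof.
apply: (@hc_ext _ D) => w; rewrite hc_sum (bigD1 w isT) /= hcZ hc_bas eqxx mulr1.
by rewrite big1 ?addr0 // => x xw; rewrite hcZ hc_bas (negPf xw) mulr0.
Qed.

Lemma heq_lin (W : lmodType F) (f g : H -> W) : islin f -> islin g ->
  (forall w, f (hb w) = g (hb w)) -> forall h, f h = g h.
Proof.
move=> fL gL e h; rewrite [h]hdec !lin_map_sum //.
by apply: eq_bigr => i _; rewrite !lin_mapZ // e.
Qed.

Lemma hext_lin (W : lmodType F) (g : sym r -> W) :
  islin (fun h : H => \sum_w hc h w *: g w).
Proof.
move=> c x y; rewrite scaler_sumr -big_split /=; apply: eq_bigr => w _.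
by rewrite hcD hcZ scalerDl scalerA.
Qed.

Lemma hextU (W : lmodType F) (g : sym r -> W) w :
  \sum_x hc (hb w) x *: g x = g w.
Proof.
rewrite (bigD1 w isT) /= hc_bas eqxx scale1r big1 ?addr0 // => x xw.
by rewrite hc_bas eq_sym (negPf xw) scale0r.
Qed.

Lemma aT_lin j : islin (fun u : V => aT u j).
Proof.
move=> c x y; apply: (@vc_ext _ D) => k; rewrite vcD vcZ !aT_coef /Tf.
by do 2?case: ifP => _; rewrite !vcD !vcZ; ring.
Qed.

Lemma aHE u h : aH u h = \sum_w hc h w *: aH u (hb w).
Proof.
rewrite {1}[h]hdec (lin_map_sum (aH_linr u)); apply: eq_bigr => w _.
by rewrite (lin_mapZ (aH_linr u)).
Qed.

Lemma aH_hb u w : aH u (hb w) = foldl (@aT _ D) u (redword w).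
Proof. by rewrite -{1}(wprod_redword w) aH_word // reduced_redword. Qed.

Lemma foldl_aT_lin js : islin (fun u : V => foldl (@aT _ D) u js).
Proof.
elim: js => [|j js IH]; first by move=> c x y.
exact: (lin_map_comp IH (aT_lin j)).
Qed.

Lemma aH_linl h : islin (fun u : V => aH u h).
Proof.
move=> c x y; rewrite !(aHE _ h) scaler_sumr -big_split /=.
by apply: eq_bigr => w _; rewrite !aH_hb foldl_aT_lin scalerDr !scalerA mulrC.
Qed.

Lemma aH1 u : aH u (hb 1%g) = u.
Proof. by rewrite (@aH_word _ D u [::]) // /reduced /= len1. Qed.

Lemma aH_rcons u w j : (w (lo j) < w (hi j))%N ->
  aH u (hb (pcomp w (stp j))) = aT (aH u (hb w)) j.
Proof.
move=> asc; rewrite -{1}(wprod_redword w) -wprod_rcons aH_word ?foldl_rcons.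
  by rewrite aH_hb.
by rewrite reduced_rconsE reduced_redword wprod_redword.
Qed.

Lemma len_stp_left_alt w j :
  len (pcomp (stp j) w) = (len w).+1 \/ len w = (len (pcomp (stp j) w)).+1.
Proof. by have := len_stp_alt (w^-1)%g j; rewrite -len_left len_inv. Qed.

Lemma aH_cons u w j : (len w < len (pcomp (stp j) w))%N ->
  aH u (hb (pcomp (stp j) w)) = aH (aT u j) (hb w).
Proof.
move=> asc; rewrite -{1}(wprod_redword w) -[pcomp _ _]/(wprod (j :: redword w)).
rewrite aH_word /=; first by rewrite aH_hb.
rewrite /reduced /= wprod_redword size_redword.
by have := len_stp_left_alt w j; lia.
Qed.

Lemma aT_aH u j : aT u j = aH u (hb (stp j)).
Proof.
rewrite -[stp j]pcomp1p aH_rcons ?aH1 //.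
by rewrite !perm1 lo_lt_hi.
Qed.

Definition varpi : word r := [ffun p : 'I_r => (p.+1)%:Z].
Definition om : V := vb varpi.

Lemma varpi_inj (p q : 'I_r) : varpi p = varpi q -> p = q.
Proof. by rewrite !ffunE => -[] e; apply: val_inj. Qed.

Lemma wperm_varpi_inj (x y : sym r) : wperm varpi x = wperm varpi y -> x = y.
Proof.
by move/ffunP => e; apply/permP => p; have := e p; rewrite !wpermE => /varpi_inj.
Qed.

(** The letters of [varpi] are distinct and increasing, so along a reduced word every generator
    meets an ascent and only permutes. Thus [om H] is a copy of the regular representation, and
    identities in H can be checked on [om]. *)
Lemma aH_om w : aH om (hb w) = vb (wperm varpi w).
Proof.
rewrite aH_hb; have := reduced_redword w; rewrite -{3}(wprod_redword w).
elim/last_ind: (redword w) => [|js j IH]; first by rewrite /= wperm1.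
rewrite reduced_rconsE foldl_rcons wprod_rcons => /andP[/IH -> asc].
rewrite aT_bas wpermM ifT // !wpermE !ffunE.
by move: asc; lia.
Qed.

Lemma aH_om_coef h w : vc (aH om h) (wperm varpi w) = hc h w.
Proof.
rewrite aHE vc_sum (bigD1 w isT) /= big1 => [|x xw].
  by rewrite vcZ aH_om vc_bas eqxx mulr1 addr0.
rewrite vcZ aH_om vb_vc1 ?mulr0 //; apply: contra_neq xw.
exact: wperm_varpi_inj.
Qed.

Lemma aH_om_inj h h' : aH om h = aH om h' -> h = h'.
Proof. by move=> e; apply: (@hc_ext _ D) => w; rewrite -!aH_om_coef e. Qed.

Lemma hMA h1 h2 h3 : hM h1 (hM h2 h3) = hM (hM h1 h2) h3.
Proof. by apply: aH_om_inj; rewrite !aHM. Qed.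

Lemma hM_linr h : islin (hM h).
Proof. by move=> c x y; apply: aH_om_inj; rewrite aHM !aH_linr !aHM. Qed.

Lemma hM_linl h : islin (fun x : H => hM x h).
Proof. by move=> c x y; apply: aH_om_inj; rewrite aHM !aH_linr !aHM aH_linl. Qed.

(* The form making the basis of words orthonormal. *)
Definition dot (u u' : V) : F := \sum_(k <- vs u) vc u k * vc u' k.

Lemma dot_linl u' : @islin F V F^o (fun u => dot u u').
Proof. exact: (@vext_lin F^o (fun k => vc u' k)). Qed.

Lemma dot_vb i u : dot (vb i) u = vc u i.
Proof. exact: (@vextU F^o (fun k => vc u k)). Qed.

Lemma dotC u u' : dot u u' = dot u' u.
Proof.
pose s := undup (vs u ++ vs u').
have us : uniq s by apply: undup_uniq.
rewrite /dot (@sum_vs _ u s) ?(@sum_vs _ u' s) //.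
- by apply: eq_bigr => k _; rewrite mulrC.
- by move=> k kk; rewrite mem_undup mem_cat kk orbT.
- by move=> k /vc_out ->; rewrite mul0r.
- by move=> k kk; rewrite mem_undup mem_cat kk.
- by move=> k /vc_out ->; rewrite mul0r.
Qed.

Lemma dot_linr u : @islin F V F^o (dot u).
Proof. by move=> c x y; rewrite !(dotC u) dot_linl. Qed.

Lemma sum_sq0 (I : eqType) (s : seq I) (f : I -> F) :
  \sum_(x <- s) f x ^+ 2 = 0 -> forall x, x \in s -> f x = 0.
Proof.
move=> e x xs; have := @hreal _ D (map f s); rewrite big_map => /(_ e) h0.
by apply: h0; apply: map_f.
Qed.

Lemma dot_eq0 u : dot u u = 0 -> u = 0.
Proof.
move=> e; apply: (@vc_ext _ D) => k; rewrite vc0.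
case: (boolP (k \in vs u)) => [ku|]; last exact: vc_out.
by apply: (sum_sq0 _ ku); rewrite -[RHS]e; apply: eq_bigr => i _; rewrite expr2.
Qed.

Lemma dot_aT u u' j : dot (aT u j) u' = dot u (aT u' j).
Proof.
apply: (@veq_lin F^o (fun u => dot (aT u j) u') (fun u => dot u (aT u' j))) => [||i].
- exact: (lin_map_comp (dot_linl u') (aT_lin j)).
- exact: dot_linl.
apply: (@veq_lin F^o (dot (aT (vb i) j)) (fun u => dot (vb i) (aT u j))) => [||k].
- exact: dot_linr.
- exact: (lin_map_comp (dot_linr (vb i)) (aT_lin j)).
rewrite dotC !dot_vb aT_coef aT_bas /Tf.
by do 2?case: ifP => _; rewrite ?vcD ?vcZ !vc_bas !(eq_sym i).
Qed.

(** The anti-involution of the Hecke algebra; [dot_aH] identifies it with taking adjoints. *)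
Definition star (h : H) : H := \sum_w hc h w *: hb (w^-1)%g.

Lemma star_lin : islin star.
Proof. exact: hext_lin. Qed.

Lemma star_hb w : star (hb w) = hb (w^-1)%g.
Proof. exact: hextU. Qed.

Lemma hc_star h w : hc (star h) w = hc h (w^-1)%g.
Proof.
rewrite /star hc_sum (bigD1 (w^-1)%g isT) /= hcZ hc_bas invgK eqxx mulr1.
rewrite big1 ?addr0 // => x xw; rewrite hcZ hc_bas; case: eqP => [e|_].
  by rewrite -e invgK eqxx in xw.
by rewrite mulr0.
Qed.

Lemma starK h : star (star h) = h.
Proof. by apply: (@hc_ext _ D) => w; rewrite !hc_star invgK. Qed.

Lemma dot_aH u u' h : dot (aH u h) u' = dot u (aH u' (star h)).
Proof.
apply: (@heq_lin F^o (fun h => dot (aH u h) u') (fun h => dot u (aH u' (star h)))) => [||w].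
- exact: (lin_map_comp (dot_linl u') (aH_linr u)).
- exact: (lin_map_comp (dot_linr u) (lin_map_comp (aH_linr u') star_lin)).
have red : reduced (rev (redword w)).
  by rewrite /reduced wprod_rev wprod_redword len_inv size_rev size_redword.
rewrite star_hb -{2}(wprod_redword w) -wprod_rev aH_word // aH_hb.
elim: (redword w) u u' {red} => [|j js IH] u u' //=.
by rewrite IH rev_cons foldl_rcons dot_aT.
Qed.

Lemma dot_ext u u' : (forall x, dot x u = dot x u') -> u = u'.
Proof. by move=> e; apply: (@vc_ext _ D) => k; rewrite -!dot_vb. Qed.

Lemma starM a b : star (hM a b) = hM (star b) (star a).
Proof.
apply: aH_om_inj; apply: dot_ext => x.
by rewrite -dot_aH !aHM -!dot_aH.
Qed.

Definition hdot a b : F := \sum_w hc a w * hc b w.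

Lemma hdotE a b : hdot a b = dot (aH om a) (aH om b).
Proof.
rewrite [aH om a]aHE (lin_map_sum (dot_linl _)); apply: eq_bigr => w _.
by rewrite (lin_mapZ (dot_linl _)) aH_om dot_vb aH_om_coef.
Qed.

Lemma hdot_hb a w : hdot a (hb w) = hc a w.
Proof.
rewrite /hdot (bigD1 w isT) /= hc_bas eqxx mulr1 big1 ?addr0 // => x xw.
by rewrite hc_bas eq_sym (negPf xw) mulr0.
Qed.

Lemma hdot_ext a b : (forall x, hdot a x = hdot b x) -> a = b.
Proof. by move=> e; apply: (@hc_ext _ D) => w; rewrite -!hdot_hb. Qed.

Lemma hdot_star a b : hdot (star a) (star b) = hdot a b.
Proof.
rewrite /hdot (reindex_inj invg_inj) /=.
by apply: eq_bigr => w _; rewrite !hc_star invgK.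
Qed.

Lemma hdot_Mr a b h : hdot (hM a h) b = hdot a (hM b (star h)).
Proof. by rewrite !hdotE !aHM dot_aH. Qed.

Lemma hdot_Ml a b h : hdot (hM h a) b = hdot a (hM (star h) b).
Proof.
by rewrite -hdot_star starM hdot_Mr -starM hdot_star.
Qed.

(* The [H]-valued inner product [sum_w (p T_w, u) T_w], conjugate-linear in [p] for [star]. *)
Definition ip p u : H := \sum_w dot (aH p (hb w)) u *: hb w.

Lemma hc_ip p u w : hc (ip p u) w = dot (aH p (hb w)) u.
Proof.
rewrite /ip hc_sum (bigD1 w isT) /= hcZ hc_bas eqxx mulr1.
by rewrite big1 ?addr0 // => x xw; rewrite hcZ hc_bas (negPf xw) mulr0.
Qed.

(** This says that [ip p] is adjoint to [a |-> p a]; its behaviour under H on either side follows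
    from it. *)
Lemma hdot_ip p u a : hdot (ip p u) a = dot (aH p a) u.
Proof.
rewrite [aH p a]aHE (lin_map_sum (dot_linl _)); apply: eq_bigr => w _.
by rewrite hc_ip (lin_mapZ (dot_linl _)) mulrC.
Qed.

Lemma ip_linr p : islin (ip p).
Proof.
move=> c x y; apply: (@hc_ext _ D) => w; rewrite hcD hcZ !hc_ip.
exact: dot_linr.
Qed.

Lemma ip_aHr p u h : ip p (aH u h) = hM (ip p u) h.
Proof.
by apply: hdot_ext => a; rewrite hdot_Mr !hdot_ip dotC dot_aH dotC aHM.
Qed.

Lemma ip_aHl p u h : ip (aH p h) u = hM (star h) (ip p u).
Proof.
by apply: hdot_ext => a; rewrite hdot_Ml starK !hdot_ip aHM.
Qed.

Lemma star_ip p u : star (ip p u) = ip u p.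
Proof.
apply: hdot_ext => a; rewrite -[in LHS](starK a) hdot_star !hdot_ip dotC.
by rewrite -dot_aH.
Qed.

Definition Schur (f : V -> V) := islin f /\ forall u h, f (aH u h) = aH (f u) h.

Definition rank1 q p u : V := aH q (ip p u).

Lemma rank1_Schur q p : Schur (rank1 q p).
Proof.
split; first exact: (lin_map_comp (aH_linr q) (ip_linr p)).
by move=> u h; rewrite /rank1 ip_aHr aHM.
Qed.

End Theory.

(** * Young subgroups and their symmetrizers *)

Section Words.
Variable r : nat.
Implicit Types (i L : word r) (w : sym r) (j : 'I_r.-1).

Definition wincr L := forall p q : 'I_r, (p <= q)%N -> L p <= L q.
Definition young_of L : {set sym r} := [set w | wperm L w == L].
Definition strict_on L i := forall p q : 'I_r, (p < q)%N -> L p = L q -> i p < i q.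
Definition inj_on L i := forall p q : 'I_r, L p = L q -> i p = i q -> p = q.
Definition posw i := forall p : 'I_r, 0 < i p.
(** A termination measure for sorting: exchanging two neighbours lowers it when [g] and the absolute
    values of the letters are ordered the same way. [y_sort] takes [g] decreasing, [climb] takes it
    increasing. *)
Definition wt (g : 'I_r -> nat) i : nat := (\sum_(p < r) g p * `|i p|)%N.

Lemma young_ofP L w : reflect (forall p, L (w p) = L p) (w \in young_of L).
Proof.
rewrite inE; apply: (iffP eqP) => [e p|e]; first by rewrite -wpermE e.
by apply/ffunP => p; rewrite wpermE.
Qed.

Lemma wincr_lohi L j : wincr L -> L (lo j) <= L (hi j).
Proof. by apply; apply: leqnSn. Qed.

Lemma young_left L j w : L (lo j) = L (hi j) ->
  (pcomp (stp j) w \in young_of L) = (w \in young_of L).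
Proof. by move=> e; rewrite !inE -wpermM wperm_eqs. Qed.

Lemma young_right L j w : L (lo j) = L (hi j) ->
  (pcomp w (stp j) \in young_of L) = (w \in young_of L).
Proof.
move=> e; rewrite !inE -wpermM; apply/eqP/eqP => [h|->]; last exact: wperm_eqs.
by rewrite -[LHS](wpermKs _ j) h wperm_eqs.
Qed.

Lemma wt_swap (g : 'I_r -> nat) i j :
  ((g (lo j) < g (hi j)) && (`|i (lo j)| < `|i (hi j)|) ||
  (g (hi j) < g (lo j)) && (`|i (hi j)| < `|i (lo j)|))%N ->
  (wt g (wperm i (stp j)) < wt g i)%N.
Proof.
have E i' : wt g i' = (g (lo j) * `|i' (lo j)| + (g (hi j) * `|i' (hi j)| +
    \sum_(p < r | (p != lo j) && (p != hi j)) g p * `|i' p|))%N.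
  by rewrite /wt (bigD1 (lo j)) //= (bigD1 (hi j)) ?hi_neq_lo.
rewrite !E !wpermE stp_lo stp_hi.
rewrite (eq_bigr (fun p => (g p * `|i p|)%N)); last first.
  by move=> p /andP[pl ph]; rewrite wpermE stp_out.
by move: (bigop.body _ _ _) => X; nia.
Qed.

Lemma strict_adj L i : wincr L ->
  (forall j, L (lo j) = L (hi j) -> i (lo j) < i (hi j)) -> strict_on L i.
Proof.
move=> Linc adj p q; move e: (q - p)%N => n; elim: n p q e => [|n IH] p q e pq Lpq; first by lia.
have jP : (p < r.-1)%N by have := ltn_ord q; lia.
have plo : p = lo (Ordinal jP) by apply: val_inj.
have hq : (hi (Ordinal jP) <= q)%N by [].
have eL : L (lo (Ordinal jP)) = L (hi (Ordinal jP)).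
  apply/eqP; rewrite eq_le wincr_lohi //= -plo Lpq; exact: Linc.
have := adj _ eL; rewrite -plo; case: (ltngtP (hi (Ordinal jP) : nat) q) hq => // [h|/val_inj <-] _ //.
move/lt_trans; apply; apply: IH => //=; first by lia.
by rewrite -eL -plo.
Qed.

Lemma strict_inj L i : strict_on L i -> inj_on L i.
Proof.
move=> s p q eL ei; case: (ltngtP p q) => [h|h|/val_inj //].
  by have := s _ _ h eL; rewrite ei ltxx.
by have := s _ _ h (esym eL); rewrite ei ltxx.
Qed.

Lemma posw_perm i w : posw i -> posw (wperm i w).
Proof. by move=> pos p; rewrite wpermE. Qed.

End Words.

(** * Symmetrizers of Young subgroups acting on words *)

Section Young.
Variables (r : nat) (D : hecke_data r).
Local Notation F := (hF D).
Local Notation v := (hv D).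
Local Notation V := (hV D).
Local Notation H := (hH D).
Local Notation vb := (vb D).
Local Notation hb := (hb D).
Implicit Types (i k L : word r) (w : sym r) (u : V) (h : H) (j : 'I_r.-1).

Definition x_of L : H := \sum_(w in young_of L) v ^+ len w *: hb w.
Definition y_of L : H :=
  \sum_(w in young_of L) ((- v ^+ 2)^-1) ^+ len w *: (v ^+ len w *: hb w).

Let v0 : v != 0 := hv_neq0 D.

(** A reduced word only swaps at ascents of the permutation built so far, and [L] is increasing, so
    the third case of [aT_bas] never occurs. A factor [v] appears exactly at equal letters, which
    for [w] in the Young subgroup is every step. *)
Lemma word_act L w : wincr L ->
  exists2 m, aH (vb L) (hb w) = v ^+ m *: vb (wperm L w) & (w \in young_of L -> m = len w).
Proof.
move=> Linc; rewrite -(wprod_redword w); have := reduced_redword w.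
elim/last_ind: (redword w) => [|js j IH].
  move=> _; exists 0%N; last by rewrite len1.
  by rewrite /= aH1 wperm1 expr0 scale1r.
move=> red; have := red; rewrite reduced_rconsE => /andP[red' asc].
have [m e1 e2] := IH red'; rewrite wprod_rcons aH_rcons // e1.
rewrite (lin_mapZ (aT_lin j)) aT_bas !wpermE wpermM.
have := Linc _ _ (ltnW asc); rewrite le_eqVlt => /orP[/eqP e|lt].
- rewrite e ltxx eqxx; exists m.+1; first by rewrite scalerA -exprSr -wpermM wperm_eqs ?wpermE.
  move=> wY; rewrite len_asc // e2 //.
  by move: wY; rewrite !inE -wpermM wperm_eqs ?wpermE.
- rewrite lt; exists m => // /young_ofP wY; exfalso.
  have := wY (lo j); have := wY (hi j); rewrite !pcompE stp_lo stp_hi => h1 h2.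
  by have := wincr_lohi j Linc; rewrite -h1 -h2; lia.
Qed.

(** By [word_act] the coefficient [(L T_w, L)] is [v ^ len w] on the Young subgroup and 0 elsewhere.
    Through this identity the Specht generator becomes [ip] of [omega_mu] with [p_mu]. *)
Lemma x_ofE L : wincr L -> x_of L = ip (vb L) (vb L).
Proof.
move=> Linc; apply: (@hc_ext _ D) => w; rewrite hc_ip /x_of hc_sum.
have [m -> mE] := word_act w Linc.
rewrite (lin_mapZ (dot_linl _)) dot_vb vc_bas /GRing.scale /=.
case: (boolP (w \in young_of L)) => wY.
  rewrite (bigD1 w) //= hcZ hc_bas eqxx big1 ?addr0.
    by rewrite mE // eq_sym; move: wY; rewrite inE => ->.
  by move=> x /andP[_ xw]; rewrite hcZ hc_bas (negPf xw) mulr0.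
rewrite big1 => [|x xY]; last first.
  by rewrite hcZ hc_bas; case: eqP => [e|_]; rewrite ?mulr0 //; rewrite -e xY in wY.
by move: wY; rewrite inE eq_sym => /negPf ->; rewrite mulr0.
Qed.

Lemma lmul_hb j w : hM (hb (stp j)) (hb w) =
  if (len w < len (pcomp (stp j) w))%N then hb (pcomp (stp j) w)
  else (v - v^-1) *: hb w + hb (pcomp (stp j) w).
Proof.
apply: aH_om_inj; rewrite aHM -aT_aH; case: ifP => [asc|nasc]; first by rewrite aH_cons.
have asc : (len (pcomp (stp j) w) < len (pcomp (stp j) (pcomp (stp j) w)))%N.
  by move: nasc; rewrite pcompsK; have := len_stp_left_alt w j; lia.
have e u : aH u (hb w) = aH (aT u j) (hb (pcomp (stp j) w)).
  by rewrite -{1}[w](pcompsK j) aH_cons.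
by rewrite (lin_mapD (aH_linr _)) (lin_mapZ (aH_linr _)) !e aT_quad aH_linl.
Qed.

Lemma hc_lmul j h w : hc (hM (hb (stp j)) h) w =
  if (len w < len (pcomp (stp j) w))%N then hc h (pcomp (stp j) w)
  else (v - v^-1) * hc h w + hc h (pcomp (stp j) w).
Proof.
apply: (@heq_lin _ D F^o (fun h => hc (hM (hb (stp j)) h) w)
  (fun h => if (len w < len (pcomp (stp j) w))%N then hc h (pcomp (stp j) w)
  else (v - v^-1) * hc h w + hc h (pcomp (stp j) w))) => [||x].
- exact: (lin_map_comp (@hc_lin _ D w) (hM_linr _)).
- by move=> c y z; case: ifP => _; rewrite !hcD !hcZ /GRing.scale /=; ring.
rewrite lmul_hb.
have e1 : (pcomp (stp j) x == w) = (x == pcomp (stp j) w).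
  by apply/eqP/eqP => [<-|->]; rewrite pcompsK.
have al := len_stp_left_alt w j; have ax := len_stp_left_alt x j.
case: (altP (x =P w)) => [->|xw].
  have n : (w == pcomp (stp j) w) = false by apply/eqP => e; rewrite -e in al; lia.
  by case: ifP => _; rewrite ?hcD ?hcZ !hc_bas eq_sym n ?eqxx.
by case: ifP => _; case: ifP => _; rewrite ?hcD ?hcZ !hc_bas e1 ?(negPf xw) ?mulr0 ?add0r.
Qed.

(** In the normalized basis [y] has the coefficients of the sign character, on which every generator
    acts by [- v^-1]. *)
Lemma y_coefE n : ((- v ^+ 2)^-1) ^+ n * v ^+ n = (- v^-1) ^+ n.
Proof.
rewrite -exprMn; congr (_ ^+ n).
by field; rewrite v0 oppr_eq0 expf_eq0 /= v0.
Qed.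

Lemma hc_y L w : hc (y_of L) w = if w \in young_of L then (- v^-1) ^+ len w else 0.
Proof.
rewrite /y_of hc_sum; case: ifP => wY.
  rewrite (bigD1 w) //= !hcZ hc_bas eqxx mulr1 y_coefE big1 ?addr0 //.
  by move=> x /andP[_ xw]; rewrite !hcZ hc_bas (negPf xw) !mulr0.
rewrite big1 // => x xY; rewrite !hcZ hc_bas; case: eqP => [e|_]; rewrite ?mulr0 //.
by rewrite e wY in xY.
Qed.

Lemma star_y L : star (y_of L) = y_of L.
Proof.
apply: (@hc_ext _ D) => w; rewrite hc_star !hc_y len_inv.
suff -> : ((w^-1)%g \in young_of L) = (w \in young_of L) by [].
by apply/young_ofP/young_ofP => e p; [rewrite -(e (w p)) permK|rewrite -(e ((w^-1)%g p)) permKV].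
Qed.

Lemma aT_y L j u : L (lo j) = L (hi j) ->
  aH (aT u j) (y_of L) = - v^-1 *: aH u (y_of L).
Proof.
move=> e; rewrite aT_aH -aHM -(lin_mapZ (aH_linr u)); congr aH.
apply: (@hc_ext _ D) => w; rewrite hc_lmul hcZ !hc_y young_left //.
have := len_stp_left_alt w j; case: ifP => c1; case: ifP => c2 al; rewrite ?mulr0 ?addr0 //.
  by case: al => al; [rewrite al exprS|lia].
case: al => al; first by lia.
by rewrite al exprS; field.
Qed.

Lemma vvi_neq0 : v + v^-1 != 0.
Proof.
apply/eqP => e; have := @hreal _ D [:: v; 1]; rewrite !big_cons big_nil addr0.
have e2 : v ^+ 2 + 1 ^+ 2 = 0 by rewrite -[RHS](mulr0 v) -e; field.
move/(_ e2 1); rewrite !inE eqxx orbT => /(_ isT) /eqP.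
by rewrite oner_eq0.
Qed.

(** The generator [j] multiplies the word by [v] because its letters agree, and multiplies [y] by
    [- v^-1] because [j] lies in a block; these scalars differ. *)
Lemma y_kill L i j : L (lo j) = L (hi j) -> i (lo j) = i (hi j) -> aH (vb i) (y_of L) = 0.
Proof.
move=> eL ei; have := @aT_y L j (vb i) eL; rewrite aT_bas ei ltxx eqxx.
rewrite (lin_mapZ (aH_linl _)) => /eqP; rewrite -subr_eq0 -scalerBl opprK scaler_eq0.
by rewrite (negPf vvi_neq0) => /eqP.
Qed.

Lemma y_swap L i j : L (lo j) = L (hi j) -> i (hi j) < i (lo j) ->
  aH (vb i) (y_of L) = - v^-1 *: aH (vb (wperm i (stp j))) (y_of L).
Proof.
move=> eL ei; rewrite -(@aT_y L j) // aT_bas !wpermE stp_lo stp_hi ei.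
by rewrite wpermKs.
Qed.

(** Bubble sort inside the blocks of [L]: removing a descent costs the nonzero factor [- v^-1], and
    two equal neighbours kill the vector. Positivity makes the absolute values in the measure follow
    the order of the letters. *)
Lemma y_sort L i : wincr L -> posw i ->
  (aH (vb i) (y_of L) = 0 /\ ~ inj_on L i) \/
  exists w c, [/\ w \in young_of L, c != 0, strict_on L (wperm i w) &
    aH (vb i) (y_of L) = c *: aH (vb (wperm i w)) (y_of L)].
Proof.
move=> Linc; pose g (p : 'I_r) := (r - p)%N.
have Y1 : 1%g \in young_of L by apply/young_ofP => p; rewrite perm1.
move: {2}(wt g i) (leqnn (wt g i)) => n; elim: n i => [|n IH] i le pos.
  right; exists 1%g, 1; rewrite oner_eq0 wperm1 scale1r; split=> //.
  (* Every term [(r - p) * |i p|] is positive, so measure 0 means that there is no position [p]. *)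
  move=> p; move: le; rewrite leqn0 /wt sum_nat_eq0 => /forallP /(_ p) /=.
  by rewrite /g muln_eq0; have := ltn_ord p; have := pos p; lia.
have [[j [eL lej]]|none] := classic (exists j, L (lo j) = L (hi j) /\ i (hi j) <= i (lo j)); last first.
  right; exists 1%g, 1; rewrite oner_eq0 wperm1 scale1r; split=> //.
  apply: strict_adj => // j eL; rewrite ltNge; apply/negP => lej.
  by apply: none; exists j.
move: lej; rewrite le_eqVlt => /orP[/eqP ei|lt].
  left; split; first exact: y_kill (esym ei).
  by move=> inj; have /eqP := inj _ _ eL (esym ei); rewrite lo_neq_hi.
have lw : (wt g (wperm i (stp j)) <= n)%N.
  have : (wt g (wperm i (stp j)) < wt g i)%N.
    apply: wt_swap; apply/orP; right; rewrite /g /=; have := pos (lo j); have := pos (hi j).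
    by have := ltn_ord j; lia.
  by lia.
have [[e ninj]|[w [c [wY c0 st e]]]] := IH _ lw (posw_perm _ pos).
  left; rewrite (y_swap eL lt) e scaler0; split=> // inj; apply: ninj => p q Lpq.
  rewrite !wpermE => /inj e'; have Ls x : L (stp j x) = L x.
    by rewrite -wpermE wperm_eqs.
  by have := e' ltac:(by rewrite !Ls); apply: perm_inj.
right; exists (pcomp (stp j) w), (- v^-1 * c); rewrite -wpermM; split=> //.
- by rewrite young_left.
- by rewrite mulf_neq0 // oppr_eq0 invr_eq0.
by rewrite (y_swap eL lt) e scalerA.
Qed.

Lemma y_notinj L i : wincr L -> posw i -> ~ inj_on L i -> aH (vb i) (y_of L) = 0.
Proof.
move=> Linc pos ninj; have [[]|[w [c [/young_ofP wY _ st _]]]] := y_sort Linc pos; first by [].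
case: ninj => p q eL ei; apply: (@perm_inj _ (w^-1)%g); apply: (strict_inj st).
  by rewrite -wY permKV eL -[in LHS](permKV w q) wY.
by rewrite !wpermE !permKV.
Qed.

Lemma strict_act L i w : wincr L -> strict_on L i -> w \in young_of L ->
  aH (vb i) (hb w) = vb (wperm i w).
Proof.
move=> Linc st; rewrite -(wprod_redword w); have := reduced_redword w.
elim/last_ind: (redword w) => [|js j IH]; first by rewrite /= aH1 wperm1.
rewrite reduced_rconsE wprod_rcons => /andP[red asc] wY.
have eL : L (lo j) = L (hi j).
  have /young_ofP wY' := wY.
  have := wY' (lo j); have := wY' (hi j); rewrite !pcompE stp_lo stp_hi => h1 h2.
  have := Linc _ _ (ltnW asc); have := wincr_lohi j Linc; rewrite h1 h2 => a b.
  by apply/eqP; rewrite eq_le a b.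
have wY' : wprod js \in young_of L by rewrite -(young_right _ eL).
rewrite aH_rcons // IH // aT_bas wpermM ifT // !wpermE; apply: st => //.
by have /young_ofP h := wY'; rewrite !h.
Qed.

Lemma strict_y L i : wincr L -> strict_on L i ->
  aH (vb i) (y_of L) = \sum_(w in young_of L) (- v^-1) ^+ len w *: vb (wperm i w).
Proof.
move=> Linc st; rewrite /y_of (lin_map_sum (aH_linr _)); apply: eq_bigr => w wY.
by rewrite !(lin_mapZ (aH_linr _)) scalerA y_coefE (strict_act Linc).
Qed.

(** A word strictly increasing on each block has distinct letters there, so only the identity of the
    Young subgroup returns it. *)
Lemma strict_y_coef L i : wincr L -> strict_on L i -> vc (aH (vb i) (y_of L)) i = 1.
Proof.
move=> Linc st; rewrite strict_y // vc_sum (bigD1 1%g) /=; last first.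
  by apply/young_ofP => p; rewrite perm1.
rewrite vcZ len1 expr0 wperm1 vc_bas eqxx mulr1 big1 ?addr0 // => w /andP[/young_ofP wY w1].
rewrite vcZ vb_vc1 ?mulr0 //; apply: contra_neq w1 => e.
apply/permP => p; rewrite perm1; apply: (strict_inj st) => //.
by rewrite -{2}e wpermE.
Qed.

End Young.

(** * Yamanouchi words and partitions *)

Section Yamanouchi.
Variable r : nat.
Implicit Types (i k t L : word r) (w : sym r) (j : 'I_r.-1).

Definition cnt (n c : nat) t : nat :=
  (\sum_(q < r) ((q < n)%N && (t q == c%:Z) : nat))%N.

Lemma cnt0 c t : cnt 0 c t = 0%N.
Proof. by rewrite /cnt big1. Qed.

Lemma cntS c t (p : 'I_r) : cnt p.+1 c t = (cnt p c t + (t p == c%:Z))%N.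
Proof.
rewrite /cnt (bigD1 p) //= [in RHS](bigD1 p) //= ltnSn ltnn /= add0n addnC.
congr (_ + _)%N; apply: eq_bigr => q qp; rewrite ltnS leq_eqVlt.
by rewrite val_eqE (negPf qp).
Qed.

Lemma cntS_le n c t : (cnt n c t <= cnt n.+1 c t)%N.
Proof.
apply: leq_sum => q _; case: (ltnP q n) => //= h.
by rewrite ltnS (ltnW h).
Qed.

Lemma cnt_mono n m c t : (n <= m)%N -> (cnt n c t <= cnt m c t)%N.
Proof.
by move=> /subnKC <-; elim: (m - n)%N => [|d IH]; rewrite ?addn0 // addnS (leq_trans IH) ?cntS_le.
Qed.

Lemma cnt_ge n c t : (r <= n)%N -> cnt n c t = cnt r c t.
Proof.
by move=> rn; apply: eq_bigr => q _; rewrite ltn_ord (leq_trans (ltn_ord q) rn).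
Qed.

Lemma cnt_wperm c t w : cnt r c (wperm t w) = cnt r c t.
Proof.
rewrite /cnt [RHS](reindex_inj (@perm_inj _ w)) /=.
by apply: eq_bigr => q _; rewrite wpermE !ltn_ord.
Qed.

Lemma cnt_swap n c t j : n != j.+1 -> cnt n c (wperm t (stp j)) = cnt n c t.
Proof.
move=> nj; rewrite /cnt [RHS](reindex_inj (@perm_inj _ (stp j))) /=.
apply: eq_bigr => q _; rewrite wpermE val_stp /swapn; congr (nat_of_bool (_ && _)).
by repeat case_if; lia.
Qed.

Lemma cnt_swap_mid c t j : cnt j.+1 c (wperm t (stp j)) = (cnt j c t + (t (hi j) == c%:Z))%N.
Proof. by rewrite -[j.+1]/(lo j).+1 cntS cnt_swap ?wpermE ?stp_lo //=; lia. Qed.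

Lemma cnt_lo c t j : cnt j.+1 c t = (cnt j c t + (t (lo j) == c%:Z))%N.
Proof. exact: cntS c t (lo j). Qed.

Lemma cnt_hi c t j : cnt j.+2 c t = (cnt j.+1 c t + (t (hi j) == c%:Z))%N.
Proof. exact: cntS c t (hi j). Qed.

Definition yam t := posw t /\ forall n c, (0 < c)%N -> (cnt n c.+1 t <= cnt n c t)%N.

(* The tight words are the column reading words [1 2 ... c_1 1 2 ... c_2 ...], characterized by the fact
   that no ascent can be swapped; [col] numbers their columns. *)
Definition tight t := yam t /\ forall j, t (lo j) < t (hi j) -> ~ yam (wperm t (stp j)).

Lemma yam_mono t n b a : yam t -> (0 < b)%N -> (b <= a)%N -> (cnt n a t <= cnt n b t)%N.
Proof.
move=> [_ Y] b0 /subnKC <-; elim: (a - b)%N => [|d IH]; rewrite ?addn0 // addnS.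
by apply: leq_trans IH; apply: Y; lia.
Qed.

(** Ascents are swapped as long as the word stays Yamanouchi; each swap moves a larger letter to the
    left and lowers the measure. *)
Lemma climb t : yam t -> exists w, tight (wperm t w).
Proof.
pose g (p : 'I_r) := (p : nat).
move: {2}(wt g t).+1 (ltnSn (wt g t)) => n; elim: n t => [//|n IH] t le Y.
have [[j [lt Yj]]|none] := classic (exists j, t (lo j) < t (hi j) /\ yam (wperm t (stp j))); last first.
  by exists 1%g; rewrite wperm1; split=> // j lt Yj; apply: none; exists j.
have lw : (wt g (wperm t (stp j)) < wt g t)%N.
  apply: wt_swap; rewrite /g lo_lt_hi; apply/orP; left.
  by have := Y.1 (lo j); have := Y.1 (hi j); lia.
have [|w tw] := IH (wperm t (stp j)) _ Yj; first by lia.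
by exists (pcomp (stp j) w); rewrite -wpermM.
Qed.

(** A swap at [j] changes only the counts in the prefix of length [j+1], so the lattice condition
    must fail there. As it holds for [t] in the neighbouring prefixes, it is sharp before [j], and
    the letters are consecutive. *)
Lemma tight_asc t j : tight t -> t (lo j) < t (hi j) ->
  t (hi j) = t (lo j) + 1 /\ cnt j `|t (hi j)| t = cnt j `|t (lo j)| t.
Proof.
move=> [Y T] lt; have := T j lt => nY.
have [n [c [c0 lc]]] : exists n c, (0 < c)%N /\
    (cnt n c (wperm t (stp j)) < cnt n c.+1 (wperm t (stp j)))%N.
  apply: NNPP => no; apply: nY; split; first by apply: posw_perm Y.1.
  move=> n c c0; rewrite leqNgt; apply/negP => lc.
  by apply: no; exists n, c.
have nj : n = j.+1.
  apply/eqP; apply: contraLR lc => nj; rewrite !cnt_swap // -leqNgt.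
  exact: Y.2.
move: lc; rewrite nj !cnt_swap_mid => lc.
have := Y.2 j c c0; have := Y.2 j.+2 c c0; rewrite !cnt_hi !cnt_lo.
have pl := Y.1 (lo j); have ph := Y.1 (hi j).
move: lc; case: eqP => e1; case: eqP => e2; try lia.
case: eqP => e3; case: eqP => e4; try lia.
move=> h1 h2 h3; have -> : `|t (lo j)|%N = c by lia.
have -> : `|t (hi j)|%N = c.+1 by lia.
by split; lia.
Qed.

Definition col t (p : 'I_r) : nat := cnt p `|t p| t.

(** Shifted by one because it is to agree with [lword r (conjp mu)], whose letters start at 1. *)
Definition Lcol t : word r := [ffun p => (col t p).+1%:Z].

Lemma absz_eq t (p : 'I_r) c : posw t -> (t p == c%:Z) = (`|t p|%N == c).
Proof. by move=> /(_ p); lia. Qed.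

Lemma col_adj t j : tight t ->
  (col t (lo j) <= col t (hi j))%N /\
  (col t (lo j) = col t (hi j) -> t (lo j) < t (hi j)).
Proof.
move=> T; have [Y _] := T; have P := Y.1; rewrite /col cnt_lo absz_eq //=.
have pl := P (lo j); have ph := P (hi j).
case: (ltgtP (t (lo j)) (t (hi j))) => h.
- by have [e ec] := tight_asc T h; rewrite ec; split; lia.
- have := @yam_mono t j.+1 `|t (hi j)| `|t (lo j)| Y ltac:(lia) ltac:(lia).
  by rewrite !cnt_lo !absz_eq // eqxx; lia.
- by rewrite h eqxx; lia.
Qed.

Lemma wincr_adj L : (forall j, L (lo j) <= L (hi j)) -> wincr L.
Proof.
move=> adj p q; move e: (q - p)%N => n; elim: n p q e => [|n IH] p q e pq.
  by have -> : p = q by apply: val_inj => /=; lia.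
have jP : (p < r.-1)%N by have := ltn_ord q; lia.
have plo : p = lo (Ordinal jP) by apply: val_inj.
rewrite plo; apply: le_trans (adj _) _; apply: IH => /=; lia.
Qed.

Lemma Lcol_wincr t : tight t -> wincr (Lcol t).
Proof.
move=> T; apply: wincr_adj => j; rewrite !ffunE.
by have [h _] := col_adj j T; lia.
Qed.

Lemma Lcol_strict t : tight t -> strict_on (Lcol t) t.
Proof.
move=> T; apply: strict_adj; first exact: Lcol_wincr.
move=> j; rewrite !ffunE => e; have [_] := col_adj j T; apply.
by lia.
Qed.

(** Prefix counts grow by steps of at most one, so [q] is the occurrence of [c] that has exactly [d]
    occurrences before it. *)
Lemma cnt_ivt n c d t : (d < cnt n c t)%N -> (n <= r)%N ->
  exists q : 'I_r, [/\ (q < n)%N, t q = c%:Z & cnt q c t = d].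
Proof.
elim: n => [|n IH]; first by rewrite cnt0.
move=> lt nr; have := cntS c t (Ordinal nr) => /= e.
case: (ltnP d (cnt n c t)) => h.
  have [|q [q1 q2 q3]] := IH h; first by lia.
  by exists q; split=> //; lia.
exists (Ordinal nr); split=> //=; move: lt; rewrite e.
  by case: eqP => //; lia.
by case: eqP => //; lia.
Qed.

(** By the lattice condition a letter [c+1] with [c >= 1] is preceded in its column by [c], so
    strict increase along columns pushes the lower bound up by one at each row. The first row holds
    by positivity. *)
Lemma Lcol_min t i : tight t -> posw i -> strict_on (Lcol t) i -> forall p, t p <= i p.
Proof.
move=> T Pi st p; case: p; elim/ltn_ind => n IH nr.
set p := Ordinal nr; have [Y _] := T; have P := Y.1.
case: (ltnP 1 `|t p|) => c1; last by have := Pi p; have := P p; lia.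
have [c ec] : exists c, `|t p|%N = c.+2 by exists (`|t p| - 2)%N; lia.
have cY := Y.2 p.+1 c.+1 isT; move: cY.
rewrite !cntS !absz_eq // ec eqxx.
have -> : (c.+2 == c.+1) = false by lia.
rewrite addn0 addn1 => cY.
have [|q [q1 q2 q3]] := @cnt_ivt p c.+1 (col t p) t _ (ltnW (ltn_ord p)).
  by rewrite /col ec.
have eL : Lcol t q = Lcol t p.
  by rewrite !ffunE; congr (_.+1%:Z); rewrite -q3 /col q2.
have := st q p q1 eL; have := IH q q1 (ltn_ord q).
have -> : Ordinal (ltn_ord q) = q by apply: val_inj.
by rewrite q2; have := P p; lia.
Qed.

(** Each box of the diagram, in row [c] and column [d], is met at most once while reading the
    word. *)
Lemma count_col n c d t : (n <= r)%N ->
  (\sum_(q < r) ((q < n)%N && ((t q == c%:Z) && (cnt q c t == d)) : nat))%N = (d < cnt n c t)%N.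
Proof.
elim: n => [|n IH] nr; first by rewrite cnt0 big1.
rewrite (bigD1 (Ordinal nr)) //= ltnSn /=.
have e := cntS c t (Ordinal nr); move: e => /= e.
have -> : (\sum_(q < r | q != Ordinal nr) ((q < n.+1)%N && ((t q == c%:Z) && (cnt q c t == d)) : nat))%N
   = (d < cnt n c t)%N.
  rewrite -IH; last by lia.
  rewrite [RHS](bigD1 (Ordinal nr)) //= ltnn add0n; apply: eq_bigr => q qn.
  by rewrite ltnS leq_eqVlt -[(q == n :> nat)]/(q == Ordinal nr) (negPf qn).
rewrite e; case: (t _ == _) => /=; case: (ltngtP d (cnt n c t)); lia.
Qed.

Lemma same_counts i k : posw i -> posw k ->
  (forall c, (0 < c)%N -> cnt r c i = cnt r c k) -> exists w, k = wperm i w.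
Proof.
move=> Pi Pk e.
pose s := [tuple i p | p < r]; pose s' := [tuple k p | p < r].
have cE (x : word r) (c : nat) : count_mem c%:Z [tuple x p | p < r] = cnt r c x.
  rewrite -sum1_count big_map big_enum_cond /= /cnt big_mkcond /=.
  by apply: eq_bigr => q _; rewrite ltn_ord /=; case: (_ == _).
have pos_count (x : word r) (c : int) : posw x -> (c <= 0) -> count_mem c [tuple x p | p < r] = 0%N.
  move=> P c0; apply/count_memPn; apply/negP => /mapP[p _ ec].
  by have := P p; rewrite -ec; lia.
have /tuple_permP [w ew] : perm_eq s' s.
  apply/allP => c _ /=; apply/eqP; case: (ltP 0 c) => c0; last by rewrite !pos_count.
  have -> : c = `|c|%N%:Z by lia.
  by rewrite !cE e //; lia.
exists w; apply/ffunP => p; rewrite wpermE.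
have := congr1 (fun x : seq int => nth 0 x p) ew.
by rewrite -!tnth_nth !tnth_mktuple.
Qed.

End Yamanouchi.

(** * Partitions as contents of Yamanouchi words *)

Section Partitions.
Variable r : nat.
Implicit Types (mu lam : seq nat).

Definition lseq lam : seq nat :=
  flatten [seq nseq (nth 0%N lam k) k.+1 | k <- iota 0 (size lam)].

Lemma lwordE lam (p : 'I_r) : lword r lam p = (nth 0%N (lseq lam) p)%:Z.
Proof. by rewrite ffunE. Qed.

Lemma count_lseq lam c : count_mem c.+1 (lseq lam) = nth 0%N lam c.
Proof.
rewrite /lseq count_flatten -map_comp sumnE big_map.
rewrite (eq_bigr (fun k => if k == c then nth 0%N lam c else 0)%N); last first.
  move=> k _; rewrite /= count_nseq /= eqSS.
  by case: eqP => [->|_]; rewrite ?mul1n ?mul0n.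
rewrite -big_mkcond big_const_seq iter_addn_0.
have -> : count (fun k => k == c) (iota 0 (size lam)) = (c < size lam)%N.
  by rewrite count_uniq_mem ?iota_uniq // mem_iota add0n leq0n.
by case: ltnP => h; rewrite ?muln1 // muln0 nth_default.
Qed.

Lemma mem_lseq0 lam c : c \in lseq lam -> (0 < c)%N.
Proof. by move=> /flatten_mapP[k _]; rewrite mem_nseq => /andP[_ /eqP ->]. Qed.

Lemma size_lseq lam : size (lseq lam) = sumn lam.
Proof.
rewrite /lseq size_flatten /shape -map_comp.
congr sumn; apply: (@eq_from_nth _ 0%N); rewrite size_map size_iota // => k kl.
by rewrite (nth_map 0%N) ?size_iota // nth_iota //= size_nseq.
Qed.

Lemma sorted_lseq lam : sorted leq (lseq lam).
Proof.
suff H n m : sorted leq (flatten [seq nseq (nth 0%N lam k) k.+1 | k <- iota m n]) /\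
   all (leq m.+1) (flatten [seq nseq (nth 0%N lam k) k.+1 | k <- iota m n]).
  by have [] := H (size lam) 0%N.
elim: n m => [|n IH] m //=; have [s a] := IH m.+1.
have a' : all (leq m.+1) (flatten [seq nseq (nth 0%N lam k) k.+1 | k <- iota m.+1 n]).
  by apply: sub_all a => x /=; lia.
split; last by rewrite all_cat a' andbT; apply/allP => x; rewrite mem_nseq => /andP[_ /eqP ->].
elim: (nth 0%N lam m) => //= d IHd; rewrite path_sortedE; last exact: leq_trans.
rewrite IHd andbT all_cat a' andbT.
by apply/allP => x; rewrite mem_nseq => /andP[_ /eqP ->].
Qed.

(** The bound keeps every position inside [lseq lam], away from the default letter 0, which would
    break monotonicity. *)
Lemma lword_wincr lam : (r <= sumn lam)%N -> wincr (lword r lam).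
Proof.
move=> sr p q pq; rewrite !lwordE lez_nat.
apply: (sorted_leq_nth leq_trans leqnn) (sorted_lseq lam) _ _ _ _ pq;
  by rewrite inE size_lseq (leq_trans (ltn_ord _)).
Qed.

Lemma lword_pos lam : sumn lam = r -> posw (lword r lam).
Proof.
move=> sr p; rewrite lwordE ltz_nat; apply: (@mem_lseq0 lam).
by rewrite mem_nth // size_lseq sr.
Qed.

Lemma cnt_lword lam c : sumn lam = r -> cnt r c.+1 (lword r lam) = nth 0%N lam c.
Proof.
move=> sr; rewrite -count_lseq -sum1_count (big_nth 0%N) size_lseq sr big_mkord /cnt.
rewrite [RHS]big_mkcond /=; apply: eq_bigr => q _.
by rewrite ltn_ord lwordE /= eqz_nat; case: (_ == _).
Qed.

Lemma sorted_nth mu a b : sorted geq mu -> (a <= b)%N -> (nth 0%N mu b <= nth 0%N mu a)%N.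
Proof.
move=> s ab; case: (ltnP b (size mu)) => h; last by rewrite nth_default.
have gt : transitive geq by move=> x y z; rewrite /geq /= => h1 h2; apply: leq_trans h2 h1.
have := @sorted_leq_nth _ geq gt (fun x => leqnn x) 0%N mu s a b.
by rewrite !inE => /(_ _ _ ab); apply; lia.
Qed.

(** In the sorted word a prefix containing [c+1] already contains all letters [c], so the inequality
    reduces to the one between consecutive parts. *)
Lemma lword_yam mu : is_partition r mu -> yam (lword r mu).
Proof.
move=> /and3P[s _ /eqP sr]; split; first exact: lword_pos.
move=> n c c0; have Linc : wincr (lword r mu) by apply: lword_wincr; rewrite sr.
case: (posnP (cnt n c.+1 (lword r mu))) => [->//|pos].
wlog nr : n pos / (n <= r)%N.
  move=> W; case: (leqP n r) => h; first exact: W.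
  by move: pos; rewrite !(cnt_ge _ _ (ltnW h)) => pos; apply: W.
have [q [qn qc _]] := cnt_ivt pos nr.
have -> : cnt n c (lword r mu) = cnt r c (lword r mu).
  apply: eq_bigr => p _; rewrite ltn_ord /=; case: eqP => [pc|]; rewrite ?andbF ?andbT //.
  suff -> : (p < n)%N by [].
  rewrite ltnNge; apply/negP => np; have := Linc q p ltac:(lia).
  by rewrite pc qc; lia.
apply: leq_trans (cnt_mono _ _ nr) _; case: c c0 {pos qc} => // c _.
by rewrite !cnt_lword // sorted_nth.
Qed.

Lemma lword_inj mu lam w : is_partition r mu -> is_partition r lam ->
  lword r mu = wperm (lword r lam) w -> mu = lam.
Proof.
move=> /and3P[_ am /eqP sm] /and3P[_ al /eqP sl] e.
have en c : nth 0%N mu c = nth 0%N lam c.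
  by rewrite -(cnt_lword _ sm) -(cnt_lword _ sl) e cnt_wperm.
have sz (a b : seq nat) : (forall c, nth 0%N a c = nth 0%N b c) -> all (leq 1) b ->
    (size b <= size a)%N.
  move=> ee ab; rewrite leqNgt; apply/negP => h.
  by have := all_nthP 0%N ab _ h; rewrite -ee nth_default.
by apply: (@eq_from_nth _ 0%N) => //; apply/eqP; rewrite eqn_leq !sz.
Qed.

(** The parts are the multiplicities of the letters 1 to [N], the largest letter. They decrease by
    the lattice condition, and none vanishes because [N] itself occurs. *)
Lemma yam_partition (t : word r) : yam t ->
  exists mu w, is_partition r mu /\ t = wperm (lword r mu) w.
Proof.
move=> Y; have P := Y.1; pose N := (\max_(p < r) `|t p|)%N.
have leN p : (`|t p| <= N)%N by apply: leq_bigmax.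
have cpos c : (c < N)%N -> (0 < cnt r c.+1 t)%N.
  move=> cN; have r0 : (0 < #|'I_r|)%N.
    case: posnP => // /eqP; rewrite card_ord => /eqP r0; move: cN.
    by rewrite /N big1 // => p _; have := ltn_ord p; rewrite {2}r0.
  have [p eN] := @bigop.eq_bigmax 'I_r (fun p : 'I_r => `|t p|%N) r0.
  have le : (c.+1 <= `|t p|)%N by rewrite -eN.
  apply: leq_trans (yam_mono _ Y _ le) => //.
  by rewrite /cnt (bigD1 p) //= ltn_ord absz_eq // eqxx.
pose mu := [seq cnt r c.+1 t | c <- iota 0 N].
have nmu c : nth 0%N mu c = cnt r c.+1 t.
  case: (ltnP c N) => h; first by rewrite (nth_map 0%N) ?size_iota // nth_iota.
  rewrite nth_default ?size_map ?size_iota // /cnt big1 // => p _.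
  by rewrite absz_eq //; have := leN p; lia.
have sr : sumn mu = r.
  rewrite sumnE big_map.
  have -> : iota 0 N = index_iota 0 N by rewrite /index_iota subn0.
  rewrite big_mkord exchange_big /= -[RHS]card_ord -sum1_card.
  apply: eq_bigr => p _; have := P p; have := leN p => h1 h2.
  have hp : (`|t p|.-1 < N)%N by lia.
  rewrite (bigD1 (Ordinal hp)) //= ltn_ord absz_eq // big1 => [|c cp].
    by rewrite addn0; have -> : (`|t p|%N == `|t p|.-1.+1) by lia.
  rewrite absz_eq //; case: eqP => // e; case/negP: cp; rewrite -val_eqE /=.
  by rewrite e.
have pm : is_partition r mu.
  apply/and3P; split; last by apply/eqP.
    apply/(sortedP 0%N) => c _; rewrite !nmu; exact: Y.2.
  by apply/allP => x /mapP[c]; rewrite mem_iota => /andP[_ cN] ->; apply: cpos.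
have [w ew] := @same_counts r (lword r mu) t (lword_pos sr) P ltac:(
  by case=> // c _; rewrite cnt_lword // nmu).
by exists mu, w.
Qed.

Lemma nth_conjp mu d : sorted geq mu -> nth 0%N (conjp mu) d = count (fun m => d < m)%N mu.
Proof.
move=> s; rewrite /conjp; case: (ltnP d (head 0%N mu)) => h.
  by rewrite (nth_map 0%N) ?size_iota // nth_iota.
rewrite nth_default ?size_map ?size_iota //; apply/esym/eqP.
rewrite -leqn0 leqNgt -has_count; apply/negP => /(has_nthP 0%N)[k ks].
by have := sorted_nth s (leq0n k); rewrite nth0; lia.
Qed.

(** Both sides are increasing sequences, so it suffices to compare multiplicities. *)
Lemma Lcol_conjp mu (t : word r) w : is_partition r mu -> tight t ->
  t = wperm (lword r mu) w -> lword r (conjp mu) = Lcol t.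
Proof.
move=> /and3P[s am /eqP sr] T et; have [Y _] := T; have P := Y.1.
have ct c : cnt r c.+1 t = nth 0%N mu c by rewrite et cnt_wperm cnt_lword.
have e : lseq (conjp mu) = [seq (col t p).+1 | p <- enum 'I_r].
  apply: (sorted_eq leq_trans anti_leq); first exact: sorted_lseq.
    apply: (homo_sorted (e := fun p q : 'I_r => (p <= q)%N)) => [p q pq|].
      by have := Lcol_wincr T pq; rewrite !ffunE; lia.
    by have := iota_sorted 0 r; rewrite -val_enum_ord sorted_map.
  apply/allP => -[|d] _ /=.
    apply/eqP; rewrite (count_memPn _) ?(count_memPn _) //; first by apply/negP => /mapP[].
    by apply/negP => /mem_lseq0.
  apply/eqP; rewrite count_lseq nth_conjp // -!sum1_count big_map big_enum_cond /=.
  rewrite (big_nth 0%N) big_mkord big_mkcond [RHS]big_mkcond /=.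
  (* Double counting of the boxes in column [d]: by rows, row [c] has one when [d < mu_c]; by
     positions, each position lies in exactly one row. *)
  transitivity (\sum_(c < size mu) \sum_(p < r) ((p < r)%N && ((t p == c.+1%:Z) && (cnt p c.+1 t == d)) : nat))%N.
    by apply: eq_bigr => c _; rewrite count_col // ct; case: ltnP.
  rewrite exchange_big /=; apply: eq_bigr => p _; rewrite eqSS.
  have lp : (`|t p|.-1 < size mu)%N.
    rewrite ltnNge; apply/negP => h; have := ct (`|t p|.-1); rewrite nth_default //.
    rewrite /cnt (bigD1 p) //= ltn_ord absz_eq //.
    by have -> : (`|t p|%N == `|t p|.-1.+1) by have := P p; lia.
  have pe : `|t p|.-1.+1 = `|t p|%N by have := P p; lia.
  rewrite (bigD1 (Ordinal lp)) //= ltn_ord absz_eq // pe eqxx /= big1 => [|c cp].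
    by rewrite addn0 /col; case: (_ == _).
  rewrite absz_eq //; case: eqP => // e; case/negP: cp; rewrite -val_eqE /=.
  by rewrite e.
apply/ffunP => p; rewrite lwordE e ffunE (nth_map p) ?size_enum_ord //.
by rewrite nth_ord_enum.
Qed.

End Partitions.

(** * Raising operators *)

Section RaisingWords.
Variable r : nat.
Implicit Types (w t i : word r) (p q : 'I_r) (j : 'I_r.-1).

Definition upd w p (c : int) : word r := [ffun q => if q == p then c else w q].

Lemma updE w p c q : upd w p c q = if q == p then c else w q.
Proof. by rewrite ffunE. Qed.
Lemma upd_same w p c : upd w p c p = c. Proof. by rewrite updE eqxx. Qed.
Lemma upd_out w p c q : q != p -> upd w p c q = w q.
Proof. by rewrite updE => /negPf ->. Qed.
Lemma upd_id w p : upd w p (w p) = w.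
Proof. by apply/ffunP => q; rewrite updE; case: eqP => [->|]. Qed.
Lemma upd_upd w p c d : upd (upd w p c) p d = upd w p d.
Proof. by apply/ffunP => q; rewrite !updE; case: eqP. Qed.
Lemma updC w p q c d : p != q -> upd (upd w p c) q d = upd (upd w q d) p c.
Proof.
move=> pq; apply/ffunP => x; rewrite !updE.
by case: (x =P q) => [->|//]; rewrite eq_sym (negPf pq).
Qed.
Lemma wperm_upd w x p c : wperm (upd w p c) x = upd (wperm w x) ((x^-1)%g p) c.
Proof.
apply/ffunP => q; rewrite !(wpermE, updE); congr (if _ then _ else _).
by apply/eqP/eqP => [<-|->]; rewrite ?permK ?permKV.
Qed.

(** When [n = r] this is the exponent of the coproduct, the number of letters [k] minus that of
    letters [k+1] to the right of [p], raised by the number of letters [k+1] away from [p]. The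
    shift is constant on words of one content and makes the exponent a natural number. *)
Definition egn (n k : nat) w p : nat :=
  (\sum_(q < r) ((q < p)%N && (w q == k.+1%:Z)) +
   \sum_(q < r) [&& (p < q)%N, (q < n)%N & w q == k%:Z])%N.

Lemma egn_upd n k w p c : egn n k (upd w p c) p = egn n k w p.
Proof.
rewrite /egn; congr (_ + _)%N; apply: eq_bigr => q _; rewrite updE;
  by case: (q =P p) => [->|//]; rewrite ltnn.
Qed.

End RaisingWords.

Section RaisingFunctions.
Variables (r : nat) (F : fieldType) (v : F) (k : nat).
Hypothesis vn0 : v != 0.
Local Notation K := (k.+1).
Implicit Types (w t : word r) (p q : 'I_r) (j : 'I_r.-1) (f g : word r -> F).

Definition En (n : nat) f w : F :=
  \sum_(p < r) if (p < n)%N && (w p == k%:Z) then v ^+ egn n k w p * f (upd w p K%:Z) else 0.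

(* The action of the quantum group generator on coefficients; [En n] only acts on the first [n] positions. *)
Definition Ef f w : F := En r f w.

Lemma En_ext n f g : f =1 g -> En n f =1 En n g.
Proof. by move=> e w; apply: eq_bigr => p _; rewrite e. Qed.

Lemma En_lin n (a : F) f g w : En n (fun x => a * f x + g x) w = a * En n f w + En n g w.
Proof.
rewrite /En mulr_sumr -big_split /=; apply: eq_bigr => p _.
by case: ifP => _; ring.
Qed.

Lemma En_scale n (a : F) f w : En n (fun x => a * f x) w = a * En n f w.
Proof. by rewrite /En mulr_sumr; apply: eq_bigr => p _; case: ifP => _; ring. Qed.

Lemma EnS (P : 'I_r) f w : En P.+1 f w =
  (if w P == k%:Z then v else 1) * En P f w +
  (if w P == k%:Z then v ^+ cnt P K w * f (upd w P K%:Z) else 0).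
Proof.
rewrite /En (bigD1 P) //= [in RHS](bigD1 P) //= ltnSn ltnn /= add0r addrC; congr (_ + _).
  rewrite mulr_sumr; apply: eq_bigr => p pP.
  rewrite ltnS leq_eqVlt val_eqE (negPf pP) /=; case: ifP => [/andP[pn _]|_]; last by rewrite mulr0.
  rewrite mulrA; congr (_ * _); have -> : egn P.+1 k w p = ((w P == k%:Z) + egn P k w p)%N.
    rewrite /egn addnCA; congr (_ + _)%N.
    rewrite (bigD1 P) //= [in RHS](bigD1 P) //= ltnSn ltnn pn /= add0n; congr (_ + _)%N.
    apply: eq_bigr => q qP.
    by have -> : (q < P.+1)%N = (q < P)%N by move: qP; rewrite -val_eqE /=; lia.
  by case: (w P == _); rewrite ?exprS ?mul1r.
case: ifP => // _; congr (_ ^+ _ * _); rewrite /egn /cnt [X in (_ + X)%N]big1 ?addn0 // => q _.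
by case: (ltnP P q) => //= h; rewrite ltnS leqNgt h.
Qed.

Lemma En_upd (P : 'I_r) f (c : int) w : En P f (upd w P c) = En P (fun x => f (upd x P c)) w.
Proof.
apply: eq_bigr => p _; case: (ltnP p P) => //= pP.
have pn : p != P by apply: contraTneq pP => ->; rewrite ltnn.
rewrite upd_out //; case: ifP => // _; rewrite updC 1?eq_sym //; congr (_ ^+ _ * _).
rewrite /egn; congr (_ + _)%N; apply: eq_bigr => q _; rewrite updE; case: (q =P P) => // ->.
  by rewrite ltnNge (ltnW pP).
by rewrite ltnn !andbF.
Qed.

Definition Dn (n : nat) f w : F := v ^+ cnt n K w * f w.

Lemma En_Dn n f w : En n (Dn n f) w = v * Dn n (En n f) w.
Proof.
rewrite /Dn /En !mulr_sumr; apply: eq_bigr => p _; case: ifP => [/andP[pn /eqP wp]|_]; last by rewrite !mulr0.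
have -> : cnt n K (upd w p K%:Z) = (cnt n K w).+1.
  rewrite /cnt (bigD1 p) //= [in RHS](bigD1 p) //= upd_same pn wp eqxx /=.
  have -> : (k%:Z == K%:Z) = false by lia.
  rewrite add0n add1n; congr _.+1; apply: eq_bigr => q qp; by rewrite upd_out.
by rewrite exprS; ring.
Qed.

(** A quantum integer in [v^2], written as a sum of squares so that formal reality shows it to be
    nonzero for positive [n]. *)
Definition Cn (n : nat) : F := \sum_(i < n) (v ^+ i) ^+ 2.

Lemma CnS n : Cn n.+1 = v ^+ 2 * Cn n + 1.
Proof.
rewrite /Cn big_ord_recl expr0 expr1n addrC; congr (_ + _).
by rewrite mulr_sumr; apply: eq_bigr => i _; rewrite lift0 -!exprM -exprD; congr (_ ^+ _); lia.
Qed.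

Lemma iter_En_other (P : 'I_r) f (c : int) m w : c != k%:Z ->
  iter m (En P.+1) f (upd w P c) = iter m (En P) (fun x => f (upd x P c)) w.
Proof.
move=> ck; elim: m w => [//|m IH] w; rewrite [LHS]/= EnS upd_same (negPf ck) mul1r addr0.
by rewrite En_upd; apply: En_ext => x; apply: IH.
Qed.

(** The last letter [k] is raised at most once in [m] applications. Summing over the moment when
    this happens, with the commutation rule [En_Dn], produces the quantum integer. *)
Lemma iter_En_low (P : 'I_r) f m w :
  iter m (En P.+1) f (upd w P k%:Z) =
  v ^+ m * iter m (En P) (fun x => f (upd x P k%:Z)) w +
  Cn m * Dn P (iter m.-1 (En P) (fun x => f (upd x P K%:Z))) w.
Proof.
have Kk : K%:Z != k%:Z by lia.
elim: m w => [|m IH] w; first by rewrite /= expr0 mul1r /Cn big_ord0 mul0r addr0.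
rewrite [LHS]/= EnS upd_same eqxx En_upd upd_upd iter_En_other //.
have -> : cnt P K (upd w P k%:Z) = cnt P K w.
  by apply: eq_bigr => q _; rewrite updE; case: (q =P P) => // ->; rewrite ltnn.
rewrite (En_ext _ IH) En_lin En_scale En_Dn CnS /=.
(* For [m = 0] the iterates differ, since [m.-1] is again 0, but then [Cn 0 = 0]. *)
have e : Cn m * Dn P (En P (iter m.-1 (En P) (fun x => f (upd x P K%:Z)))) w =
         Cn m * Dn P (iter m (En P) (fun x => f (upd x P K%:Z))) w.
  by case: m {IH} => [|m //]; rewrite /Cn big_ord0 !mul0r.
rewrite exprS -!mulrA [Cn m * (v * _)]mulrCA [v * (_ + _)]mulrDr e /Dn; ring.
Qed.

Hypothesis Cn_neq0 : forall m, Cn m.+1 != 0.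

(* The raising operator is injective on vectors of negative weight; powers are needed for the induction on the number of letters. *)
Lemma En_inj n f m : (n <= r)%N ->
  (forall w, f w != 0 -> (cnt n k w + m <= cnt n K w)%N) ->
  (forall w, iter m (En n) f w = 0) -> forall w, f w = 0.
Proof.
elim: n f m => [|n IH] f m nr cond z w.
  have [//|fw] := eqVneq (f w) 0; have := cond w fw.
  by rewrite !cnt0 add0n leqn0 => /eqP m0; have := z w; rewrite m0.
case: m cond z => [|m] cond z; first exact: z.
pose P := Ordinal nr; have nr' := ltnW nr.
have cE (c : int) (a : nat) x : cnt n.+1 a (upd x P c) = (cnt n a x + (c == a%:Z))%N.
  rewrite -[n.+1]/(P.+1) cntS upd_same; congr (_ + _)%N.
  by apply: eq_bigr => q _; rewrite updE; case: (q =P P) => // ->; rewrite ltnn.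
have Kk : (K%:Z == k%:Z) = false by lia.
have kK : (k%:Z == K%:Z) = false by lia.
have zK x : iter m.+1 (En n) (fun x => f (upd x P K%:Z)) x = 0.
  by rewrite -(@iter_En_other P) ?Kk // z.
have zk x : v ^+ m.+1 * iter m.+1 (En n) (fun x => f (upd x P k%:Z)) x +
  Cn m.+1 * Dn n (iter m (En n) (fun x => f (upd x P K%:Z))) x = 0.
  by rewrite -[RHS](z (upd x P k%:Z)) (@iter_En_low P).
(* One more application removes the second term of [zk] by [zK]. This is the hypothesis for last
   letter [k] with exponent [m+2], as the weight condition then demands: fixing a last [k] removes
   one [k] from the count. *)
have zk2 x : iter m.+2 (En n) (fun x => f (upd x P k%:Z)) x = 0.
  have e0 : En n (fun=> 0) x = 0 by apply: big1 => p _; rewrite mulr0 if_same.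
  have := En_ext n zk x; rewrite e0 En_lin En_scale En_Dn /Dn.
  rewrite [En n (iter m _ _) x]zK !mulr0 addr0 => /eqP.
  by rewrite mulf_eq0 expf_eq0 (negPf vn0) andbF => /eqP.
have fk x : f (upd x P k%:Z) = 0.
  apply: (IH (fun x => f (upd x P k%:Z)) m.+2 nr' _ zk2) => y /cond.
  by rewrite !cE eqxx kK; lia.
have zK' x : iter m (En n) (fun x => f (upd x P K%:Z)) x = 0.
  have := zk x; have -> : iter m.+1 (En n) (fun x => f (upd x P k%:Z)) x = 0.
    move: (x); elim: (m.+1) => [|d IHd] y; first exact: fk.
    have e0 : En n (fun=> 0) y = 0 by apply: big1 => p _; rewrite mulr0 if_same.
    by rewrite /= (En_ext n IHd).
  rewrite mulr0 add0r /Dn => /eqP; rewrite !mulf_eq0 (negPf (Cn_neq0 m)) expf_eq0 (negPf vn0) andbF.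
  by move/eqP.
have fK x : f (upd x P K%:Z) = 0.
  apply: (IH (fun x => f (upd x P K%:Z)) m nr' _ zK') => y /cond.
  by rewrite !cE eqxx Kk; lia.
rewrite -(upd_id w P); case: (altP (w P =P k%:Z)) => [->//|n1].
case: (altP (w P =P K%:Z)) => [->//|n2].
apply: (IH (fun x => f (upd x P (w P))) m.+1 nr') => [y /cond|y].
  by rewrite !cE (negPf n1) (negPf n2); lia.
by rewrite -(@iter_En_other P) // z.
Qed.

Lemma Tf_sum j (I : Type) (s : seq I) (Q : pred I) (G : I -> word r -> F) w :
  Tf v j (fun x => \sum_(i <- s | Q i) G i x) w = \sum_(i <- s | Q i) Tf v j (G i) w.
Proof.
rewrite /Tf; case: ifP => _ //; case: ifP => _; rewrite mulr_sumr // big_split //=.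
Qed.

(** Terms raising a letter outside the positions [j] and [j+1] match one by one; the two remaining
    terms reduce to a computation with two letters. *)
Lemma Ef_Tf j f w : Ef (Tf v j f) w = Tf v j (Ef f) w.
Proof.
pose G (p : 'I_r) (g : word r -> F) (x : word r) : F :=
  if x p == k%:Z then v ^+ egn r k x p * g (upd x p K%:Z) else 0.
have EG g x : Ef g x = \sum_p G p g x.
  by apply: eq_bigr => p _; rewrite ltn_ord.
have -> : Tf v j (Ef f) w = \sum_p Tf v j (G p f) w.
  rewrite -Tf_sum /Tf; by rewrite !EG.
rewrite EG (bigD1 (lo j)) //= (bigD1 (hi j)) ?hi_neq_lo //=.
rewrite [RHS](bigD1 (lo j)) //= [in RHS](bigD1 (hi j)) ?hi_neq_lo //= !addrA.
congr (_ + _); last first.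
  apply: eq_bigr => p /andP[pl ph].
  have sp : stp j p = p by rewrite stp_out.
  have ul c : upd w p c (lo j) = w (lo j) by rewrite upd_out // eq_sym.
  have uh c : upd w p c (hi j) = w (hi j) by rewrite upd_out // eq_sym.
  have us c : upd (wperm w (stp j)) p c = wperm (upd w p c) (stp j).
    by rewrite wperm_upd stp_inv sp.
  have eg : egn r k (wperm w (stp j)) p = egn r k w p.
    rewrite /egn; congr (_ + _)%N; rewrite [RHS](reindex_inj (@perm_inj _ (stp j))) /=;
    apply: eq_bigr => q _; rewrite wpermE val_stp /swapn; congr (nat_of_bool _);
    move: pl ph (ltn_ord q); rewrite -!val_eqE /= => pl ph qr.
      by congr (_ && _); repeat case_if; lia.
    by rewrite !andbA; congr (_ && _); have := ltn_ord (hi j); rewrite /=; repeat case_if; lia.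
  rewrite /G /Tf wpermE sp ul uh us eg.
  by case: ifP => _ //; do 2?case: ifP => _ //; ring.
(* The part of the exponent due to the other positions, common to both positions of the pair; each
   gets at most one more factor [v] from its partner. *)
pose m := (\sum_(q < r) ((q < lo j)%N && (w q == K%:Z)) +
           \sum_(q < r) ((hi j < q)%N && (w q == k%:Z)))%N.
have egl (x : word r) : (forall q, q != lo j -> q != hi j -> x q = w q) ->
    egn r k x (lo j) = (m + (x (hi j) == k%:Z))%N.
  move=> ex; rewrite /egn /m -addnA; congr (_ + _)%N.
    apply: eq_bigr => q _; case: (ltnP q (lo j)) => //= h; rewrite ex // -val_eqE /=; move: h => /=; lia.
  rewrite (bigD1 (hi j)) // [in RHS](bigD1 (hi j)) //= ltnn add0n addnC hi_subproof ltnSn /=.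
  congr (_ + _)%N; apply: eq_bigr => q qh; rewrite ltn_ord /=.
  move: (qh); rewrite -val_eqE /= => qh'.
  have -> : (j < q)%N = (j.+1 < q)%N by lia.
  case: (ltnP j.+1 q) => //= h; rewrite ex // -val_eqE /=; lia.
have egh (x : word r) : (forall q, q != lo j -> q != hi j -> x q = w q) ->
    egn r k x (hi j) = (m + (x (lo j) == K%:Z))%N.
  move=> ex; rewrite /egn /m addnAC; congr (_ + _)%N; last first.
    apply: eq_bigr => q _; rewrite ltn_ord; case: (ltnP (hi j) q) => //= h.
    by rewrite ex // -val_eqE /=; move: h => /=; lia.
  rewrite (bigD1 (lo j)) //= [in RHS](bigD1 (lo j)) //= ltnn add0n addnC ltnSn /=.
  congr (_ + _)%N; apply: eq_bigr => q ql.
  move: (ql); rewrite -val_eqE /= => ql'.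
  have -> : (q < j.+1)%N = (q < j)%N by lia.
  case: (ltnP q j) => //= h; rewrite ex // -val_eqE /=; lia.
have exs q : q != lo j -> q != hi j -> wperm w (stp j) q = w q.
  by move=> a b; rewrite wpermE stp_out.
rewrite /Tf /G !egl // !egh // !wpermE stp_lo stp_hi !upd_same.
rewrite !(@upd_out _ _ (lo j)) ?hi_neq_lo // !(@upd_out _ _ (hi j)) ?lo_neq_hi //.
have ul : upd (wperm w (stp j)) (lo j) K%:Z = wperm (upd w (hi j) K%:Z) (stp j).
  by rewrite wperm_upd stp_inv stp_hi.
have uh : upd (wperm w (stp j)) (hi j) K%:Z = wperm (upd w (lo j) K%:Z) (stp j).
  by rewrite wperm_upd stp_inv stp_lo.
rewrite ul uh.
have ekk : w (lo j) = k%:Z -> w (hi j) = k%:Z ->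
   wperm (upd w (lo j) K%:Z) (stp j) = upd w (hi j) K%:Z.
  by move=> a b; rewrite -uh wperm_eqs // a b.
have ekk' : w (lo j) = k%:Z -> w (hi j) = k%:Z ->
   wperm (upd w (hi j) K%:Z) (stp j) = upd w (lo j) K%:Z.
  by move=> a b; rewrite -ul wperm_eqs // a b.
have ekK : w (hi j) = K%:Z -> wperm (upd w (lo j) K%:Z) (stp j) = upd w (lo j) K%:Z.
  by move=> a; apply: wperm_eqs; rewrite upd_same upd_out ?hi_neq_lo.
have eKk : w (lo j) = K%:Z -> wperm (upd w (hi j) K%:Z) (stp j) = upd w (hi j) K%:Z.
  by move=> a; apply: wperm_eqs; rewrite upd_same upd_out ?lo_neq_hi.
move: ekk ekk' ekK eKk; move: (w (lo j)) (w (hi j)) => a b ekk ekk' ekK eKk.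
case: (ltgtP a b) => ab; case: (altP (a =P k%:Z)) => ak; case: (altP (b =P k%:Z)) => bk;
  case: (altP (a =P K%:Z)) => aK; case: (altP (b =P K%:Z)) => bK; try (exfalso; lia);
  case: (ltgtP K%:Z b) => h1; case: (ltgtP a K%:Z) => h2; try (exfalso; lia);
  rewrite ?addn0 ?addn1 ?(ekk ak bk) ?(ekk' ak bk) ?(ekK bK) ?(eKk aK) ?exprS; try ring; try by field.
Qed.

End RaisingFunctions.

(** * Highest weight vectors *)

Section Orders.
Variable r : nat.
Implicit Types (w t i : word r) (p q : 'I_r) (j : 'I_r.-1).

(* [keyn B r] orders the words with letters in [0, B) by comparing the last letters first. *)
Definition keyn (B n : nat) w : nat := (\sum_(q < r | (q < n)%N) `|w q| * B ^ q)%N.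

Lemma keynS B w p : keyn B p.+1 w = (keyn B p w + `|w p| * B ^ p)%N.
Proof.
rewrite /keyn (bigD1 p) //= addnC; congr (_ + _)%N; apply: eq_bigl => q.
by rewrite ltnS -val_eqE /=; lia.
Qed.

Lemma keyn_lt B n w : (n <= r)%N -> (forall q, (`|w q| < B)%N) -> (keyn B n w < B ^ n)%N.
Proof.
move=> nr wB; elim: n nr => [|n IH] nr; first by rewrite /keyn big1.
have := keynS B w (Ordinal nr); rewrite /= => ->.
by have := IH (ltnW nr); have := wB (Ordinal nr); rewrite expnS; nia.
Qed.

(** Below [p] the digits of [w] contribute less than [B ^ p], so the smaller digit at [p]
    decides. *)
Lemma key_lt B w t p : (forall q, (`|w q| < B)%N) -> (`|w p| < `|t p|)%N ->
  (forall q, (p < q)%N -> w q = t q) -> (keyn B r w < keyn B r t)%N.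
Proof.
move=> wB lt e.
suff H n : (p < n)%N -> (n <= r)%N -> (keyn B n w < keyn B n t)%N by apply: H.
elim: n => [//|n IH] pn nr; have := keynS B w (Ordinal nr); have := keynS B t (Ordinal nr).
rewrite /= => -> ->; case: (ltngtP p n) => h; last 1 first.
- have -> : Ordinal nr = p by apply: val_inj.
  by have := keyn_lt (ltnW nr) wB; nia.
- by rewrite e //= ltn_add2r; apply: IH => //; lia.
- by lia.
Qed.

Lemma top_diff w t : w != t -> exists p, w p != t p /\ forall q, (p < q)%N -> w q = t q.
Proof.
move=> wt; have [p0 hp0] : exists p, w p != t p.
  apply: NNPP => no; case/eqP: wt; apply/ffunP => p; apply/eqP; apply: contraT => h.
  by case: no; exists p.
case: (@arg_maxnP _ p0 (fun p => w p != t p) (fun p : 'I_r => p : nat) hp0) => p hp mx; exists p; split=> // q pq.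
by apply/eqP; apply: contraT => h; have := mx q h; rewrite /=; lia.
Qed.

Definition sc (n c : nat) t : nat := (\sum_(q < r) ((n <= q)%N && (c%:Z <= t q)%R))%N.
(** The rank criterion for Bruhat order, applied to words. Suffixes are counted so that it refines
    to the order [keyn], which looks at last letters first. *)
Definition dom i t := forall n c, (sc n c i <= sc n c t)%N.

Lemma scS c t p : sc p c t = ((c%:Z <= t p)%R + sc p.+1 c t)%N.
Proof.
rewrite /sc (bigD1 p) //= [in RHS](bigD1 p) //= leqnn ltnn /= add0n; congr (_ + _)%N.
apply: eq_bigr => q qp; congr (nat_of_bool (_ && _)).
by move: qp; rewrite -val_eqE /=; lia.
Qed.

Lemma sc_swap n c t j : n != j.+1 -> sc n c (wperm t (stp j)) = sc n c t.
Proof.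
move=> nj; rewrite /sc [RHS](reindex_inj (@perm_inj _ (stp j))) /=.
apply: eq_bigr => q _; rewrite wpermE val_stp /swapn; congr (nat_of_bool (_ && _)).
by repeat case_if; lia.
Qed.

Lemma sc_lo c t j : sc j c t = ((c%:Z <= t (lo j))%R + sc j.+1 c t)%N.
Proof. exact: scS c t (lo j). Qed.
Lemma sc_hi c t j : sc j.+1 c t = ((c%:Z <= t (hi j))%R + sc j.+2 c t)%N.
Proof. exact: scS c t (hi j). Qed.

(** Only the suffix starting at [j+1] changes; its count is controlled by those of the suffixes from
    [j] and [j+2], since [t] ascends at [j]. *)
Lemma dom_swap i t j : t (lo j) < t (hi j) -> dom i t -> dom (wperm i (stp j)) t.
Proof.
move=> lt d n c; case: (altP (n =P j.+1)) => [->|nj]; last by rewrite sc_swap.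
have := d j c; have := d j.+2 c; have := d j.+1 c.
rewrite !sc_lo !sc_hi sc_swap ?wpermE ?stp_hi; last by lia.
by case: (c%:Z <= i (lo j)); case: (c%:Z <= i (hi j));
  case: (lerP c%:Z (t (lo j))); case: (lerP c%:Z (t (hi j))) => /=; lia.
Qed.

Lemma dom_trans a b c : dom a b -> dom b c -> dom a c.
Proof. by move=> h1 h2 n x; apply: leq_trans (h1 n x) (h2 n x). Qed.

Lemma dom_key B i t : posw i -> posw t -> (forall q, (`|i q| < B)%N) -> dom i t -> i != t ->
  (keyn B r i < keyn B r t)%N.
Proof.
move=> Pi Pt iB d it; have [p [ne e]] := top_diff it.
apply: (@key_lt B i t p) => //; have := Pi p; have := Pt p.
suff : i p <= t p by lia.
have := d p `|i p|%N; rewrite !scS.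
have -> : sc p.+1 `|i p|%N i = sc p.+1 `|i p|%N t.
  by apply: eq_bigr => q _; case: (ltnP p q) => //= h; rewrite (e q h).
by have := Pi p; case: lerP; case: lerP => /=; lia.
Qed.

End Orders.

(** * Raising operators on vectors and leading words *)

Section HighestWeight.
Variables (r : nat) (D : hecke_data r).
Local Notation F := (hF D).
Local Notation v := (hv D).
Local Notation V := (hV D).
Local Notation H := (hH D).
Local Notation vb := (vb D).
Local Notation hb := (hb D).
Implicit Types (i w t : word r) (x : sym r) (u : V) (h : H) (j : 'I_r.-1).

Let v0 : v != 0 := hv_neq0 D.

Lemma Cn_neq0 m : Cn v m.+1 != 0.
Proof.
apply/eqP => e; have := @sum_sq0 _ D _ (index_enum 'I_m.+1) (fun i : 'I_m.+1 => v ^+ i) e ord0.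
by rewrite mem_index_enum expr0 => /(_ isT) /eqP; rewrite oner_eq0.
Qed.

Definition inC i u := forall w, vc u w != 0 -> exists x, w = wperm i x.

Lemma inC_lin i (a : F) u u' : inC i u -> inC i u' -> inC i (a *: u + u').
Proof.
move=> h h' w; rewrite vcD vcZ; case: (altP (vc u w =P 0)) => [->|n] n'; last exact: h.
by apply: h'; move: n'; rewrite mulr0 add0r.
Qed.

Lemma inC0 i : inC i 0.
Proof. by move=> w; rewrite vc0 eqxx. Qed.

Lemma inC_vb i x : inC i (vb (wperm i x)).
Proof. by move=> w; rewrite vc_bas; case: (altP (wperm i x =P w)) => [<- _|_]; [exists x|rewrite eqxx]. Qed.

Lemma inC_aT i u j : inC i u -> inC i (aT u j).
Proof.
move=> h w; rewrite aT_coef /Tf.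
have h' : vc u (wperm w (stp j)) != 0 -> exists x, w = wperm i x.
  by move/h => [x e]; exists (pcomp x (stp j)); rewrite -wpermM -e wpermKs.
case: ifP => _; first exact: h'.
case: ifP => _; first by rewrite mulf_eq0 negb_or => /andP[_ /h].
case: (altP (vc u w =P 0)) => [->|n _]; last exact: h.
by rewrite mulr0 add0r.
Qed.

Lemma inC_aH i u h : inC i u -> inC i (aH u h).
Proof.
move=> hu; rewrite aHE.
apply: (big_ind (inC i)) => [|a b ha hb|w _]; first exact: inC0.
  by rewrite -[a]scale1r; apply: inC_lin.
rewrite -[_ *: _]addr0; apply: inC_lin; last exact: inC0.
rewrite aH_hb; elim: (redword w) u hu => [|j js IH] u hu //=.
by apply: IH; apply: inC_aT.
Qed.

Definition Eop (k : nat) : V -> V :=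
  vext (fun i => \sum_(p < r | i p == k.+1%:Z) v ^+ egn r k i p *: vb (upd i p k%:Z)).

Lemma Eop_lin k : islin (Eop k). Proof. exact: vext_lin. Qed.

Lemma Eop_vb k i : Eop k (vb i) =
  \sum_(p < r | i p == k.+1%:Z) v ^+ egn r k i p *: vb (upd i p k%:Z).
Proof. exact: vextU. Qed.

Lemma Ef_islin k w : @islin F V F^o (fun u => Ef v k (vc u) w).
Proof.
move=> a x y; rewrite /Ef -En_lin; apply: En_ext => z.
by rewrite vcD vcZ.
Qed.

Lemma Eop_coef k u w : vc (Eop k u) w = Ef v k (vc u) w.
Proof.
apply: (@veq_lin _ D F^o (fun u => vc (Eop k u) w) (fun u => Ef v k (vc u) w)) => [||i].
- exact: (lin_map_comp (@vc_lin _ D w) (Eop_lin k)).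
- exact: Ef_islin.
rewrite Eop_vb vc_sum big_mkcond /= /Ef /En; apply: eq_bigr => p _.
rewrite ltn_ord /= vc_bas; case: (altP (i =P upd w p k.+1%:Z)) => [->|ne].
  rewrite upd_same eqxx egn_upd vcZ vc_bas upd_upd mulr1.
  case: (altP (w p =P k%:Z)) => [e|n]; first by rewrite -e upd_id eqxx mulr1.
  case: eqP => [e|_]; last by rewrite mulr0.
  by case/eqP: n; rewrite -e upd_same.
rewrite mulr0 if_same; case: ifP => // /eqP e; rewrite vcZ vc_bas.
case: eqP => [e'|_]; last by rewrite mulr0.
by case/eqP: ne; rewrite -e' upd_upd -e upd_id.
Qed.

Lemma Eop_aT k u j : Eop k (aT u j) = aT (Eop k u) j.
Proof.
apply: (@vc_ext _ D) => w; rewrite aT_coef Eop_coef.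
have -> : vc (aT u j) = Tf v j (vc u) by apply: functional_extensionality => x; rewrite aT_coef.
have -> : vc (Eop k u) = Ef v k (vc u) by apply: functional_extensionality => x; rewrite Eop_coef.
exact: Ef_Tf.
Qed.

Lemma Eop_aH k u h : Eop k (aH u h) = aH (Eop k u) h.
Proof.
apply: (@heq_lin _ D V (fun h => Eop k (aH u h)) (aH (Eop k u))) => [||w].
- exact: (lin_map_comp (Eop_lin k) (aH_linr u)).
- exact: aH_linr.
rewrite !aH_hb; elim: (redword w) u => [|j js IH] u //=.
by rewrite IH Eop_aT.
Qed.

Definition hw u := forall k, (0 < k)%N -> Eop k u = 0.

Lemma hw_Ef u k w : hw u -> (0 < k)%N -> Ef v k (vc u) w = 0.
Proof. by move=> hu k0; rewrite -Eop_coef hu // vc0. Qed.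

Definition bound i : nat := (\sum_(p < r) `|i p|).+1.

Lemma boundP i x (p : 'I_r) : (`|wperm i x p| < bound i)%N.
Proof. by rewrite wpermE /bound ltnS (bigD1 (x p)) //= leq_addr. Qed.

Definition lead i u t := vc u t != 0 /\
  forall w, vc u w != 0 -> (keyn (bound i) r w <= keyn (bound i) r t)%N.

Lemma leadP i u : u != 0 -> exists t, lead i u t.
Proof.
move=> u0; have : vs u != [::].
  by apply: contraNneq u0 => e; rewrite [u]vdec e big_nil.
have : {subset vs u <= vs u} by [].
have sub w : w \in vs u = (vc u w != 0) by rewrite vs_mem.
suff H (s : seq (word r)) : s != [::] -> exists t, t \in s /\
   forall w, w \in s -> (keyn (bound i) r w <= keyn (bound i) r t)%N.
  move=> _ /H[t [ts tm]]; exists t; split; first by rewrite -sub.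
  by move=> w; rewrite -sub; apply: tm.
elim: s => [//|a s IH] _; have [->|s0] := eqVneq s [::].
  by exists a; rewrite inE eqxx; split=> // w; rewrite inE => /eqP ->.
have [t [ts tm]] := IH s0.
case: (leqP (keyn (bound i) r a) (keyn (bound i) r t)) => h.
  by exists t; rewrite inE ts orbT; split=> // w; rewrite inE => /orP[/eqP ->|/tm].
exists a; rewrite inE eqxx; split=> // w; rewrite inE => /orP[/eqP ->//|/tm h'].
exact: leq_trans h' (ltnW h).
Qed.

Lemma cnt_tail n c w t : (forall q : 'I_r, (n <= q)%N -> w q = t q) ->
  cnt r c w = cnt r c t -> cnt n c w = cnt n c t.
Proof.
have E (x : word r) : cnt r c x = (cnt n c x + \sum_(q < r) ((n <= q)%N && (x q == c%:Z)))%N.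
  rewrite /cnt -big_split; apply: eq_bigr => q _; rewrite ltn_ord /=.
  by case: ltnP => h /=; rewrite ?addn0 ?add0n.
move=> e; rewrite !E; have -> : (\sum_(q < r) ((n <= q)%N && (w q == c%:Z)) =
  \sum_(q < r) ((n <= q)%N && (t q == c%:Z)))%N.
  by apply: eq_bigr => q _; case: leqP => //= h; rewrite e.
exact: addIn.
Qed.

Lemma egn_split n k w (p : 'I_r) : (p < n)%N -> (n <= r)%N ->
  egn r k w p = (egn n k w p + \sum_(q < r) ((n <= q)%N && (w q == k%:Z)))%N.
Proof.
move=> pn nr; rewrite /egn -addnA; congr (_ + _)%N; rewrite -big_split; apply: eq_bigr => q _ /=.
rewrite ltn_ord; case: (ltnP q n) => h /=; rewrite ?addn0 ?andbF ?add0n //.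
by rewrite (leq_trans pn h).
Qed.

(** If a prefix of [t] had more letters [k+1] than [k], the part [f] of [u] agreeing with [t] beyond
    that prefix would have negative weight there. The truncated raising operator kills [f], so
    [En_inj] gives [f = 0], against [f t <> 0]. *)
Lemma lead_yam i u t : posw i -> inC i u -> hw u -> lead i u t -> yam t.
Proof.
move=> Pi Cu hu [ut mx].
have Pu w : vc u w != 0 -> posw w by move/Cu => [x ->]; apply: posw_perm.
split=> [|n k k0]; first exact: Pu.
wlog nr : n / (n <= r)%N.
  move=> W; case: (leqP n r) => h; first exact: W.
  by rewrite !(cnt_ge _ _ (ltnW h)); apply: W.
rewrite leqNgt; apply/negP => lt.
pose agree w := [forall q : 'I_r, (n <= q)%N ==> (w q == t q)].
pose f w := if agree w then vc u w else 0.
have agreeP w : agree w -> forall q : 'I_r, (n <= q)%N -> w q = t q.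
  by move=> /forallP h q nq; have := h q; rewrite nq => /eqP.
have agree_upd w (p : 'I_r) c : (p < n)%N -> agree (upd w p c) = agree w.
  move=> pn; apply: eq_forallb => q; case: (leqP n q) => //= nq.
  by rewrite upd_out //; apply: contraTneq nq => ->; rewrite -ltnNge.
have tt : agree t by apply/forallP => q; rewrite eqxx implybT.
have : f t = 0.
  apply: (@En_inj r F v k v0 Cn_neq0 n f 1 nr) => w.
    rewrite /f; case: ifP => [aw /Cu[x ew]|_]; last by rewrite eqxx.
    have [y ey] := Cu t ut.
    have cc c : cnt n c w = cnt n c t.
      by apply: cnt_tail; [apply: agreeP|rewrite ew ey !cnt_wperm].
    by rewrite !cc; lia.
  rewrite /=; case: (boolP (agree w)) => aw; last first.
    apply: big1 => p _; case: ifP => // /andP[pn _].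
    by rewrite /f agree_upd // (negPf aw) mulr0.
  have := hw_Ef w hu k0; rewrite /Ef /En.
  pose e0 := (\sum_(q < r) ((n <= q)%N && (w q == k%:Z)))%N.
  rewrite (eq_bigr (fun p : 'I_r => v ^+ e0 * (if (p < n)%N && (w p == k%:Z)
     then v ^+ egn n k w p * f (upd w p k.+1%:Z) else 0))); last first.
    move=> p _; rewrite ltn_ord /=; case: (altP (w p =P k%:Z)) => wp; last by rewrite andbF mulr0.
    case: (ltnP p n) => pn /=.
      by rewrite /f agree_upd // aw (egn_split _ _ pn nr) exprD -/e0; ring.
    (* Raising at a position [p >= n] involves a word that agrees with [t] after [p] and has a
       larger letter at [p]: it exceeds the leading word, so its coefficient vanishes. *)
    rewrite mulr0; have [->|nz] := eqVneq (vc u (upd w p k.+1%:Z)) 0; first by rewrite mulr0.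
    have := mx _ nz; rewrite leqNgt => /negP[]; have [y ey] := Cu t ut.
    apply: (@key_lt _ _ t (upd w p k.+1%:Z) p) => [q||q pq].
    - rewrite ey; exact: boundP.
    - by rewrite upd_same -(agreeP w aw p pn) wp; lia.
    - by rewrite upd_out ?(agreeP w aw) //; [lia|rewrite -val_eqE /=; lia].
  rewrite -mulr_sumr => /eqP; rewrite mulf_eq0 expf_eq0 (negPf v0) andbF /=.
  by move/eqP.
by rewrite /f tt => e; rewrite e eqxx in ut.
Qed.

Definition gen t : V := aH (vb t) (y_of D (Lcol t)).

Lemma hw_aH u h : hw u -> hw (aH u h).
Proof. by move=> hu k k0; rewrite Eop_aH hu // (lin_map0 (aH_linl _)). Qed.

Lemma posw_upd w (p : 'I_r) c : posw w -> 0 < c -> posw (upd w p c).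
Proof. by move=> Pw c0 q; rewrite updE; case: eqP. Qed.

Lemma tight_pred t (p : 'I_r) k : tight t -> (0 < k)%N -> t p = k.+1%:Z ->
  exists q : 'I_r, [/\ q != p, t q = k%:Z & Lcol t q = Lcol t p].
Proof.
move=> T k0 tp; have [Y _] := T; have := Y.2 p.+1 k k0.
rewrite !cntS tp eqxx; have -> : (k.+1%:Z == k%:Z) = false by lia.
rewrite addn0 addn1 => lt.
have [q [q1 q2 q3]] := cnt_ivt lt (ltnW (ltn_ord p)).
exists q; split=> //; first by apply: contraTneq q1 => ->; rewrite ltnn.
by rewrite !ffunE /col q2 tp /= q3.
Qed.

(** In a tight word each letter [k+1] has a [k] in its column, so lowering it to [k] repeats a
    letter in a block and [y] kills the result. *)
Lemma gen_hw t : tight t -> hw (gen t).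
Proof.
move=> T k k0; rewrite /gen Eop_aH Eop_vb (lin_map_sum (aH_linl _)) big1 // => p /eqP tp.
rewrite (lin_mapZ (aH_linl _)) y_notinj ?scaler0 //.
- exact: Lcol_wincr.
- by apply: posw_upd => //; exact: T.1.1.
move=> inj; have [q [qp tq eL]] := tight_pred T k0 tp.
have : q = p by apply: inj => //; rewrite upd_same upd_out.
by move/eqP; rewrite (negPf qp).
Qed.

Lemma gen_inC t : inC t (gen t).
Proof. by apply: inC_aH; rewrite -{2}(wperm1 t); apply: inC_vb. Qed.

Lemma gen_coef t : tight t -> vc (gen t) t = 1.
Proof. by move=> T; apply: strict_y_coef; [apply: Lcol_wincr|apply: Lcol_strict]. Qed.

Lemma gen_neq0 t : tight t -> gen t != 0.
Proof.
move=> T; apply/eqP => e; have := gen_coef T; rewrite e vc0 => /eqP.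
by rewrite eq_sym oner_eq0.
Qed.

Lemma young_dom L t x : wincr L -> strict_on L t -> x \in young_of L -> dom (wperm t x) t.
Proof.
move=> Linc st; rewrite -(wprod_redword x); have := reduced_redword x.
elim/last_ind: (redword x) => [|js j IH]; first by move=> _ _ n c; rewrite /= wperm1.
rewrite reduced_rconsE wprod_rcons => /andP[red asc] wY.
have eL : L (lo j) = L (hi j).
  have /young_ofP wY' := wY.
  have := wY' (lo j); have := wY' (hi j); rewrite !pcompE stp_lo stp_hi => h1 h2.
  have := Linc _ _ (ltnW asc); have := wincr_lohi j Linc; rewrite h1 h2 => a b.
  by apply/eqP; rewrite eq_le a b.
have wY' : wprod js \in young_of L by rewrite -(young_right _ eL).
by rewrite -wpermM; apply: dom_swap; [apply: st => //; exact: lo_lt_hi|apply: IH].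
Qed.

Definition inD t u := forall w, vc u w != 0 -> dom w t.

Lemma inD_aT t u j : t (lo j) < t (hi j) -> inD t u -> inD t (aT u j).
Proof.
move=> lt h w; rewrite aT_coef /Tf.
have h' : vc u (wperm w (stp j)) != 0 -> dom w t.
  by move/h => d; rewrite -(wpermKs w j); apply: dom_swap.
case: ifP => _; first exact: h'.
case: ifP => _; first by rewrite mulf_eq0 negb_or => /andP[_ /h].
case: (altP (vc u w =P 0)) => [->|n _]; last exact: h.
by rewrite mulr0 add0r.
Qed.

Lemma gen_inD t : tight t -> inD t (gen t).
Proof.
move=> T w; have Li := Lcol_wincr T; have Ls := Lcol_strict T.
rewrite /gen strict_y // vc_sum => nz.
have [x xY ew] : exists2 x, x \in young_of (Lcol t) & w = wperm t x.
  apply: NNPP => no; case/eqP: nz; apply: big1 => x xY; rewrite vcZ vb_vc1 ?mulr0 //.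
  by apply/eqP => e; apply: no; exists x.
by rewrite ew; apply: young_dom xY.
Qed.

(** Both words have the columns of the same conjugate partition, and each is the minimal word
    strictly increasing along them. *)
Lemma tight_uniq t t' x : tight t -> tight t' -> t' = wperm t x -> t' = t.
Proof.
move=> T T' e.
have [mu [y [pm ey]]] := yam_partition T.1.
have eL : Lcol t = Lcol t'.
  rewrite -(Lcol_conjp pm T ey) -(Lcol_conjp pm T' (w := pcomp y x)) //.
  by rewrite e ey wpermM.
apply/ffunP => p; apply/eqP; rewrite eq_le.
rewrite (Lcol_min T' T.1.1) -?eL; last exact: Lcol_strict.
by rewrite (Lcol_min T T'.1.1) // eL; apply: Lcol_strict.
Qed.

(** The ascent-swapping of [climb] leads from [t] to the tight word. Undoing a swap at [j] is
    multiplication by [T_j]: as [t] ascends at [j], its new coefficient is the old one of the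
    swapped word, and dominance persists. *)
Lemma yam_gen t0 t x : tight t0 -> yam t -> t = wperm t0 x ->
  exists h, inD t (aH (gen t0) h) /\ vc (aH (gen t0) h) t != 0.
Proof.
move=> T0; pose g (p : 'I_r) := (p : nat).
move: {2}(wt g t).+1 (ltnSn (wt g t)) => n; elim: n t x => [//|n IH] t x le Y et.
have [[j [lt Yj]]|none] := classic (exists j, t (lo j) < t (hi j) /\ yam (wperm t (stp j))); last first.
  have T : tight t by split=> // j lt Yj; apply: none; exists j.
  have -> := tight_uniq T0 T et; exists (hb 1%g); rewrite aH1; split; first exact: gen_inD.
  by rewrite gen_coef // oner_eq0.
have lw : (wt g (wperm t (stp j)) < wt g t)%N.
  apply: wt_swap; rewrite /g lo_lt_hi; apply/orP; left.
  by have := Y.1 (lo j); have := Y.1 (hi j); lia.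
have [||h [dh ch]] := IH (wperm t (stp j)) (pcomp x (stp j)) _ Yj.
- by lia.
- by rewrite et wpermM.
exists (hM h (hb (stp j))); rewrite aHM -aT_aH; split.
  apply: inD_aT => // w /dh d; apply: dom_trans d _; apply: dom_swap => //.
by rewrite aT_coef /Tf lt.
Qed.

(** The leading word of [u] is Yamanouchi, and [gen t H] has an element with the same leading word;
    subtracting a multiple lowers the leading word, and the key gives the induction. *)
Lemma hw_gen t u : tight t -> inC t u -> hw u -> exists h, u = aH (gen t) h.
Proof.
move=> T Cu hu.
suff H n : forall u, inC t u -> hw u -> (forall w, vc u w != 0 -> (keyn (bound t) r w < n)%N) ->
    exists h, u = aH (gen t) h.
  have [->|u0] := eqVneq u 0; first by exists 0; rewrite (lin_map0 (aH_linr _)).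
  have [t' [_ mx]] := leadP t u0.
  by apply: (H (keyn (bound t) r t').+1) => // w /mx; rewrite ltnS.
elim: n => [|n IH] {Cu hu} u Cu hu bnd.
  exists 0; rewrite (lin_map0 (aH_linr _)); apply: (@vc_ext _ D) => w; rewrite vc0.
  by apply/eqP; apply: contraT => /bnd.
have [->|u0] := eqVneq u 0; first by exists 0; rewrite (lin_map0 (aH_linr _)).
have [t' [ut' mx]] := leadP t u0.
have [x et'] := Cu _ ut'.
have Y := lead_yam T.1.1 Cu hu (conj ut' mx).
have [h [dh ch]] := yam_gen T Y et'.
(* Chosen to cancel the coefficient at [t']; every other word of either vector has a smaller key. *)
pose c := vc u t' / vc (aH (gen t) h) t'.
have Cg : inC t (aH (gen t) h) by apply: inC_aH; apply: gen_inC.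
have eu : u - c *: aH (gen t) h = (- c) *: aH (gen t) h + u by rewrite scaleNr addrC.
have [h' eh'] : exists h', u - c *: aH (gen t) h = aH (gen t) h'.
  apply: IH.
  - by rewrite eu; apply: inC_lin.
  - move=> k k0; rewrite (lin_mapB (Eop_lin k)) (lin_mapZ (Eop_lin k)) hu //.
    by rewrite (hw_aH h (gen_hw T)) // scaler0 subr0.
  move=> w nz; have [ew|ne] := eqVneq w t'.
    by move: nz; rewrite ew vcB vcZ /c mulfVK // subrr eqxx.
  suff : (keyn (bound t) r w < keyn (bound t) r t')%N.
    by move/leq_trans; apply; rewrite -ltnS; apply: bnd.
  have [wu|] := eqVneq (vc u w) 0.
    have wg : vc (aH (gen t) h) w != 0.
      by apply: contraNneq nz => wg; rewrite vcB vcZ wu wg mulr0 subr0.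
    have [y ey] := Cg w wg; apply: dom_key => //.
    - by rewrite ey; apply: posw_perm T.1.1.
    - exact: Y.1.
    - by rewrite ey => q; apply: boundP.
    - exact: dh.
  move=> wu; rewrite ltn_neqAle mx // andbT.
  have [p [np ep]] := top_diff ne; have [y ey] := Cu w wu.
  have Pw : posw w by rewrite ey; apply: posw_perm T.1.1.
  have Pt := Y.1; have pw := Pw p; have pt := Pt p.
  case: (ltngtP `|w p|%N `|t' p|%N) => hlt; last by case/eqP: np; lia.
    by rewrite neq_ltn (@key_lt _ (bound t) w t' p) // => q; rewrite ey; apply: boundP.
  rewrite neq_ltn (@key_lt _ (bound t) t' w p) ?orbT // => q; first by rewrite et'; apply: boundP.
  by move/ep.
exists (c *: h + h'); rewrite (lin_mapD (aH_linr _)) (lin_mapZ (aH_linr _)) -eh'.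
by rewrite addrC subrK.
Qed.

End HighestWeight.

(** * Primitive idempotents *)

Section Wlam.
Variable r : nat.
Implicit Types (w x a b : sym r) (mu : seq nat).

Lemma young_of1 (L : word r) : 1%g \in young_of L.
Proof. by apply/young_ofP => p; rewrite perm1. Qed.

Lemma young_ofM (L : word r) a b : a \in young_of L -> b \in young_of L -> pcomp a b \in young_of L.
Proof. by move=> /young_ofP ha /young_ofP hb; apply/young_ofP => p; rewrite pcompE ha hb. Qed.

Lemma tight_word mu : is_partition r mu -> exists x,
  tight (wperm (lword r mu) x) /\ lword r (conjp mu) = Lcol (wperm (lword r mu) x).
Proof.
move=> pm; have [x T] := climb (lword_yam pm); exists x; split=> //.
exact: Lcol_conjp pm T erefl.
Qed.

(** Two equal letters in one block would make the transposition of their positions a common element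
    of the two subgroups whose intersection is trivial. *)
Lemma is_wlam_inj mu w : is_wlam mu w -> inj_on (lword r (conjp mu)) (wperm (lword r mu) w).
Proof.
move=> /andP[_ /eqP e] p q eL; rewrite !wpermE => ew.
apply/eqP; apply: contraT => pq.
have ewt y : lword r mu (w (tperm p q y)) = lword r mu (w y) by case: tpermP => [->|->|].
have : tperm p q \in [set pcomp (pcomp (w^-1)%g a) w | a in young r mu] :&: young r (conjp mu).
  rewrite inE; apply/andP; split.
    apply/imsetP; exists (pcomp (pcomp w (tperm p q)) (w^-1)%g).
      by apply/young_ofP => y; rewrite !pcompE ewt permKV.
    by apply/permP => y; rewrite !pcompE !permK.
  by apply/young_ofP => y; case: tpermP => [->|->|].
rewrite e inE => /eqP /permP /(_ p); rewrite tpermL perm1 => h.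
by rewrite h eqxx in pq.
Qed.

(** [wlam] has a default value, so existence is needed. The permutation giving the tight word
    separates letters in every column; this depends only on its double coset, in which an element of
    minimal length is taken. *)
Lemma is_wlam_exists mu : is_partition r mu -> exists w, is_wlam (r := r) mu w.
Proof.
move=> pm; have [w0 [T eL]] := tight_word pm.
have d0 : w0 \in dcoset mu w0.
  by apply/imset2P; exists 1%g 1%g; rewrite ?young_of1 // pcomp1p pcompp1.
case: (@arg_minnP _ w0 (fun w => w \in dcoset mu w0) (@len r) d0) => w1 d1 mn.
have /imset2P[a b aY bY ew1] := d1.
exists w1; apply/andP; split.
  apply/forallP => u; apply/implyP => /imset2P[a' b' aY' bY' ->]; apply: mn.
  apply/imset2P; exists (pcomp a' a) (pcomp b b'); rewrite ?young_ofM //.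
  by rewrite ew1 !pcompA.
apply/eqP/setP => x; rewrite !inE; apply/andP/eqP => [[/imsetP[c cY ex] xY]|->]; last first.
  split; last by rewrite wperm1.
  by apply/imsetP; exists 1%g; [exact: young_of1|rewrite pcompp1 /pcomp mulgV].
apply/permP => p; rewrite perm1.
have inj := strict_inj (Lcol_strict T).
have /young_ofP bL := bY; have /young_ofP aL := aY; have /young_ofP cL := cY.
have /young_ofP xL : x \in young_of (lword r (conjp mu)) by rewrite inE; exact: xY.
apply: (@perm_inj _ b); apply: inj; first by rewrite -eL !bL xL.
rewrite !wpermE.
have e y : lword r mu (w1 y) = lword r mu (w0 (b y)) by rewrite ew1 !pcompE aL.
by rewrite -!e ex !pcompE permKV cL.
Qed.

Lemma wlam_inj mu : is_partition r mu ->
  inj_on (lword r (conjp mu)) (wperm (lword r mu) (wlam r mu)).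
Proof.
move=> /is_wlam_exists[w hw]; apply: is_wlam_inj; rewrite /wlam.
by case: pickP => [//|/(_ w)]; rewrite hw.
Qed.

Definition wsum (i : word r) : nat := (\sum_(p < r) `|i p|)%N.

Lemma wsum_wperm i x : wsum (wperm i x) = wsum i.
Proof.
rewrite /wsum [RHS](reindex_inj (@perm_inj _ x)) /=.
by apply: eq_bigr => p _; rewrite wpermE.
Qed.

Lemma wsum_le (i k : word r) : posw i -> (forall p, i p <= k p) ->
  (wsum i <= wsum k)%N /\ (wsum i = wsum k -> i = k).
Proof.
move=> Pi le; have le' p : (`|i p| <= `|k p|)%N by have := le p; have := Pi p; lia.
split; first by apply: leq_sum.
move=> e; have : (\sum_(p < r) (`|k p| - `|i p|) = 0)%N.
  by rewrite sumnB // -/(wsum k) -/(wsum i) e subnn.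
move/eqP; rewrite sum_nat_eq0 => /forallP h; apply/ffunP => p.
by have := h p; rewrite /= subn_eq0; have := le p; have := Pi p; lia.
Qed.

(** A partition of [r] has at most [r] parts, each at most [r], so padding with zeros gives an
    [r]-tuple. *)
Definition allparts : seq (seq nat) :=
  [seq mu <- [seq filter (fun m => 0 < m)%N (map val (val t)) | t <- enum {: r.-tuple 'I_r.+1}] |
     is_partition r mu].

Lemma mem_allparts mu : (mu \in allparts) = is_partition r mu.
Proof.
rewrite mem_filter; case: (boolP (is_partition r mu)) => //= /and3P[s am /eqP sr].
have le m : m \in mu -> (m <= r)%N.
  by move=> mm; rewrite -sr; move: mm; elim: (mu) => //= a l IH; rewrite inE => /orP[/eqP ->|/IH]; lia.
have sz : (size mu <= r)%N.
  rewrite -sr; elim: (mu) am => //= a l IH /andP[a0 /IH]; lia.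
have szs : size (map (@inord r) (mu ++ nseq (r - size mu) 0%N)) == r.
  by rewrite size_map size_cat size_nseq subnKC.
apply/mapP; exists (Tuple szs); first by rewrite mem_enum.
rewrite /= -map_comp map_cat filter_cat.
have -> : map (val \o @inord r) (nseq (r - size mu) 0%N) = nseq (r - size mu) 0%N.
  by rewrite map_nseq /= inordK.
have -> : [seq m <- nseq (r - size mu) 0%N | (0 < m)%N] = [::] by elim: (r - size mu)%N.
rewrite cats0 -[LHS]filter_predT.
have -> : map (val \o @inord r) mu = mu.
  rewrite -[RHS]map_id; apply/eq_in_map => m /le mr; by rewrite /= inordK.
by apply/eq_in_filter => m mm; rewrite (allP am m mm).
Qed.

End Wlam.

(** * Membership in a span tested by orthogonality *)

Section Separation.
Variables (r : nat) (D : hecke_data r).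
Local Notation F := (hF D).
Local Notation H := (hH D).
Local Notation hb := (hb D).

(** [hdot] is the standard form in coordinates, so a separating element is read off from a column of
    the cokernel matrix. *)
Lemma span_or_separate (T : finType) (X : T -> H) (y : H) :
  (exists c : T -> F, y = \sum_t c t *: X t) \/
  (exists j : H, (forall t, hdot (X t) j = 0) /\ hdot y j != 0).
Proof.
pose A : 'M[F]_(#|T|, #|{: sym r}|) := \matrix_(i, w) hc (X (enum_val i)) (enum_val w).
pose Y : 'rV[F]_#|{: sym r}| := \row_w hc y (enum_val w).
have hE (x : H) (l : 'I_#|{: sym r}|) : hdot x (\sum_w (cokermx A) (enum_rank w) l *: hb w) =
    \sum_w hc x (enum_val w) * (cokermx A) w l.
  rewrite /hdot (reindex (@enum_val _ (mem {: sym r}))) /=; last first.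
    by apply: onW_bij; exact: enum_val_bij.
  apply: eq_bigr => w _; congr (_ * _); rewrite hc_sum (bigD1 (enum_val w) isT) /=.
  rewrite hcZ hc_bas eqxx mulr1 enum_valK big1 ?addr0 // => x' ne.
  by rewrite hcZ hc_bas (negPf ne) mulr0.
case: (boolP (Y <= A)%MS) => [/submxP[C e]|n].
  left; exists (fun t => C 0 (enum_rank t)); apply: (@hc_ext _ D) => w.
  have := congr1 (fun M : 'rV_#|{: sym r}| => M 0 (enum_rank w)) e.
  rewrite !mxE enum_rankK => ->; rewrite hc_sum [RHS](reindex (@enum_val _ (mem T))) /=; last first.
    by apply: onW_bij; exact: enum_val_bij.
  by apply: eq_bigr => t _; rewrite hcZ mxE enum_valK enum_rankK.
right; have [l hl] : exists l, (Y *m cokermx A) 0 l != 0.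
  apply: NNPP => no; case/negP: n; rewrite submxE; apply/eqP/matrixP => i l.
  rewrite (ord1 i) [RHS]mxE; apply/eqP; apply: contraT => h.
  by case: no; exists l.
exists (\sum_w (cokermx A) (enum_rank w) l *: hb w); split=> [t|]; rewrite hE.
  have := congr1 (fun M : 'M_(_, _) => M (enum_rank t) l) (mulmx_coker A); rewrite [RHS]mxE.
  by apply: etrans; rewrite mxE; apply: eq_bigr => w _; rewrite [A _ _]mxE enum_rankK.
by move: hl; rewrite mxE; under eq_bigr do rewrite mxE.
Qed.

End Separation.

(** * The elements [eps_mu] and the ideals they generate *)

Section Blocks.
Variables (r : nat) (D : hecke_data r).
Local Notation F := (hF D).
Local Notation v := (hv D).
Local Notation V := (hV D).
Local Notation H := (hH D).
Local Notation vb := (vb D).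
Local Notation hb := (hb D).
Implicit Types (mu lam : seq nat) (u : V) (h : H).

Let v0 : v != 0 := hv_neq0 D.

Definition ypart mu : H := y_of D (lword r (conjp mu)).
Definition tpart mu : H := v ^+ len (wlam r mu) *: hb (wlam r mu).
Definition npart mu : H := hM (tpart mu) (ypart mu).
Definition ppart mu : V := aH (vb (lword r mu)) (npart mu).
Definition eps mu : H := ip (ppart mu) (ppart mu).
Definition spe mu : H := hM (hM (x_of D (lword r mu)) (tpart mu)) (ypart mu).

Section OnePartition.
Variable mu : seq nat.
Hypothesis pm : is_partition r mu.

Lemma part_sum : sumn mu = r.
Proof. by case/and3P: pm => _ _ /eqP. Qed.

Lemma part_wincr : wincr (lword r mu).
Proof. by apply: lword_wincr; rewrite part_sum. Qed.

Lemma part_pos : posw (lword r mu).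
Proof. exact: lword_pos part_sum. Qed.

Lemma y_nonzero u i : posw i -> inC i u -> aH u (ypart mu) != 0 ->
  exists w, strict_on (lword r (conjp mu)) (wperm i w).
Proof.
move=> Pi Cu; rewrite {1}[u]vdec (lin_map_sum (aH_linl _)) => nz.
have [x T] := tight_word pm; have Li : wincr (lword r (conjp mu)).
  by rewrite T.2; apply: Lcol_wincr T.1.
apply: NNPP => no; case/eqP: nz; rewrite big_seq big1 // => k; rewrite vs_mem => ck.
rewrite (lin_mapZ (aH_linl _)); have [y ek] := Cu k ck.
have Pk : posw k by rewrite ek; apply: posw_perm.
have [[-> _]|[w [c [_ _ st _]]]] := y_sort D Li Pk; first by rewrite scaler0.
by case: no; exists (pcomp y w); rewrite -wpermM -ek.
Qed.

(** A word not killed sorts to one strictly increasing along the columns; the tight word lies below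
    it letter by letter, and equal sums force equality. *)
Lemma y_wsum u i : posw i -> inC i u -> aH u (ypart mu) != 0 ->
  (wsum (lword r mu) <= wsum i)%N /\
  (wsum (lword r mu) = wsum i -> exists x, lword r mu = wperm i x).
Proof.
move=> Pi Cu nz; have [w st] := y_nonzero Pi Cu nz.
have [x [T eL]] := tight_word pm; rewrite eL in st.
have [le eq] := wsum_le T.1.1 (Lcol_min T (posw_perm w Pi) st).
rewrite -(wsum_wperm (lword r mu) x) -(wsum_wperm i w); split=> // /eq e.
exists (pcomp w (x^-1)%g); rewrite -wpermM -e wpermM.
by rewrite /pcomp mulVg wperm1.
Qed.

(** [omega_mu T_w] is a power of [v] times a word whose letters are distinct in each column, so
    [y_sort] does not kill it. The sorted word has the letter sum of the tight word, hence equals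
    it. *)
Lemma ppart_gen : exists x c, [/\ tight (wperm (lword r mu) x), c != 0,
  lword r (conjp mu) = Lcol (wperm (lword r mu) x) & ppart mu = c *: gen D (wperm (lword r mu) x)].
Proof.
have [x [T eL]] := tight_word pm; exists x.
have Li : wincr (lword r (conjp mu)) by rewrite eL; apply: Lcol_wincr.
have Pw := posw_perm (wlam r mu) part_pos.
have [m em _] := word_act D (wlam r mu) part_wincr.
have [[_ nj]|[w [c [_ c0 st e]]]] := y_sort D Li Pw; first by case: nj; apply: wlam_inj.
rewrite eL wpermM in st.
have [_ eq] := wsum_le T.1.1 (Lcol_min T (posw_perm _ part_pos) st).
have ew := eq ltac:(by rewrite !wsum_wperm).
exists (v ^+ len (wlam r mu) * v ^+ m * c); split=> //.
  by rewrite !mulf_neq0 // expf_neq0.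
rewrite /ppart /npart aHM (lin_mapZ (aH_linr _)) em scalerA (lin_mapZ (aH_linl _)).
by rewrite e scalerA wpermM -ew /gen -eL.
Qed.

Lemma ppart_inC : inC (lword r mu) (ppart mu).
Proof. by apply: inC_aH; rewrite -{2}(wperm1 (lword r mu)); apply: inC_vb. Qed.

Lemma ppart_neq0 : ppart mu != 0.
Proof.
have [x [c [T c0 _ ->]]] := ppart_gen.
by rewrite scaler_eq0 negb_or c0 gen_neq0.
Qed.

Lemma dot_ppart : dot (ppart mu) (ppart mu) != 0.
Proof. by apply: contra_neq ppart_neq0; apply: dot_eq0. Qed.

Lemma one_dim u : inC (lword r mu) u -> exists c, aH u (ypart mu) = c *: ppart mu.
Proof.
move=> Cu; have [x [c [T c0 eL ep]]] := ppart_gen.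
rewrite [u in aH u]vdec (lin_map_sum (aH_linl _)) big_seq.
apply: (big_ind (fun y => exists c, y = c *: ppart mu)).
- by exists 0; rewrite scale0r.
- by move=> _ _ [a ->] [b ->]; exists (a + b); rewrite scalerDl.
move=> k; rewrite vs_mem => ck; have [y ek] := Cu k ck.
have Pk : posw k by rewrite ek; apply: posw_perm part_pos.
have Li : wincr (lword r (conjp mu)) by rewrite eL; apply: Lcol_wincr.
rewrite (lin_mapZ (aH_linl _)).
have [[-> _]|[w [d [_ d0 st e]]]] := y_sort D Li Pk; first by exists 0; rewrite scaler0 scale0r.
have st' : strict_on (Lcol (wperm (lword r mu) x)) (wperm k w) by rewrite -eL.
have [_ eq] := wsum_le T.1.1 (Lcol_min T (posw_perm _ Pk) st').
have ew := eq ltac:(by rewrite ek !wsum_wperm).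
exists (vc u k * d * c^-1); rewrite e ep -ew /gen -eL !scalerA.
by rewrite -!mulrA mulVf // mulr1.
Qed.

Definition chi u : F := dot u (ppart mu) / dot (ppart mu) (ppart mu).

Lemma chiE u c : u = c *: ppart mu -> u = chi u *: ppart mu.
Proof.
move=> ->; congr (_ *: _); rewrite /chi (lin_mapZ (dot_linl _)) mulfK //.
exact: dot_ppart.
Qed.

(** [eps mu] ends in the factor [ypart mu], so [one_dim] applies. By H-linear rank one maps this
    controls [u eps_mu h eps_mu] for every vector [u]. *)
Lemma ppart_eps h : aH (aH (ppart mu) h) (eps mu) =
  chi (aH (aH (ppart mu) h) (eps mu)) *: ppart mu.
Proof.
suff [c] : exists c, aH (aH (ppart mu) h) (eps mu) = c *: ppart mu by apply: chiE.
have -> : eps mu = hM (ip (ppart mu) (aH (vb (lword r mu)) (tpart mu))) (ypart mu).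
  by rewrite -ip_aHr -aHM.
by rewrite aHM; apply: one_dim; do 2!apply: inC_aH; apply: ppart_inC.
Qed.

Lemma dot_ip_neq0 u : u != 0 -> aH u (ip u u) != 0.
Proof.
apply: contra_neq => e; apply: dot_eq0.
have := congr1 (fun x => dot x u) e; rewrite aHE (lin_map_sum (dot_linl _)) (lin_map0 (dot_linl _)).
move=> e2; have e3 : \sum_w dot (aH u (hb w)) u ^+ 2 = 0.
  rewrite -[RHS]e2; apply: eq_bigr => w _.
  by rewrite (lin_mapZ (dot_linl _)) hc_ip expr2.
by have := sum_sq0 e3 (mem_index_enum 1%g); rewrite aH1.
Qed.

Definition ceps : F := chi (aH (ppart mu) (eps mu)).

Lemma ppart_epsE : aH (ppart mu) (eps mu) = ceps *: ppart mu.
Proof. by have := ppart_eps (hb 1%g); rewrite aH1. Qed.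

Lemma ceps_neq0 : ceps != 0.
Proof.
apply: contra_neq (dot_ip_neq0 ppart_neq0) => c0.
by rewrite -/(eps mu) ppart_epsE c0 scale0r.
Qed.

Lemma eps_specht : eps mu = hM (star (npart mu)) (spe mu).
Proof. by rewrite /eps /ppart ip_aHl ip_aHr -x_ofE ?hMA //; exact: part_wincr. Qed.

(** [spe mu] equals [ip] of [omega_mu] with [p_mu], so [spe mu h] depends only on [p_mu h]. *)
Lemma specht0 h : aH (ppart mu) h = 0 -> hM (spe mu) h = 0.
Proof.
move=> e; rewrite /spe -!hMA x_ofE; last exact: part_wincr.
by rewrite -ip_aHr !hMA aHM -/(npart mu) -/(ppart mu) e (lin_map0 (ip_linr _)).
Qed.

End OnePartition.

Lemma star_eps mu : star (eps mu) = eps mu.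
Proof. exact: star_ip. Qed.

(** A nonzero product bounds the letter sum of [lam] by that of [mu], its adjoint gives the reverse
    bound, and equality identifies the contents. *)
Lemma eps_orth mu lam h : is_partition r mu -> is_partition r lam -> mu <> lam ->
  aH (aH (ppart mu) h) (eps lam) = 0.
Proof.
move=> pm pl ne; apply/eqP; apply: contraT => nz; case: ne.
have [h1 e1] : (wsum (lword r lam) <= wsum (lword r mu))%N /\
    (wsum (lword r lam) = wsum (lword r mu) -> exists x, lword r lam = wperm (lword r mu) x).
  apply: (@y_wsum lam pl (aH (aH (ppart mu) h) (ip (ppart lam) (aH (vb (lword r lam)) (tpart lam))))).
  - exact: part_pos.
  - by do 2!apply: inC_aH; apply: ppart_inC.
  have e : eps lam = hM (ip (ppart lam) (aH (vb (lword r lam)) (tpart lam))) (ypart lam).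
    by rewrite -ip_aHr -aHM.
  by rewrite -aHM -e.
have [h2 _] : (wsum (lword r mu) <= wsum (lword r lam))%N /\
    (wsum (lword r mu) = wsum (lword r lam) -> exists x, lword r mu = wperm (lword r lam) x).
  apply: (@y_wsum mu pm (aH (ppart lam) (star h))).
  - exact: part_pos.
  - by apply: inC_aH; apply: ppart_inC.
  (* Adjunction moves the factor [y] of [p_mu] to the other side, next to [x eps_lam], which is the
     image of [p_lam] under a rank one Schur map; so [z] makes the pairing vanish. *)
  apply: contra_neq nz => z; apply: dot_ext => x.
  rewrite (lin_map0 (dot_linr _)) dotC dot_aH star_eps dot_aH {1}/ppart /npart aHM dot_aH star_y.
  rewrite {1}/eps -/(rank1 x (ppart lam) (ppart lam)).
  have [rl rH] := rank1_Schur x (ppart lam).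
  by rewrite -!rH z (lin_map0 rl) (lin_map0 (dot_linr _)).
have [x ex] := e1 ltac:(by apply/eqP; rewrite eqn_leq h1 h2).
exact/esym/(lword_inj pl pm ex).
Qed.

Section Killed.
Variable j : H.
Hypothesis pj : forall mu, is_partition r mu -> forall b, aH (aH (ppart mu) b) (star j) = 0.

(** A raising operator lowers the letter sum of [i], so by induction [u] is a highest weight vector
    and lies in some [p_mu H]. *)
Lemma killed_words i b : posw i -> aH (aH (vb i) b) j = 0.
Proof.
move: {2}(wsum i).+1 (ltnSn (wsum i)) => n; elim: n i b => [//|n IH] i b le Pi.
set u := aH _ j.
have hu : hw u.
  move=> k k0; rewrite /u !Eop_aH Eop_vb !(lin_map_sum (aH_linl _)) big1 // => p /eqP ip.
  rewrite !(lin_mapZ (aH_linl _)) IH ?scaler0 //; last by apply: posw_upd.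
  suff : (wsum (upd i p k%:Z) < wsum i)%N by lia.
  rewrite /wsum (bigD1 p) //= [X in (_ < X)%N](bigD1 p) //= upd_same ip.
  rewrite (eq_bigr (fun q => `|i q|%N)) => [|q qp]; last by rewrite upd_out.
  by rewrite !absz_nat ltn_add2r.
have Cu : inC i u by do 2!apply: inC_aH; rewrite -{2}(wperm1 i); apply: inC_vb.
apply/eqP; apply: contraT => u0.
have [t lt] := leadP i u0; have Y := lead_yam Pi Cu hu lt.
have [y et] := Cu t lt.1.
have [mu [w [pm ew]]] := yam_partition Y.
have [x [c [T c0 eL ep]]] := ppart_gen pm.
have Ct : inC (wperm (lword r mu) x) u.
  move=> k /Cu[y' ->]; exists (pcomp (pcomp (x^-1)%g w) (pcomp (y^-1)%g y')).
  rewrite -!wpermM; have -> : wperm (wperm (lword r mu) x) (x^-1)%g = lword r mu.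
    by rewrite wpermM /pcomp mulVg wperm1.
  by rewrite -ew et; rewrite (wpermM i) /pcomp mulVg wperm1.
have [h eh] := hw_gen T Ct hu.
have eu : u = aH (ppart mu) (c^-1 *: h).
  by rewrite (lin_mapZ (aH_linr _)) ep (lin_mapZ (aH_linl _)) scalerA mulVf // scale1r.
(* One factor [u] is written as [p_mu h], the [j] of the other is moved across as [star j], and
   [p_mu h] is killed by it. *)
have : dot u u = 0.
  by rewrite {2}eu {1}/u dot_aH pj // (lin_map0 (dot_linr _)).
by move/dot_eq0 => e; rewrite e eqxx in u0.
Qed.

End Killed.

Lemma killed_zero (j : H) :
  (forall mu, is_partition r mu -> forall b, aH (aH (ppart mu) b) (star j) = 0) -> j = 0.
Proof.
move=> pj; apply: (@aH_om_inj _ D); rewrite (lin_map0 (aH_linr _)) -[om D]aH1.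
by apply: killed_words => // p; rewrite ffunE.
Qed.

(** Orthogonality to the ideal says that [eps_mu b] times [star j] vanishes; [p_mu] may replace
    [eps_mu] since [p_mu eps_mu] is a nonzero multiple of [p_mu]. *)
Lemma hdot_eps_kill (j : H) mu : is_partition r mu ->
  (forall a b, hdot (hM (hM a (eps mu)) b) j = 0) ->
  forall b, aH (aH (ppart mu) b) (star j) = 0.
Proof.
move=> pm h b.
have e : hM (hM (eps mu) b) (star j) = 0.
  apply: hdot_ext => a; rewrite hdot_Mr starK -(starK a) -hdot_Ml hMA h.
  by rewrite /hdot big1 // => w _; rewrite hc0 mul0r.
apply/eqP; rewrite -[_ == 0]orFb -(negPf (ceps_neq0 pm)) -scaler_eq0.
rewrite -(lin_mapZ (aH_linl _)) -(lin_mapZ (aH_linl _)) -ppart_epsE //.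
by rewrite -(aHM (ppart mu)) -(aHM (ppart mu)) e (lin_map0 (aH_linr _)).
Qed.

Lemma eps_complete : exists s : seq (seq nat * (H * H)),
  (forall x, x \in map fst s -> is_partition r x) /\
  hb 1%g = \sum_(x <- s) hM (hM x.2.1 (eps x.1)) x.2.2.
Proof.
pose P := allparts r.
pose T : finType := (('I_(size P)) * (sym r * sym r))%type.
pose X (t : T) := hM (hM (hb t.2.1) (eps (nth [::] P t.1))) (hb t.2.2).
have pP (m : 'I_(size P)) : is_partition r (nth [::] P m).
  by rewrite -mem_allparts mem_nth.
have [[c e]|[j [jX j1]]] := span_or_separate X (hb 1%g).
  exists [seq (nth [::] P t.1, (c t *: hb t.2.1, hb t.2.2)) | t : T <- enum T]; split.
    by move=> x; rewrite -map_comp => /mapP[t _ ->]; apply: pP.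
  rewrite e big_map big_enum; apply: eq_bigr => t _ /=.
  by rewrite /X (lin_mapZ (hM_linl _)) (lin_mapZ (hM_linl _)).
have jE mu a b : is_partition r mu -> hdot (hM (hM a (eps mu)) b) j = 0.
  rewrite -mem_allparts => mP.
  have [m em] : exists m : 'I_(size P), mu = nth [::] P m.
    have h : (index mu P < size P)%N by rewrite index_mem.
    by exists (Ordinal h); rewrite /= nth_index.
  have lin1 : @islin F H F^o (fun x => hdot x j).
    move=> k x y; rewrite /hdot scaler_sumr -big_split; apply: eq_bigr => w _ /=.
    by rewrite hcD hcZ /GRing.scale /=; ring.
  apply: (@heq_lin _ D F^o (fun a => hdot (hM (hM a (eps mu)) b) j) (fun=> 0)) => [||wa].
  - apply: (lin_map_comp lin1); apply: (lin_map_comp (hM_linl _) (hM_linl _)).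
  - by move=> k x y; rewrite scaler0 addr0.
  apply: (@heq_lin _ D F^o (fun b => hdot (hM (hM (hb wa) (eps mu)) b) j) (fun=> 0)) => [||wb'].
  - exact: (lin_map_comp lin1 (hM_linr _)).
  - by move=> k x y; rewrite scaler0 addr0.
  by have := jX (m, (wa, wb')); rewrite /X /= -em.
have jE' mu a b : is_partition r mu -> hdot (hM (hM a (eps mu)) b) (star j) = 0.
  move=> pm; rewrite -hdot_star starK !starM star_eps hMA; exact: jE.
have j0 : j = 0.
  by apply: killed_zero => mu pm; apply: hdot_eps_kill => // a b; apply: jE.
case/eqP: j1; rewrite j0 /hdot big1 // => w _.
by rewrite hc0 mulr0.
Qed.

End Blocks.

(** * The bimodule decomposition *)

Section Decomposition.
Variables (r : nat) (D : hecke_data r).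
Local Notation F := (hF D).
Local Notation V := (hV D).
Local Notation H := (hH D).
Local Notation vb := (vb D).
Local Notation hb := (hb D).
Local Notation om := (om D).
Local Notation ppart := (ppart D).
Local Notation eps := (eps D).
Local Notation spe := (spe D).
Implicit Types (mu lam : seq nat) (u q : V) (h s : H) (phi : V -> V).

Definition inW (z phi : V -> V) := exists2 f, Schur f & forall u, phi u = f (z u).
Definition inS mu s := exists h, s = hM (spe mu) h.
Definition lcomb (a : F) (f g : V -> V) : V -> V := fun u => a *: f u + g u.
Definition bilin (W : lmodType F) (z : V -> V) mu (g : (V -> V) -> H -> W) : Prop :=
  (forall a phi1 phi2 s, inW z phi1 -> inW z phi2 -> inS mu s ->
     g (lcomb a phi1 phi2) s = a *: g phi1 s + g phi2 s) /\
  (forall a phi s1 s2, inW z phi -> inS mu s1 -> inS mu s2 ->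
     g phi (a *: s1 + s2) = a *: g phi s1 + g phi s2).

Variable z : seq nat -> V -> V.
Hypothesis zS : forall mu, is_partition r mu -> Schur (z mu).
Hypothesis z0 : forall mu, is_partition r mu ->
  forall i : word r, (forall x, i <> wperm (varpi r) x) -> z mu (vb i) = 0.
Hypothesis z1 : forall mu, is_partition r mu ->
  forall h, z mu (aH om h) = aH (ppart mu) h.

Lemma Schur_comp (f g : V -> V) : Schur f -> Schur g -> Schur (fun u : V => f (g u)).
Proof.
move=> [fl fH] [gl gH]; split; first exact: (lin_map_comp fl gl).
by move=> u h; rewrite gH fH.
Qed.

Lemma Schur_lcomb a (f g : V -> V) : Schur f -> Schur g -> Schur (lcomb a f g).
Proof.
move=> [fl fH] [gl gH]; split.
  by move=> c x y; rewrite /lcomb fl gl !scalerDr !scalerA [a * c]mulrC addrACA.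
by move=> u h; rewrite /lcomb fH gH aH_linl.
Qed.

Lemma Schur0 : Schur (fun _ : V => 0 : V).
Proof.
split; first by move=> a x y; rewrite scaler0 addr0.
by move=> u h; rewrite (lin_map0 (aH_linl _)).
Qed.

Section Fixed.
Variable mu : seq nat.
Hypothesis pm : is_partition r mu.

Lemma z_om : z mu om = ppart mu.
Proof. by rewrite -[om]aH1 z1 // aH1. Qed.

Lemma inW_Schur phi : inW (z mu) phi -> Schur phi.
Proof.
move=> [f fS e]; have -> : phi = fun u => f (z mu u) by apply: functional_extensionality.
by apply: Schur_comp => //; apply: zS.
Qed.

Lemma inW_lcomb a phi1 phi2 : inW (z mu) phi1 -> inW (z mu) phi2 -> inW (z mu) (lcomb a phi1 phi2).
Proof.
move=> [f fS e] [g gS e']; exists (lcomb a f g); first exact: Schur_lcomb.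
by move=> u; rewrite /lcomb e e'.
Qed.

Lemma inW0 : inW (z mu) (fun=> 0).
Proof. by exists (fun=> 0); [exact: Schur0|]. Qed.

(** Elements of the Weyl module vanish on words outside the content [varpi], and the others span
    [om H]. Hence the Weyl module is identified with its values at [om]. *)
Lemma inW_ext phi1 phi2 : inW (z mu) phi1 -> inW (z mu) phi2 -> phi1 om = phi2 om -> phi1 = phi2.
Proof.
move=> W1 W2 e; have [l1 H1] := inW_Schur W1; have [l2 H2] := inW_Schur W2.
apply: functional_extensionality; apply: veq_lin => // i.
have [[x ->]|no] := classic (exists x, i = wperm (varpi r) x).
  by rewrite -aH_om H1 H2 e.
case: W1 W2 => [f1 [f1l _] e1] [f2 [f2l _] e2].
have zi : z mu (vb i) = 0 by apply: z0 => // x ex; apply: no; exists x.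
by rewrite e1 e2 zi (lin_map0 f1l) (lin_map0 f2l).
Qed.

(** The element of the Weyl module whose value at [om] is [u eps_mu]. *)
Definition Phi u : V -> V := fun y => rank1 u (ppart mu) (z mu y).

Lemma Phi_inW u : inW (z mu) (Phi u).
Proof. by exists (rank1 u (ppart mu)); [exact: rank1_Schur|]. Qed.

Lemma Phi_om u : Phi u om = aH u (eps mu).
Proof. by rewrite /Phi z_om. Qed.

Lemma inW_om phi : inW (z mu) phi -> exists2 f, Schur f & phi om = f (ppart mu).
Proof. by move=> [f fS e]; exists f => //; rewrite e z_om. Qed.

Lemma Phi_lcomb a u u' : Phi (a *: u + u') = lcomb a (Phi u) (Phi u').
Proof.
apply: inW_ext; [exact: Phi_inW|by apply: inW_lcomb; exact: Phi_inW|].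
by rewrite /lcomb !Phi_om aH_linl.
Qed.

(* Since [eps mu = star (npart mu) * spe mu], this sends [(phi, spe mu * h)] to [phi om * h]. *)
Definition beta phi s : V := aH (phi om) (hM ((ceps D mu)^-1 *: star (npart D mu)) s).

Lemma betaE phi h : inW (z mu) phi -> beta phi (hM (spe mu) h) = aH (phi om) h.
Proof.
move=> /inW_om[f [fl fH] e]; rewrite /beta e (lin_mapZ (hM_linl _)) (lin_mapZ (aH_linr _)).
rewrite hMA -eps_specht // aHM -fH ppart_epsE // (lin_mapZ fl) (lin_mapZ (aH_linl _)) scalerA.
by rewrite mulVf ?scale1r //; apply: ceps_neq0.
Qed.

Lemma beta_bilin : bilin (z mu) mu beta.
Proof.
split=> a.
  by move=> phi1 phi2 s _ _ _; rewrite /beta /lcomb aH_linl.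
by move=> phi s1 s2 _ _ _; rewrite /beta hM_linr aH_linr.
Qed.

Lemma beta_hM phi s h : beta phi (hM s h) = aH (beta phi s) h.
Proof. by rewrite /beta hMA aHM. Qed.

Lemma bilin0 (W : lmodType F) (g : (V -> V) -> H -> W) s :
  bilin (z mu) mu g -> inS mu s -> g (fun=> 0) s = 0.
Proof.
move=> [g1 _] hs; have := g1 (-1) (fun=> 0) (fun=> 0) s inW0 inW0 hs.
have -> : lcomb (-1) (fun=> 0) (fun=> 0) = (fun=> 0).
  by apply: functional_extensionality => u; rewrite /lcomb scaler0 addr0.
by rewrite scaleN1r addNr.
Qed.

Lemma inS_spe h : inS mu (hM (spe mu) h).
Proof. by exists h. Qed.

Lemma bilin_sum (W : lmodType F) (g : (V -> V) -> H -> W) phi (I : Type) (l : seq I) (P : pred I) (c : I -> F) (b : I -> H) :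
  bilin (z mu) mu g -> inW (z mu) phi ->
  g phi (hM (spe mu) (\sum_(x <- l | P x) c x *: b x)) =
  \sum_(x <- l | P x) c x *: g phi (hM (spe mu) (b x)).
Proof.
move=> [_ g2] hp.
have L : islin (fun h => g phi (hM (spe mu) h)).
  by move=> a x y; rewrite hM_linr g2 //; apply: inS_spe.
rewrite (lin_map_sum L); apply: eq_bigr => x _; exact: (lin_mapZ L).
Qed.

End Fixed.

Section Completed.
Variable l : seq (seq nat * (H * H)).
Hypothesis lP : forall x, x \in map fst l -> is_partition r x.
Hypothesis l1 : hb 1%g = \sum_(x <- l) hM (hM x.2.1 (eps x.1)) x.2.2.

Lemma l_part x : x \in l -> is_partition r x.1.
Proof. by move=> xl; apply: lP; apply: map_f. Qed.

Lemma split_vec u : u = \sum_(x <- l) aH (aH (aH u x.2.1) (eps x.1)) x.2.2.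
Proof.
rewrite -[LHS]aH1 l1 (lin_map_sum (aH_linr _)); apply: eq_bigr => x _.
by rewrite !aHM.
Qed.

Lemma split_beta u : u = \sum_(x <- l) beta x.1 (Phi x.1 (aH u x.2.1)) (hM (spe x.1) x.2.2).
Proof.
rewrite {1}[u]split_vec big_seq [RHS]big_seq; apply: eq_bigr => x /l_part px.
by rewrite betaE ?Phi_om //; apply: Phi_inW.
Qed.

(** The map is dictated by [split_beta]. On [beta phi s], orthogonality leaves only the terms of the
    same partition, where [Phi] returns a scalar multiple of [phi]. *)
Lemma decomp_exists (W : lmodType F) (gam : seq nat -> (V -> V) -> H -> W) :
  (forall mu, is_partition r mu -> bilin (z mu) mu (gam mu)) ->
  exists g : V -> W, islin g /\
    forall mu phi s, is_partition r mu -> inW (z mu) phi -> inS mu s ->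
      g (beta mu phi s) = gam mu phi s.
Proof.
move=> gB; exists (fun u => \sum_(x <- l) gam x.1 (Phi x.1 (aH u x.2.1)) (hM (spe x.1) x.2.2)); split.
  move=> a u u'; rewrite scaler_sumr -big_split big_seq [RHS]big_seq; apply: eq_bigr => x /l_part px /=.
  by rewrite aH_linl Phi_lcomb // (gB x.1 px).1 //; try exact: inS_spe; apply: Phi_inW.
move=> lam phi _ pl hphi [h ->]; rewrite betaE //.
have [f [fl fH] ef] := inW_om pl hphi.
(* The scalar by which [p_lam h a eps_lam] is a multiple of [p_lam]; applying [f] carries it over to
   [phi]. *)
pose ch (x : seq nat * (H * H)) := chi lam (aH (aH (ppart lam) (hM h x.2.1)) (eps lam)).
have term x : x \in l -> gam x.1 (Phi x.1 (aH (aH (phi om) h) x.2.1)) (hM (spe x.1) x.2.2) =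
    if x.1 == lam then ch x *: gam lam phi (hM (spe lam) x.2.2) else 0.
  move=> xl; have px := l_part xl; case: eqP => [e|ne].
    rewrite e; have -> : Phi lam (aH (aH (phi om) h) x.2.1) = lcomb (ch x) phi (fun=> 0).
      apply: (inW_ext pl); [exact: Phi_inW|apply: inW_lcomb => //; exact: inW0|].
      rewrite Phi_om // /lcomb addr0 ef -!fH -(aHM _ h).
      by rewrite ppart_eps // (lin_mapZ fl).
    rewrite (gB lam pl).1 //; [|exact: inW0|exact: inS_spe].
    by rewrite (bilin0 (gB lam pl) (inS_spe _ _)) addr0.
  have -> : Phi x.1 (aH (aH (phi om) h) x.2.1) = fun=> 0.
    apply: (inW_ext px); [exact: Phi_inW|exact: inW0|].
    rewrite Phi_om // ef -!fH -(aHM _ h) eps_orth // ?(lin_map0 fl) //.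
    by move=> e; apply: ne.
  exact: (bilin0 (gB x.1 px) (inS_spe _ _)).
rewrite big_seq (eq_bigr _ term) -big_seq -big_mkcond.
rewrite -(bilin_sum _ _ _ _ (gB lam pl) hphi).
(* What remains is an identity in the Specht module; by [specht0] it follows from the decomposition
   of [p_lam h] given by [split_vec]. *)
congr gam; apply/eqP; rewrite eq_sym -subr_eq0 -(lin_mapB (hM_linr _)); apply/eqP.
apply: specht0 => //; rewrite (lin_mapB (aH_linr _)); apply/eqP; rewrite subr_eq0; apply/eqP.
rewrite {1}[aH (ppart lam) h]split_vec (lin_map_sum (aH_linr _)) big_seq [RHS]big_mkcond [RHS]big_seq.
apply: eq_bigr => x xl; have px := l_part xl.
rewrite -(aHM (ppart lam) h); case: eqP => [e|ne]; last first.
  by rewrite eps_orth // ?(lin_map0 (aH_linl _)) // => e; apply: ne.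
by rewrite e ppart_eps // (lin_mapZ (aH_linl _)) (lin_mapZ (aH_linr _)).
Qed.

Lemma decomp_uniq (W : lmodType F) (gam : seq nat -> (V -> V) -> H -> W) (g1 g2 : V -> W) :
  islin g1 -> islin g2 ->
  (forall mu phi s, is_partition r mu -> inW (z mu) phi -> inS mu s ->
     g1 (beta mu phi s) = gam mu phi s /\ g2 (beta mu phi s) = gam mu phi s) ->
  forall u, g1 u = g2 u.
Proof.
move=> L1 L2 h u; rewrite [u]split_beta !lin_map_sum // big_seq [RHS]big_seq.
apply: eq_bigr => x /l_part px.
by have [-> ->] := h x.1 (Phi x.1 (aH u x.2.1)) (hM (spe x.1) x.2.2) px (Phi_inW _ _) (inS_spe _ _).
Qed.

End Completed.
End Decomposition.

(** * Complete reducibility *)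

Section CompleteReducibility.
Variables (r : nat) (D : hecke_data r).
Local Notation F := (hF D).
Local Notation V := (hV D).
Local Notation H := (hH D).
Local Notation hb := (hb D).
Local Notation ppart := (ppart D).
Local Notation eps := (eps D).
Implicit Types (u q : V) (P Q R : V -> Prop).

Definition submod P : Prop :=
  P 0 /\ (forall a u w, P u -> P w -> P (a *: u + w)) /\
  (forall f u, Schur f -> P u -> P (f u)).

(** Each such submodule [V eps_mu b] turns out to be zero or simple, and finitely many of them span
    [V]. *)
Definition isotypic mu (b : H) u := exists u', u = aH (aH u' (eps mu)) b.
Definition sumP P Q u := exists a b, P a /\ Q b /\ u = a + b.

Lemma submodD P u w : submod P -> P u -> P w -> P (u + w).
Proof. by move=> [_ [h _]] pu pw; rewrite -[u]scale1r; apply: h. Qed.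

Lemma submodN P u : submod P -> P u -> P (- u).
Proof. by move=> [h0 [h _]] pu; rewrite -scaleN1r -[_ *: _]addr0; apply: h. Qed.

Lemma isotypic_submod mu b : submod (isotypic mu b).
Proof.
split; first by exists 0; rewrite !(lin_map0 (aH_linl _)).
split=> [a u w [u' ->] [w' ->]|f u [fl fH] [u' ->]].
  by exists (a *: u' + w'); rewrite !aH_linl.
by exists (f u'); rewrite !fH.
Qed.

Lemma sumP_submod P Q : submod P -> submod Q -> submod (sumP P Q).
Proof.
move=> [p0 [pl pS]] [q0 [ql qS]]; split; first by exists 0, 0; rewrite addr0.
split=> [a _ _ [x [y [px [qy ->]]]] [x' [y' [px' [qy' ->]]]]|f _ fS [x [y [px [qy ->]]]]].
  exists (a *: x + x'), (a *: y + y'); split; [exact: pl|split; [exact: ql|]].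
  by rewrite scalerDr addrACA.
exists (f x), (f y); split; [exact: pS|split; [exact: qS|]].
exact: (lin_mapD fS.1).
Qed.

(* For [q] in [V eps], [rank1 (u eps) q] maps [q] to a nonzero multiple of [u eps], because [eps H eps] is a line. *)
Lemma isotypic_simple mu b R : is_partition r mu -> submod R ->
  (forall u, isotypic mu b u -> R u) \/ (forall u, isotypic mu b u -> R u -> u = 0).
Proof.
move=> pm [_ [_ RS]].
have [[u0 [[u' e0] [R0 n0]]]|no] := classic (exists u, isotypic mu b u /\ (R u /\ u <> 0)); last first.
  by right=> u iu Ru; apply: NNPP => nu; apply: no; exists u.
left=> _ [u1 ->]; pose q := aH u' (eps mu).
have q0 : q != 0.
  apply/eqP => q0; apply: n0; rewrite e0 -/q q0; exact: (lin_map0 (aH_linl _)).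
have ipq : ip q q = hM (hM (eps mu) (ip u' u')) (eps mu).
  by rewrite /q ip_aHl ip_aHr star_eps hMA.
(* The scalar by which [ip q q], of the form [eps h eps], acts on [V eps]; it does not depend on the
   vector, and testing it on [q] shows that it is nonzero. *)
pose d := chi mu (aH (aH (aH (ppart mu) (eps mu)) (ip u' u')) (eps mu)).
have act u2 : aH (aH u2 (eps mu)) (ip q q) = d *: aH u2 (eps mu).
  have [fl fH] := rank1_Schur u2 (ppart mu).
  have -> : aH u2 (eps mu) = rank1 u2 (ppart mu) (ppart mu) by [].
  rewrite ipq !aHM -!fH -(aHM (ppart mu) (eps mu)) ppart_eps // (lin_mapZ fl).
  by rewrite aHM.
have d0 : d != 0.
  by apply: contra_neq (dot_ip_neq0 q0) => d0; rewrite {1}/q act d0 scale0r.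
have -> : aH (aH u1 (eps mu)) b = d^-1 *: rank1 (aH u1 (eps mu)) q u0.
  rewrite e0 -/q (rank1_Schur _ _).2 /rank1 act (lin_mapZ (aH_linl _)) scalerA.
  by rewrite mulVf // scale1r.
have S := rank1_Schur (aH u1 (eps mu)) q; apply: (RS (fun u => d^-1 *: rank1 (aH u1 (eps mu)) q u)) R0.
split; first exact: lin_map_scale S.1.
by move=> u h; rewrite S.2 (lin_mapZ (aH_linl _)).
Qed.

(** Greedy construction: a zero or simple summand either lies in [P + Q] already or meets it
    trivially and is added to [Q]. *)
Lemma complement P (l : seq (seq nat * H)) : submod P ->
  (forall x, x \in map fst l -> is_partition r x) ->
  exists Q, [/\ submod Q, (forall u, P u -> Q u -> u = 0) &
    forall x, x \in l -> forall u, isotypic x.1 x.2 u -> sumP P Q u].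
Proof.
move=> sP; elim: l => [_|x l IH lP].
  exists (fun u => u = 0); split=> //; split=> //; split=> [a u w -> ->|f u fS ->].
    by rewrite scaler0 addr0.
  exact: (lin_map0 fS.1).
have [Q [sQ dQ hQ]] : exists Q, [/\ submod Q, (forall u, P u -> Q u -> u = 0) &
    forall x, x \in l -> forall u, isotypic x.1 x.2 u -> sumP P Q u].
  by apply: IH => y yl; apply: lP; rewrite inE yl orbT.
have px : is_partition r x.1 by apply: lP; rewrite inE eqxx.
have [inc|dis] := isotypic_simple x.2 px (sumP_submod sP sQ).
  by exists Q; split=> // y; rewrite inE => /orP[/eqP ->|/hQ].
have sM := isotypic_submod x.1 x.2.
exists (sumP Q (isotypic x.1 x.2)); split; first exact: sumP_submod.
  move=> u Pu [a [b [Qa [Mb e]]]]; have b0 : b = 0.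
    apply: dis => //; exists u, (- a); split=> //; split; first exact: submodN.
    by rewrite e addrC addKr.
  by apply: dQ => //; rewrite e b0 addr0.
move=> y; rewrite inE => /orP[/eqP ->|/hQ h] u iu.
  exists 0, u; split; [exact: sP.1|split; last by rewrite add0r].
  by exists 0, u; split; [exact: sQ.1|split; last by rewrite add0r].
have [a [b [Pa [Qb ->]]]] := h u iu; exists a, b; split=> //; split=> //.
by exists b, 0; split=> //; split; [exact: sM.1|rewrite addr0].
Qed.

Lemma completely_reducible P : submod P -> exists Q, submod Q /\
  (forall u, P u -> Q u -> u = 0) /\ (forall u, sumP P Q u).
Proof.
move=> sP; have [l [lP l1]] := eps_complete D.
have [|Q [sQ dQ hQ]] := @complement P [seq (x.1, x.2.2) | x <- l] sP.
  by move=> x; rewrite -map_comp; apply: lP.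
exists Q; split=> //; split=> // u; rewrite (split_vec l1 u) big_seq.
have sS := sumP_submod sP sQ.
apply: (big_ind (sumP P Q)) => [|a b|x xl]; first exact: sS.1.
  exact: submodD.
apply: (hQ (x.1, x.2.2)) => /=; last by exists (aH u x.2.1).
by apply/mapP; exists x.
Qed.

End CompleteReducibility.

(** * Application to the tensor space over Q(v) *)

(** Kept transparent, so that the abstract notions over it are convertible to those of the
    statement. *)
Definition Qv_data (r : nat) : hecke_data r.
Proof.
refine (@HeckeData r Qv vv (Omega r) (Hk r) (@bvec r) (fun u k => u@_k)
  (fun u => enum_fset (msupp u)) (@hbas r) (fun h w => h@_w)
  (@actT r) (@actH r) (@hmul r) vv_neq0 Qv_real _ _ _ _ _ _ _ _
  (@actT_coef r) _ _ (@actH_linr r) _ (@actHM r)).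
- exact: mcoeff_lin.
- exact: bvec_coef.
- by move=> u u'; case: (malgP u u').
- by move=> u; apply: fset_uniq.
- by move=> u i; rewrite -[LHS]/(i \in msupp u) -mcoeff_neq0.
- exact: mcoeff_lin.
- exact: mcoeff_bas.
- by move=> h h'; case: (malgP h h').
- by move=> i j; apply: etrans (actT_bvec i j) (actT_basE j i).
- exact: actT_quad.
- exact: actH_word.
Defined.

Lemma varpi_content_perm (r : nat) (i : word r) :
  varpi_content i -> exists x, i = wperm (varpi r) x.
Proof.
move=> /andP[/forallP c1 /forallP bd]; apply: same_counts => [p|p|c c0].
- by rewrite ffunE.
- by have /andP[] := bd p.
have cE (t : word r) : cnt r c t = #|[set p | t p == c%:Z]|.
  rewrite /cnt -sum1_card [RHS]big_mkcond; apply: eq_bigr => p _.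
  by rewrite ltn_ord inE /=; case: (_ == _).
rewrite !cE; case: (ltnP c.-1 r) => cr.
  have := c1 (Ordinal cr); rewrite /= prednK // => /eqP ->.
  rewrite (_ : [set p | varpi r p == c%:Z] = [set Ordinal cr]) ?cards1 //.
  apply/setP => p; rewrite !inE ffunE -val_eqE /=; lia.
rewrite !eq_card0 // => p; rewrite !inE; apply/negP => /eqP e.
  by have := bd p; rewrite e; lia.
by move: e; rewrite ffunE; have := ltn_ord p; lia.
Qed.

Section Instance.
Variable r : nat.
Let D := Qv_data r.

Lemma bilin_onE (W : lmodType Qv) z mu (g : (Omega r -> Omega r) -> Hk r -> W) :
  bilin_on z mu g <-> @bilin r D W z mu g.
Proof. by split. Qed.

Lemma SsubmodE (P : Omega r -> Prop) : Ssubmod P <-> @submod r D P.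
Proof. by split. Qed.

End Instance.

Theorem theorem10p6 (r : nat) (z : seq nat -> Omega r -> Omega r) :
  (forall mu : seq nat, is_partition r mu -> zspec mu (z mu)) ->
  (exists beta : seq nat -> (Omega r -> Omega r) -> Hk r -> Omega r,
      bimod_tensor_decomp z beta) /\
  S_completely_reducible r.
Proof.
move=> zP; pose D := Qv_data r.
have zS mu : is_partition r mu -> @Schur r D (z mu) by move=> /zP[].
have z0 mu : is_partition r mu -> forall i : word r, (forall x, i <> wperm (varpi r) x) ->
    z mu (vb D i) = 0.
  move=> /zP[_ [h _]] i no; apply: h; apply/negP => /varpi_content_perm[x ex].
  exact: no ex.
have z1 mu : is_partition r mu -> forall h, z mu (aH (om D) h) = aH (ppart D mu) h.
  by move=> /zP[_ [_ h]] x; apply: etrans (h x) _; exact: (@aHM r D).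
split; last first.
  move=> P /SsubmodE sP; have [Q [sQ [d c]]] := completely_reducible sP.
  by exists Q; split; [apply/SsubmodE|split].
have [l [lP l1]] := eps_complete D.
exists (@beta r D); split; first by move=> mu pm; apply/bilin_onE; apply: beta_bilin.
split.
  move=> mu f phi s _ [fl fH] _ _; rewrite /beta; exact/esym/fH.
split.
  by move=> mu phi s h _ _ _; exact: (@beta_hM r D).
move=> V gam gB; have gB' mu (pm : is_partition r mu) : @bilin r D V (z mu) mu (gam mu).
  by apply/bilin_onE; apply: gB.
split.
  have [g [gl gE]] := @decomp_exists r D z zS z0 z1 l lP l1 V gam gB'.
  by exists g; split=> [|mu phi s pm W S]; [exact: gl|apply: gE => //].
move=> g1 g2 L1 L2 h; apply: (@decomp_uniq r D z z1 l lP l1 V gam g1 g2 L1 L2).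
by move=> mu phi s pm W S; apply: h.
Qed.
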